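(* Let $n\ge 2$ and $k\in\{1,\dots,n-1\}$. The data $(\mathcal X_k,\gamma,\varphi_i,\varepsilon_i,e_i,f)$ (with $i$ ranging over $\mathbb Z/n\mathbb Z$) defined below form a decorated geometric crystal of type $A_{n-1}^{(1)}$.
   Context: Notation: $[i,j]=\{m\in\mathbb Z: i\le m\le j\}$, $[n]=[1,n]$. Points $M$ of the Grassmannian $\mathrm{Gr}(k,n)$ of $k$-dimensional subspaces of $\mathbb C^n$ are represented as column spans of full-rank $n\times k$ matrices; for a $k$-subset $J\subset[n]$, the Plücker coordinate $P_J(M)$ is the maximal minor of such a matrix using the rows in $J$ in increasing order (defined up to a common scalar). Conventions: for any finite set $I$ of integers, $P_I(M):=P_{I'}(M)$ where $I'\subset[n]$ is the set of residues modulo $n$ (taken in $[n]$) of the elements of $I$, and $P_{I'}(M)=0$ if $I'$ does not have exactly $k$ elements. $\mathrm{GL}_n(\mathbb C)$ acts on $\mathrm{Gr}(k,n)$ by left multiplication of representing matrices. $E_{ij}$ denotes an $n\times n$ matrix unit; $x_i(a)=\mathrm{Id}+aE_{i,i+1}$ for $i\in[n-1]$ and $x_0(a)=\mathrm{Id}+aE_{n1}$. Let $\mathcal X_k=\mathrm{Gr}(k,n)\times\mathbb C^\times$, with points $(M,t)$. For $i\in\mathbb Z/n\mathbb Z$ (represented in $\{0,\dots,n-1\}$; $\delta_{i,a}$ means $1$ if $i\equiv a\pmod n$, else $0$) define: - $\gamma(M,t)=(\gamma_1,\dots,\gamma_n)$ with $\gamma_i=P_{[i-k+1,i]}(M)/P_{[i-k,i-1]}(M)$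 for $1\le i\le k$ and $\gamma_i=t\,P_{[i-k+1,i]}(M)/P_{[i-k,i-1]}(M)$ for $k+1\le i\le n$; - $\varphi_i(M,t)=t^{-\delta_{i,0}}\dfrac{P_{[i-k+1,i-1]\cup\{i+1\}}(M)}{P_{[i-k+1,i]}(M)}$, $\quad\varepsilon_i(M,t)=t^{-\delta_{i,k}}\dfrac{P_{[i-k+1,i-1]\cup\{i+1\}}(M)\,P_{[i-k+1,i]}(M)}{P_{[i-k,i-1]}(M)\,P_{[i-k+2,i+1]}(M)}$; - $e_i^c(M,t)=(M',t)$ where $M'=x_i\big(\frac{c-1}{\varphi_i(M,t)}\big)\cdot M$ if $i\ne0$ and $M'=x_0\big(\frac{(-1)^{k-1}}{t}\cdot\frac{c-1}{\varphi_0(M,t)}\big)\cdot M$ if $i=0$; - $f(M,t)=\sum_{i\in[n],\,i\ne k}\dfrac{P_{\{i-k\}\cup[i-k+2,i]}(M)}{P_{[i-k+1,i]}(M)}+t\,\dfrac{P_{[2,k]\cup\{n\}}(M)}{P_{[1,k]}(M)}$. Definitions. A geometric pre-crystal of type $A_{n-1}^{(1)}$ consists of an irreducible complex algebraic variety $X$, a rational map $\gamma:X\to(\mathbb C^\times)^n$, for each $i\in\mathbb Z/n\mathbb Z$ rational functions $\varphi_i,\varepsilon_i:X\to\mathbb C^\times$ not identically zero, and for each $i$ a rational unital action $e_i:\mathbb C^\times\times X\to X$, $(c,x)\mapsto e_i^c(x)$ (unital: $e_i^1(x)$ is defined and equals $x$ for all $x$; action: $e_i^{c_1}e_i^{c_2}=e_i^{c_1c_2}$),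 such that: (1) $\varepsilon_i(x)=\varphi_i(x)\alpha_i(\gamma(x))$ where $\alpha_i(z_1,\dots,z_n)=z_i/z_{i+1}$ (indices mod $n$); (2) $\gamma(e_i^c(x))=\alpha_i^\vee(c)\gamma(x)$ (componentwise product), where $\alpha_i^\vee(c)$ has $c$ in component $i$, $c^{-1}$ in component $i+1$ (mod $n$), and $1$ elsewhere; (3) $\varphi_i(e_i^c(x))=c^{-1}\varphi_i(x)$ and $\varepsilon_i(e_i^c(x))=c\,\varepsilon_i(x)$. It is a geometric crystal if moreover, when $n\ge3$, for all $i,j\in\mathbb Z/n\mathbb Z$ and $c_1,c_2\in\mathbb C^\times$: $e_i^{c_1}e_j^{c_2}=e_j^{c_2}e_i^{c_1}$ if $|i-j|>1$, and $e_i^{c_1}e_j^{c_1c_2}e_i^{c_2}=e_j^{c_2}e_i^{c_1c_2}e_j^{c_1}$ if $|i-j|=1$ (distance taken in $\mathbb Z/n\mathbb Z$); for $n=2$ no such relation is required. A decorated geometric crystal is a geometric crystal with a rational function $f:X\to\mathbb C^\times$ (the decoration) such that $f(e_i^c(x))=f(x)+\frac{c-1}{\varphi_i(x)}+\frac{c^{-1}-1}{\varepsilon_i(x)}$ for all $x$ and all $i$. *)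

(* Defs.v *)
From HB Require Import structures.
From mathcomp Require Import all_boot all_order all_algebra.
From mathcomp Require Import mpoly.

Set Implicit Arguments.
Unset Strict Implicit.
Unset Printing Implicit Defensive.
Import GRing.Theory.
Local Open Scope ring_scope.

(** * Algebraic varieties

  A variety over [K] is given by a set of points with finitely many affine
  charts, each identifying a subset of the points with a Zariski closed subset
  of an affine space [K^m]. *)

Record atlas (K : fieldType) (X : Type) := Atlas {
  chart_idx : finType;
  chart_dim : chart_idx -> nat;
  chart_dom : chart_idx -> X -> Prop;
  (* only the values on [chart_dom a] are relevant *)
  chart : forall a : chart_idx, X -> 'rV[K]_(chart_dim a) }.

Definition peval (K : fieldType) (m : nat) (p : {mpoly K[m]}) (v : 'rV[K]_m) : K :=
  p.@[fun j => v 0 j].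

Definition algebraic_set (K : fieldType) (m : nat) (V : 'rV[K]_m -> Prop) : Prop :=
  exists S : {mpoly K[m]} -> Prop,
    forall v, V v <-> (forall p, S p -> peval p v = 0).

Definition zclosed (K : fieldType) (X : Type) (A : atlas K X) (Z : X -> Prop) : Prop :=
  forall a : chart_idx A, exists S : {mpoly K[chart_dim a]} -> Prop,
    forall x, chart_dom a x ->
      (Z x <-> (forall p, S p -> peval p (chart a x) = 0)).

Definition zopen (K : fieldType) (X : Type) (A : atlas K X) (U : X -> Prop) : Prop :=
  zclosed A (fun x => ~ U x).

(* [g] restricts to a regular function on the open set [U]: locally it is a
   quotient of polynomials in the coordinates of some chart. *)
Definition regular (K : fieldType) (X : Type) (A : atlas K X)
    (U : X -> Prop) (g : X -> K) : Prop :=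
  forall x, U x ->
  exists (a : chart_idx A) (p q : {mpoly K[chart_dim a]}),
    [/\ chart_dom a x,
        peval q (chart a x) != 0
      & forall y, U y -> chart_dom a y -> peval q (chart a y) != 0 ->
          g y = peval p (chart a y) / peval q (chart a y)].

Record is_variety (K : fieldType) (X : Type) (A : atlas K X) : Prop := IsVariety {
  var_cover : forall x, exists a : chart_idx A, chart_dom a x;
  var_inj : forall (a : chart_idx A) x y,
    chart_dom a x -> chart_dom a y -> chart a x = chart a y -> x = y;
  var_affine : forall a : chart_idx A,
    algebraic_set (fun v => exists2 x, chart_dom a x & chart a x = v);
  var_dom_open : forall a : chart_idx A, zopen A (chart_dom a);
  var_transition : forall (a b : chart_idx A) (j : 'I_(chart_dim b)) x,
    chart_dom a x -> chart_dom b x ->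
    exists p q : {mpoly K[chart_dim a]},
      peval q (chart a x) != 0 /\
      forall y, chart_dom a y -> chart_dom b y -> peval q (chart a y) != 0 ->
        chart b y 0 j = peval p (chart a y) / peval q (chart a y);
  (* the diagonal is closed in the product of any two charts *)
  var_separated : forall a b : chart_idx A,
    algebraic_set (fun w => exists x,
      [/\ chart_dom a x, chart_dom b x & w = row_mx (chart a x) (chart b x)]) }.

Definition irreducible_space (K : fieldType) (X : Type) (A : atlas K X) : Prop :=
  (exists x : X, True) /\
  forall Z1 Z2 : X -> Prop, zclosed A Z1 -> zclosed A Z2 ->
    (forall x, Z1 x \/ Z2 x) -> (forall x, Z1 x) \/ (forall x, Z2 x).

Definition prod_atlas (K : fieldType) (X Y : Type) (A : atlas K X) (B : atlas K Y) :
    atlas K (X * Y) :=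
  @Atlas K (X * Y)%type
    (chart_idx A * chart_idx B)%type
    (fun ab => chart_dim ab.1 + chart_dim ab.2)%N
    (fun ab xy => chart_dom ab.1 xy.1 /\ chart_dom ab.2 xy.2)
    (fun ab xy => row_mx (chart ab.1 xy.1) (chart ab.2 xy.2)).

(** ** Rational maps

  A rational map from an irreducible variety is represented by a partial
  function (valued in [option]) that is a morphism on a nonempty, hence dense,
  open domain.  The domain need not be the largest possible one. *)

Definition preim_opt (X Y : Type) (F : X -> option Y) (V : Y -> Prop) : X -> Prop :=
  fun x => exists2 y, F x = Some y & V y.

Definition is_rational (K : fieldType) (X Y : Type) (A : atlas K X) (B : atlas K Y)
    (F : X -> option Y) : Prop :=
  (exists x y, F x = Some y) /\
  forall V : Y -> Prop, zopen B V ->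
    zopen A (preim_opt F V) /\
    forall g : Y -> K, regular B V g ->
      regular A (preim_opt F V) (fun x => oapp g 0 (F x)).

Definition generically (K : fieldType) (X : Type) (A : atlas K X) (P : X -> Prop) : Prop :=
  exists U : X -> Prop,
    [/\ zopen A U, exists x, U x & forall x, U x -> P x].

(* Equality of rational maps; in particular both sides, which may be composites,
   are required to be defined on a nonempty open set. *)
Definition rat_eq (K : fieldType) (X Y : Type) (A : atlas K X)
    (F G : X -> option Y) : Prop :=
  generically A (fun x => exists2 y, F x = Some y & G x = Some y).

(* The rational map represented by [F] is defined at [x], with value [y]:
   some representative of it is. *)
Definition rat_value (K : fieldType) (X Y : Type) (A : atlas K X) (B : atlas K Y)
    (F : X -> option Y) (x : X) (y : Y) : Prop :=
  exists G : X -> option Y, [/\ is_rational A B G, rat_eq A F G & G x = Some y].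

(** ** Tori *)

Definition Gm (K : fieldType) : Type := {c : K | c != 0}.

Definition to_Gm (K : fieldType) (a : K) : option (Gm K) := insub a.

Definition gm1 (K : fieldType) : Gm K := exist _ 1 (oner_neq0 K).

Definition gm_mul (K : fieldType) (c d : Gm K) : Gm K :=
  exist _ (val c * val d) (mulf_neq0 (valP c) (valP d)).

Definition Gm_atlas (K : fieldType) : atlas K (Gm K) :=
  @Atlas K (Gm K) unit (fun _ => 2) (fun _ _ => True)
    (fun _ c => \row_(j < 2) (if j == 0 then val c else (val c)^-1)).

(* Components are indexed by residues modulo [n]: the ordinal [0] stands for the
   component [n]. *)
Definition torus (K : fieldType) (n : nat) : Type :=
  {z : 'rV[K]_n | [forall i, z 0 i != 0]}.

Definition torus_atlas (K : fieldType) (n : nat) : atlas K (torus K n) :=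
  @Atlas K (torus K n) unit (fun _ => n + n)%N (fun _ _ => True)
    (fun _ z => row_mx (val z) (map_mx GRing.inv (val z))).

(** * Geometric crystals of type A_(n-1)^(1)

  The index set Z/nZ is ['I_n], with successor [ordS]. *)

Section Crystals.
Variables (K : fieldType) (n : nat) (X : Type) (A : atlas K X).

Definition alpha (i : 'I_n) (z : torus K n) : K := val z 0 i / val z 0 (ordS i).

Definition alpha_vee (i : 'I_n) (c : Gm K) (j : 'I_n) : K :=
  if j == i then val c else if j == ordS i then (val c)^-1 else 1.

Definition adjacent (i j : 'I_n) : bool := (j == ordS i) || (i == ordS j).

Record rational_unital_action (e : Gm K -> X -> option X) : Prop := RationalUnitalAction {
  act_rational : is_rational (prod_atlas (Gm_atlas K) A) A (fun cx => e cx.1 cx.2);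
  act_unital : forall x, rat_value A A (e (gm1 K)) x x;
  act_mul : forall c1 c2,
    rat_eq A (fun x => obind (e c1) (e c2 x)) (e (gm_mul c1 c2)) }.

Variables (gamma : X -> option (torus K n)) (phi eps : 'I_n -> X -> option (Gm K))
          (e : 'I_n -> Gm K -> X -> option X).

Record geometric_precrystal : Prop := GeometricPrecrystal {
  gpc_variety : is_variety A;
  gpc_irreducible : irreducible_space A;
  gpc_gamma : is_rational A (torus_atlas K n) gamma;
  (* being valued in [Gm], these are not identically zero *)
  gpc_phi : forall i, is_rational A (Gm_atlas K) (phi i);
  gpc_eps : forall i, is_rational A (Gm_atlas K) (eps i);
  gpc_act : forall i, rational_unital_action (e i);
  gpc_eps_phi : forall i, generically A (fun x => exists u v z,
    [/\ eps i x = Some u, phi i x = Some v, gamma x = Some z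
      & val u = val v * alpha i z]);
  gpc_gamma_e : forall i c, generically A (fun x => exists y z z',
    [/\ e i c x = Some y, gamma x = Some z, gamma y = Some z'
      & forall j, val z' 0 j = alpha_vee i c j * val z 0 j]);
  gpc_phi_e : forall i c, generically A (fun x => exists y v v',
    [/\ e i c x = Some y, phi i x = Some v, phi i y = Some v'
      & val v' = (val c)^-1 * val v]);
  gpc_eps_e : forall i c, generically A (fun x => exists y u u',
    [/\ e i c x = Some y, eps i x = Some u, eps i y = Some u'
      & val u' = val c * val u]) }.

Record geometric_crystal : Prop := GeometricCrystal {
  gc_precrystal : geometric_precrystal;
  gc_commute : (3 <= n)%N -> forall (i j : 'I_n) (c1 c2 : Gm K),
    i != j -> ~~ adjacent i j ->
    rat_eq A (fun x => obind (e i c1) (e j c2 x))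
             (fun x => obind (e j c2) (e i c1 x));
  gc_braid : (3 <= n)%N -> forall (i j : 'I_n) (c1 c2 : Gm K),
    adjacent i j ->
    rat_eq A
      (fun x => obind (e i c1) (obind (e j (gm_mul c1 c2)) (e i c2 x)))
      (fun x => obind (e j c2) (obind (e i (gm_mul c1 c2)) (e j c1 x))) }.

Record decorated_geometric_crystal (f : X -> option (Gm K)) : Prop :=
    DecoratedGeometricCrystal {
  dgc_crystal : geometric_crystal;
  dgc_rational : is_rational A (Gm_atlas K) f;
  dgc_decoration : forall i c, generically A (fun x => exists y u v w w',
    [/\ e i c x = Some y, eps i x = Some u /\ phi i x = Some v,
        f x = Some w, f y = Some w'
      & val w' = val w + (val c - 1) / val v + ((val c)^-1 - 1) / val u]) }.

End Crystals.

(** * The Grassmannian *)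

Definition Gr (K : fieldType) (k n : nat) : Type :=
  {V : {vspace 'cV[K]_n} | \dim V == k}.

Section Grassmannian.
Variables (K : fieldType) (k n : nat).

(* A matrix with column span [M].  Plücker coordinates depend on this choice by
   a common scalar only. *)
Definition gr_mx (M : Gr K k n) : 'M[K]_(n, k) :=
  \matrix_(r < n, j < k) (vbasis (val M))`_j r 0.

(* The rows of [B] in [J], in increasing order ([0] if [J] does not have [k]
   elements).  The ordinal [r] is the index of the row numbered [r + 1]. *)
Definition rows_mx (B : 'M[K]_(n, k)) (J : {set 'I_n}) : 'M[K]_k :=
  match #|J| =P k with
  | ReflectT eqJ => rowsub (fun a : 'I_k => enum_val (cast_ord (esym eqJ) a)) B
  | ReflectF _ => 0
  end.

Definition maxminor (B : 'M[K]_(n, k)) (J : {set 'I_n}) : K :=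
  if #|J| == k then \det (rows_mx B J) else 0.

Definition residues (I : seq int) : {set 'I_n} :=
  [set r : 'I_n | has (fun m : int => (r.+1%:Z == m %[mod n%:Z])%Z) I].

Definition plucker (I : seq int) (M : Gr K k n) : K :=
  maxminor (gr_mx M) (residues I).

(* The chart at [J] sends [M] to its representing matrix whose rows in [J] form
   the identity. *)
Definition Gr_atlas : atlas K (Gr K k n) :=
  @Atlas K (Gr K k n) {set 'I_n} (fun _ => n * k)%N
    (fun J M => maxminor (gr_mx M) J != 0)
    (fun J M => mxvec (gr_mx M *m invmx (rows_mx (gr_mx M) J))).

(* Meaningful for invertible [g], which preserves dimensions. *)
Definition gr_act (g : 'M[K]_n) (M : Gr K k n) : Gr K k n :=
  insubd M (linfun (mulmx g) @: val M)%VS.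

Lemma gr_actE (g : 'M[K]_n) (M : Gr K k n) :
  g \in unitmx -> val (gr_act g M) = (linfun (mulmx g) @: val M)%VS.
Proof.
move=> gu; rewrite /gr_act val_insubd limg_dim_eq; first by rewrite (valP M).
apply/eqP; rewrite -subv0; apply/subvP=> v.
rewrite memv_cap memv_ker lfunE /= => /andP[_ /eqP h].
by rewrite memv0 -(mulKmx gu v) h mulmx0.
Qed.

(* [Id + a E_(i, i+1)] for [0 < i], [Id + a E_(n, 1)] for [i = 0]: the ordinals
   [ord_pred i] and [i] number the rows [i] (or [n] if [i = 0]) and [i + 1]. *)
Definition xmx (i : 'I_n) (a : K) : 'M[K]_n := 1%:M + a *: delta_mx (ord_pred i) i.

End Grassmannian.

(** * The data on Gr(k,n) x C^* *)

Definition zint (a b : int) : seq int :=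
  [seq a + m%:Z | m <- iota 0 (if a <= b then `|b - a|%N.+1 else 0%N)].

Section Data.
Variables (K : fieldType) (n k : nat).

Definition Xk : Type := (Gr K k n * Gm K)%type.

Definition Xk_atlas : atlas K Xk := prod_atlas (Gr_atlas K k n) (Gm_atlas K).

Implicit Types (i : 'I_n) (x : Xk).

(* In the next three definitions [insub] and [to_Gm] are defined exactly where all Plücker
   coordinates involved are nonzero, since [_ / 0 = 0]. *)

(* [~~ (1 <= i <= k)] covers [i = 0], which stands for the component [n > k]. *)
Definition Xgamma x : option (torus K n) :=
  insub (\row_(i < n)
    ((if (1 <= i <= k)%N then 1 else val x.2) *
     (plucker (zint (i%:Z - k%:Z + 1) i%:Z) x.1 /
      plucker (zint (i%:Z - k%:Z) (i%:Z - 1)) x.1))).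

Definition Xphi i x : option (Gm K) :=
  to_Gm (val x.2 ^- (i == 0 :> nat)%N *
    (plucker (rcons (zint (i%:Z - k%:Z + 1) (i%:Z - 1)) (i%:Z + 1)) x.1 /
     plucker (zint (i%:Z - k%:Z + 1) i%:Z) x.1)).

Definition Xeps i x : option (Gm K) :=
  to_Gm (val x.2 ^- (i == k :> nat)%N *
    ((plucker (rcons (zint (i%:Z - k%:Z + 1) (i%:Z - 1)) (i%:Z + 1)) x.1 *
      plucker (zint (i%:Z - k%:Z + 1) i%:Z) x.1) /
     (plucker (zint (i%:Z - k%:Z) (i%:Z - 1)) x.1 *
      plucker (zint (i%:Z - k%:Z + 2) (i%:Z + 1)) x.1))).

Definition Xe i (c : Gm K) x : option Xk :=
  if Xphi i x is Some v then
    let a := (val c - 1) / val v in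
    let a' := if (i == 0 :> nat)%N then (-1) ^+ k.-1 / val x.2 * a else a in
    Some (gr_act (xmx i a') x.1, x.2)
  else None.

Definition Xf_value x : K :=
  (\sum_(1 <= i < n.+1 | i != k)
      plucker ((i%:Z - k%:Z) :: zint (i%:Z - k%:Z + 2) i%:Z) x.1 /
      plucker (zint (i%:Z - k%:Z + 1) i%:Z) x.1) +
  val x.2 * (plucker (rcons (zint 2 k%:Z) n%:Z) x.1 / plucker (zint 1 k%:Z) x.1).

Definition Xf x : option (Gm K) :=
  if [forall i : 'I_n, plucker (zint (i%:Z - k%:Z + 1) i%:Z) x.1 != 0]
  then to_Gm (Xf_value x) else None.

End Data.

(* Main.v *)
(**
  Represent a point of Gr(k,n) by an n x k matrix and number its rows by all integers m, with
  v_(m+n) = (-1)^(k-1) v_m.  With this sign every Plücker coordinate of a cyclically increasing index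
  sequence is the determinant of the rows in that order, also when the sequence wraps around, and
  e_i^c becomes the same row operation for every i, namely v_m := v_m + (c-1) (P_i / N_i) v_(m+1)
  for m = i mod n, where P_i and N_i have the index sets [i-k+1, i] and [i-k+1, i-1] U {i+1}; the
  variable t cancels.  It multiplies P_i by c and fixes N_i and P_j for j <> i mod n, which gives the
  axioms of a pre-crystal and the commutation relations.  The braid relation and the decoration
  formula reduce to the three-term Plücker relations
    N_(i+1) N_i = R P_i + P_(i+1) T    and    Q_i N_i = S P_i + P_(i-1) P_(i+1),
  which follow from Cramer's rule.

  Regularity is expressed by germs in a chart, which form a ring.  Any two points (M1, t1), (M2, t2)
  lie on the rational curve of the affine combinations of representing matrices and of t1, t2;
  hence Gr(k,n) x K^* is irreducible, and finitely many generic conditions hold simultaneously.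
*)
Require Import Defs.
From mathcomp Require Import all_boot all_order all_algebra.
From mathcomp Require Import perm mpoly ring zify.
From mathcomp Require Import complex reals.
From Stdlib Require Import Classical_Prop.

Set Implicit Arguments.
Unset Strict Implicit.
Unset Printing Implicit Defensive.
Import Order.TTheory GRing.Theory Num.Theory.
Local Open Scope ring_scope.

(** * Polynomial functions and germs of regular functions *)

(** Under e_i^c a coordinate can change only if its index set contains i but not i+1 modulo n:
    otherwise row i does not occur, or the added multiple of row i+1 is already among the rows.
    Among the cyclic intervals only [i-k+1, i] has this property, whence P_i becomes P_i +
    (c-1)(P_i/N_i) N_i = c P_i. In f only the terms at i and i+k change: the term at i+k produces
    (c-1)/phi_i directly, the term at i produces (1/c-1)/eps_i through the second Plücker relation.
    Partiality is the other obstacle. [Xe] is undefined wherever [Xphi] is, so unitality at every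
    point uses the identity as a second representative of e_i^1, and the composites in the braid
    relation are generically defined because e_i^c is dominant. Since f takes values in K^*, it must
    also be shown not to vanish identically. *)

Record fun_ring (K : fieldType) (T : Type) (S : (T -> K) -> Prop) : Prop := FunRing {
  fr_ext : forall g h, g =1 h -> S g -> S h;
  fr_cst : forall c, S (fun _ => c);
  fr_add : forall g h, S g -> S h -> S (fun x => g x + h x);
  fr_mul : forall g h, S g -> S h -> S (fun x => g x * h x) }.

Section FunRing.
Variables (K : fieldType) (T : Type) (S : (T -> K) -> Prop).
Hypothesis frS : fun_ring S.

Lemma fr_opp g : S g -> S (fun x => - g x).
Proof.
move=> Sg; apply: fr_ext (fr_mul frS (fr_cst frS (-1)) Sg) => // x.
by rewrite mulN1r.
Qed.

Lemma fr_sub g h : S g -> S h -> S (fun x => g x - h x).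
Proof. by move=> Sg Sh; apply: fr_add => //; apply: fr_opp. Qed.

Lemma fr_sum (I : Type) (r : seq I) (P : pred I) (g : I -> T -> K) :
  (forall i, P i -> S (g i)) -> S (fun x => \sum_(i <- r | P i) g i x).
Proof.
move=> Sg; elim: r => [|i r IHr].
  by apply: fr_ext (fr_cst frS 0) => // x; rewrite big_nil.
case Pi: (P i); last by apply: fr_ext IHr => // x; rewrite big_cons Pi.
by apply: fr_ext (fr_add frS (Sg _ Pi) IHr) => // x; rewrite big_cons Pi.
Qed.

Lemma fr_prod (I : Type) (r : seq I) (P : pred I) (g : I -> T -> K) :
  (forall i, P i -> S (g i)) -> S (fun x => \prod_(i <- r | P i) g i x).
Proof.
move=> Sg; elim: r => [|i r IHr].
  by apply: fr_ext (fr_cst frS 1) => // x; rewrite big_nil.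
case Pi: (P i); last by apply: fr_ext IHr => // x; rewrite big_cons Pi.
by apply: fr_ext (fr_mul frS (Sg _ Pi) IHr) => // x; rewrite big_cons Pi.
Qed.

Lemma fr_exp g m : S g -> S (fun x => g x ^+ m).
Proof.
move=> Sg; elim: m => [|m IHm]; first exact: fr_cst.
by apply: fr_ext (fr_mul frS Sg IHm) => // x; rewrite exprS.
Qed.

(** The closure properties of [fun_ring] are collected for this: with [S] the polynomial functions
    it is composition, with [S] the germs at a point it keeps polynomial expressions regular, and
    with [S] the univariate polynomials it restricts a polynomial to a line. *)
Lemma fr_peval m (p : {mpoly K[m]}) (h : T -> 'rV[K]_m) :
  (forall j, S (fun x => h x 0 j)) -> S (fun x => peval p (h x)).
Proof.
move=> Sh; apply: (fr_ext frS (g := fun x => \sum_(m <- msupp p) p@_m * \prod_i h x 0 i ^+ m i)).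
  by move=> x; rewrite /peval mevalE.
apply: fr_sum => mm _; apply: fr_mul => //; first exact: fr_cst.
by apply: fr_prod => i _; apply: fr_exp.
Qed.

Definition mx_in m p (h : T -> 'M[K]_(m, p)) := forall i j, S (fun x => h x i j).

Lemma mx_in_cst m p (B : 'M[K]_(m, p)) : mx_in (fun _ => B).
Proof. by move=> i j; apply: fr_cst. Qed.

Lemma mx_in_add m p (g h : T -> 'M[K]_(m, p)) :
  mx_in g -> mx_in h -> mx_in (fun x => g x + h x).
Proof.
by move=> Sg Sh i j; apply: fr_ext (fr_add frS (Sg i j) (Sh i j)) => // x; rewrite mxE.
Qed.

Lemma mx_in_scale m p (a : T -> K) (g : T -> 'M[K]_(m, p)) :
  S a -> mx_in g -> mx_in (fun x => a x *: g x).
Proof.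
by move=> Sa Sg i j; apply: fr_ext (fr_mul frS Sa (Sg i j)) => // x; rewrite mxE.
Qed.

Lemma mx_in_mul m p q (g : T -> 'M[K]_(m, p)) (h : T -> 'M[K]_(p, q)) :
  mx_in g -> mx_in h -> mx_in (fun x => g x *m h x).
Proof.
move=> Sg Sh i j; apply: (fr_ext frS (g := fun x => \sum_l g x i l * h x l j)).
  by move=> x; rewrite mxE.
by apply: fr_sum => l _; apply: fr_mul.
Qed.

Lemma mx_in_mxvec m p (g : T -> 'M[K]_(m, p)) : mx_in g -> mx_in (fun x => mxvec (g x)).
Proof.
move=> Sg i j; case/mxvec_indexP: j => j l.
by apply: fr_ext (Sg j l) => // x; rewrite ord1 mxvecE.
Qed.

Lemma mx_in_vec_mx m p (g : T -> 'rV[K]_(m * p)) : mx_in g -> mx_in (fun x => vec_mx (g x)).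
Proof. by move=> Sg i j; apply: fr_ext (Sg 0 (mxvec_index i j)) => // x; rewrite mxE. Qed.

Lemma mx_in_lsubmx m p q (g : T -> 'M[K]_(m, p + q)) :
  mx_in g -> mx_in (fun x => lsubmx (g x)).
Proof. by move=> Sg i j; apply: fr_ext (Sg i (lshift q j)) => // x; rewrite mxE. Qed.

Lemma mx_in_rsubmx m p q (g : T -> 'M[K]_(m, p + q)) :
  mx_in g -> mx_in (fun x => rsubmx (g x)).
Proof. by move=> Sg i j; apply: fr_ext (Sg i (rshift p j)) => // x; rewrite mxE. Qed.

Lemma mx_in_row_mx m p q (g : T -> 'M[K]_(m, p)) (h : T -> 'M[K]_(m, q)) :
  mx_in g -> mx_in h -> mx_in (fun x => row_mx (g x) (h x)).
Proof.
move=> Sg Sh i j; case: (split_ordP j) => l ->.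
  by apply: fr_ext (Sg i l) => // x; rewrite row_mxEl.
by apply: fr_ext (Sh i l) => // x; rewrite row_mxEr.
Qed.

Lemma fr_det m (h : T -> 'M[K]_m) : mx_in h -> S (fun x => \det (h x)).
Proof.
move=> Sh.
apply: (fr_ext frS (g := fun x => \sum_(s : 'S_m) (-1) ^+ s * \prod_i h x i (s i))) => //.
by apply: fr_sum => s _; apply: fr_mul => //; [apply: fr_cst | apply: fr_prod].
Qed.

Lemma mx_in_adj m (h : T -> 'M[K]_m) : mx_in h -> mx_in (fun x => \adj (h x)).
Proof.
move=> Sh i j.
apply: (fr_ext frS (g := fun x => (-1) ^+ (j + i) * \det (row' j (col' i (h x))))).
  by move=> x; rewrite mxE.
apply: fr_mul => //; first exact: fr_cst.
apply: fr_det => r s.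
by apply: fr_ext (Sh (lift j r) (lift i s)) => // x; rewrite !mxE.
Qed.

End FunRing.

Section Polyfun.
Variables (K : fieldType) (m : nat).

Definition polyfun (g : 'rV[K]_m -> K) := exists p, forall v, g v = peval p v.

Lemma polyfun_ring : fun_ring polyfun.
Proof.
split.
- by move=> g h gh [p gp]; exists p => v; rewrite -gh.
- by move=> c; exists c%:MP => v; rewrite /peval mevalC.
- by move=> g h [p gp] [q hq]; exists (p + q) => v; rewrite gp hq /peval mevalD.
- by move=> g h [p gp] [q hq]; exists (p * q) => v; rewrite gp hq /peval mevalM.
Qed.

Lemma polyfun_coord j : polyfun (fun v => v 0 j).
Proof. by exists 'X_j => v; rewrite /peval mevalXU. Qed.

Lemma polyfun_id : mx_in polyfun (fun v : 'rV[K]_m => v).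
Proof. by move=> i j; rewrite ord1; apply: polyfun_coord. Qed.

Lemma algebraic_setP (I : Type) (g : I -> 'rV[K]_m -> K) (V : 'rV[K]_m -> Prop) :
  (forall i, polyfun (g i)) -> (forall v, V v <-> forall i, g i v = 0) -> algebraic_set V.
Proof.
move=> pg VE; exists (fun p => exists i, forall v, g i v = peval p v) => v.
rewrite VE; split=> [gv p [i gi]|pv i]; first by rewrite -gi.
by have [p gp] := pg i; rewrite gp; apply: pv; exists i.
Qed.

Lemma algebraic_setT : algebraic_set (fun _ : 'rV[K]_m => True).
Proof. by apply: (@algebraic_setP void (fun _ _ => 0)) => [[]|v]; split. Qed.

Lemma algebraic_setI (V W : 'rV[K]_m -> Prop) :
  algebraic_set V -> algebraic_set W -> algebraic_set (fun v => V v /\ W v).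
Proof.
move=> [S VS] [S' WS']; exists (fun p => S p \/ S' p) => v; rewrite VS WS'.
split=> [[Sv S'v] p []|SS']; [exact: Sv | exact: S'v |].
by split=> p Sp; apply: SS'; [left | right].
Qed.

Lemma algebraic_set_ext (V W : 'rV[K]_m -> Prop) :
  (forall v, V v <-> W v) -> algebraic_set V -> algebraic_set W.
Proof. by move=> VW [S VS]; exists S => v; rewrite -VW. Qed.

Lemma algebraic_set_preim d (h : 'rV[K]_m -> 'rV[K]_d) (V : 'rV[K]_d -> Prop) :
  mx_in polyfun h -> algebraic_set V -> algebraic_set (fun v => V (h v)).
Proof.
move=> ph [S VS].
apply: (@algebraic_setP {p | S p} (fun p v => peval (sval p) (h v))) => [[p Sp]|v].
  by apply: (fr_peval polyfun_ring) => j; apply: ph.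
by rewrite VS; split=> [Sv [p Sp]|Sv p Sp]; [apply: Sv | apply: (Sv (exist _ p Sp))].
Qed.

End Polyfun.

(** * Neighbourhoods and germs of regular functions on a variety *)

Section Germs.
Variables (K : fieldType) (X : Type) (A : atlas K X).

(** Principal open sets of a chart serve as neighbourhoods. In [creg] the quotient p/q needs to
    represent g only on such a smaller neighbourhood, so that sums, products and inverses require no
    bookkeeping of domains; [creg_quot] later absorbs the shrinking into p and q. *)
Definition cnear (a : chart_idx A) (x : X) (P : X -> Prop) :=
  exists2 q : {mpoly K[chart_dim a]}, peval q (chart a x) != 0 &
    forall y, chart_dom a y -> peval q (chart a y) != 0 -> P y.

Definition creg (a : chart_idx A) (x : X) (g : X -> K) :=
  exists p q : {mpoly K[chart_dim a]}, peval q (chart a x) != 0 /\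
    cnear a x (fun y => g y = peval p (chart a y) / peval q (chart a y)).

Definition near (x : X) (P : X -> Prop) := exists2 a, chart_dom a x & cnear a x P.

Definition reg_at (x : X) (g : X -> K) := exists2 a, chart_dom a x & creg a x g.

Section FixedChart.
Variables (a : chart_idx A) (x : X).

Lemma cnear_all (P : X -> Prop) : (forall y, chart_dom a y -> P y) -> cnear a x P.
Proof. by move=> allP; exists 1 => [|y ay _]; [rewrite /peval meval1 oner_neq0 | exact: allP]. Qed.

Lemma cnear_mono (P Q : X -> Prop) :
  (forall y, chart_dom a y -> P y -> Q y) -> cnear a x P -> cnear a x Q.
Proof. by move=> PQ [q qx qP]; exists q => // y ay qy; apply: PQ (qP y ay qy). Qed.

Lemma cnearI (P Q : X -> Prop) :
  cnear a x P -> cnear a x Q -> cnear a x (fun y => P y /\ Q y).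
Proof.
move=> [p px pP] [q qx qQ]; exists (p * q) => [|y ay].
  by rewrite /peval mevalM mulf_neq0.
by rewrite /peval mevalM mulf_eq0 negb_or => /andP[py qy]; split; [apply: pP | apply: qQ].
Qed.

Lemma cnear_neq0 (q : {mpoly K[chart_dim a]}) :
  peval q (chart a x) != 0 -> cnear a x (fun y => peval q (chart a y) != 0).
Proof. by move=> qx; exists q. Qed.

Lemma creg_near (g h : X -> K) : cnear a x (fun y => g y = h y) -> creg a x g -> creg a x h.
Proof.
move=> gh [p [q [qx gpq]]]; exists p, q; split=> //.
by apply: cnear_mono (cnearI gh gpq) => y _ [<-].
Qed.

Lemma creg_peval (p : {mpoly K[chart_dim a]}) : creg a x (fun y => peval p (chart a y)).
Proof.
exists p, 1; split; first by rewrite /peval meval1 oner_neq0.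
by apply: cnear_all => y _; rewrite /peval meval1 divr1.
Qed.

Lemma creg_polyfun g : polyfun g -> creg a x (fun y => g (chart a y)).
Proof.
move=> [p gp]; apply: creg_near (creg_peval p).
by apply: cnear_all => y _; rewrite gp.
Qed.

Lemma creg_ring : fun_ring (creg a x).
Proof.
split.
- by move=> g h gh; apply: creg_near; apply: cnear_all => y _; apply: gh.
- by move=> c; apply: (@creg_polyfun (fun _ => c)); apply: fr_cst (polyfun_ring _ _) _.
- move=> g h [p [q [qx gpq]]] [p' [q' [q'x hpq]]].
  exists (p * q' + p' * q), (q * q'); rewrite /peval mevalM mulf_neq0 //; split=> //.
  apply: cnear_mono (cnearI (cnearI (cnear_neq0 qx) (cnear_neq0 q'x)) (cnearI gpq hpq)) => y _.
  case=> [[]]; rewrite /peval => qy q'y [-> ->]; rewrite mevalD !mevalM.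
  by field; rewrite qy q'y.
- move=> g h [p [q [qx gpq]]] [p' [q' [q'x hpq]]].
  exists (p * p'), (q * q'); rewrite /peval mevalM mulf_neq0 //; split=> //.
  apply: cnear_mono (cnearI (cnearI (cnear_neq0 qx) (cnear_neq0 q'x)) (cnearI gpq hpq)) => y _.
  case=> [[]]; rewrite /peval => qy q'y [-> ->]; rewrite !mevalM.
  by field; rewrite qy q'y.
Qed.

Hypothesis ax : chart_dom a x.

Lemma cnear_self P : cnear a x P -> P x.
Proof. by move=> [q qx]; apply. Qed.

Lemma creg_num_neq0 g (p q : {mpoly K[chart_dim a]}) :
  cnear a x (fun y => g y = peval p (chart a y) / peval q (chart a y)) ->
  g x != 0 -> peval p (chart a x) != 0.
Proof. by move=> /cnear_self ->; apply: contraNneq => ->; rewrite mul0r. Qed.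

Lemma creg_neq0 g : creg a x g -> g x != 0 -> cnear a x (fun y => g y != 0).
Proof.
move=> [p [q [qx gpq]]] gx; have px := creg_num_neq0 gpq gx.
apply: cnear_mono (cnearI gpq (cnearI (cnear_neq0 px) (cnear_neq0 qx))) => y _ [-> [py qy]].
by rewrite mulf_neq0 ?invr_eq0.
Qed.

Lemma creg_inv g : creg a x g -> g x != 0 -> creg a x (fun y => (g y)^-1).
Proof.
(* No condition on zeros of p is needed away from x: with 0^-1 = 0 the inverse of p/q is q/p
   everywhere. *)
move=> [p [q [qx gpq]]] gx; exists q, p; rewrite (creg_num_neq0 gpq gx); split=> //.
by apply: cnear_mono gpq => y _ ->; rewrite invf_div.
Qed.

Lemma creg_div g h : creg a x g -> creg a x h -> h x != 0 -> creg a x (fun y => g y / h y).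
Proof. by move=> rg rh hx; apply: (fr_mul creg_ring) => //; apply: creg_inv. Qed.

Lemma creg_invmx m (h : X -> 'M[K]_m) :
  mx_in (creg a x) h -> h x \in unitmx -> mx_in (creg a x) (fun y => invmx (h y)).
Proof.
move=> rh; rewrite unitmxE unitfE => ux i j.
have rd := fr_det creg_ring rh.
apply: creg_near; last first.
  exact: (mx_in_scale creg_ring (creg_inv rd ux) (mx_in_adj creg_ring rh) i j).
apply: cnear_mono (creg_neq0 rd ux) => y _ uy.
by rewrite /invmx unitmxE unitfE uy.
Qed.

Lemma zopen_cnear U : zopen A U -> U x -> cnear a x U.
Proof.
move=> opU Ux; have [S SE] := opU a.
have [p [Sp px]] : exists p, S p /\ peval p (chart a x) <> 0.
  apply: NNPP => nex; have []// : ~ U x.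
  by apply/(SE x ax) => p Sp; apply: NNPP => px; apply: nex; exists p.
exists p => [|y ay /eqP py]; first exact/eqP.
by apply: NNPP => nUy; apply: py; move/(SE y ay): nUy; apply.
Qed.

End FixedChart.

Lemma cnear_zopen (U : X -> Prop) :
  (forall a x, chart_dom a x -> U x -> cnear a x U) -> zopen A U.
Proof.
(* The equations of the complement of [U] are all polynomials whose non-vanishing locus in the chart
   lies inside [U]. *)
move=> nU a; exists (fun p => forall y, chart_dom a y -> peval p (chart a y) != 0 -> U y).
move=> x ax; split=> [nUx p pU|pU Ux].
  by apply/eqP/negP => /negP px; apply: nUx; apply: pU.
by have [q qx qU] := nU a x ax Ux; move: qx; rewrite (pU q qU) eqxx.
Qed.

Hypothesis varA : is_variety A.

Lemma creg_chart (a b : chart_idx A) x : chart_dom a x -> chart_dom b x ->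
  cnear b x (chart_dom a) /\ mx_in (creg b x) (fun y => chart a y).
Proof.
move=> ax bx; have nab := zopen_cnear bx (var_dom_open varA a) ax.
split=> // i j; rewrite ord1; have [p [q [qx pq]]] := var_transition varA j bx ax.
exists p, q; split=> //; apply: cnear_mono (cnearI nab (cnear_neq0 qx)) => y by_ [ay qy].
exact: pq.
Qed.

(** With [reg_at_creg], this makes neighbourhoods and germs independent of the chart: the transition
    functions are germs, and a polynomial in germs is a germ. Conditions at a point can thus be
    compared in one common chart. *)
Lemma near_cnear x b P : near x P -> chart_dom b x -> cnear b x P.
Proof.
move=> [a ax [q qx qP]] bx; have [nab rab] := creg_chart ax bx.
have rq := fr_peval (creg_ring b x) q (rab 0).
apply: cnear_mono (cnearI nab (creg_neq0 bx rq qx)) => y _ [ay qy]; exact: qP.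
Qed.

Lemma reg_at_creg x b g : reg_at x g -> chart_dom b x -> creg b x g.
Proof.
move=> [a ax [p [q [qx gpq]]]] bx; have [nab rab] := creg_chart ax bx.
have gpq' := near_cnear (ex_intro2 _ _ a ax gpq) bx.
apply: (creg_near (g := fun y => peval p (chart a y) / peval q (chart a y))).
  by apply: cnear_mono gpq'.
by apply: creg_div => //; apply: (fr_peval (creg_ring b x)) => j; apply: rab.
Qed.

Lemma near_mono x (P Q : X -> Prop) : (forall y, P y -> Q y) -> near x P -> near x Q.
Proof. by move=> PQ [a ax nP]; exists a => //; apply: cnear_mono nP => y _; apply: PQ. Qed.

Lemma nearI x (P Q : X -> Prop) : near x P -> near x Q -> near x (fun y => P y /\ Q y).
Proof. by move=> [a ax nP] nQ; exists a => //; apply: cnearI => //; apply: near_cnear. Qed.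

Lemma near_forall (I : finType) x (P : I -> X -> Prop) :
  (forall i, near x (P i)) -> near x (fun y => forall i, P i y).
Proof.
move=> nP; have [a ax] := var_cover varA x.
suff: near x (fun y => forall i, i \in enum I -> P i y).
  by apply: near_mono => y Py i; apply: Py; rewrite mem_enum.
elim: (enum I) => [|i s IHs]; first by exists a => //; apply: cnear_all.
apply: near_mono (nearI (nP i) IHs) => y [Piy Py] j.
by rewrite inE => /predU1P[->|/Py].
Qed.

Lemma near_self x P : near x P -> P x.
Proof. by move=> [a ax]; apply: cnear_self. Qed.

Lemma zopen_near U : zopen A U <-> (forall x, U x -> near x U).
Proof.
split=> [opU x Ux|nU]; last by apply: cnear_zopen => a x ax Ux; apply: near_cnear (nU x Ux) ax.
by have [a ax] := var_cover varA x; exists a => //; apply: zopen_cnear.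
Qed.

Lemma zopenI (U V : X -> Prop) : zopen A U -> zopen A V -> zopen A (fun x => U x /\ V x).
Proof. by rewrite !zopen_near => opU opV x [Ux Vx]; apply: nearI; [apply: opU | apply: opV]. Qed.

Lemma reg_at_near x (g h : X -> K) : near x (fun y => g y = h y) -> reg_at x g -> reg_at x h.
Proof.
by move=> gh [a ax rg]; exists a => //; apply: creg_near rg; apply: near_cnear.
Qed.

Lemma reg_at_ring x : fun_ring (reg_at x).
Proof.
have [a ax] := var_cover varA x; split.
- by move=> g h gh [b bx rg]; exists b => //; apply: fr_ext (creg_ring b x) _ _ gh rg.
- by move=> c; exists a => //; apply: fr_cst (creg_ring a x) _.
- move=> g h rg rh; exists a => //.
  by apply: (fr_add (creg_ring a x)); apply: reg_at_creg.
- move=> g h rg rh; exists a => //.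
  by apply: (fr_mul (creg_ring a x)); apply: reg_at_creg.
Qed.

Lemma reg_at_neq0 x g : reg_at x g -> g x != 0 -> near x (fun y => g y != 0).
Proof. by move=> [a ax rg] gx; exists a => //; apply: creg_neq0. Qed.

Lemma reg_at_inv x g : reg_at x g -> g x != 0 -> reg_at x (fun y => (g y)^-1).
Proof. by move=> [a ax rg] gx; exists a => //; apply: creg_inv. Qed.

Lemma reg_at_div x g h : reg_at x g -> reg_at x h -> h x != 0 -> reg_at x (fun y => g y / h y).
Proof. by move=> rg rh hx; apply: (fr_mul (reg_at_ring x)) => //; apply: reg_at_inv. Qed.

Lemma reg_at_invmx x m (h : X -> 'M[K]_m) :
  mx_in (reg_at x) h -> h x \in unitmx -> mx_in (reg_at x) (fun y => invmx (h y)).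
Proof.
have [a ax] := var_cover varA x => rh ux i j; exists a => //.
by apply: creg_invmx => // r s; apply: reg_at_creg.
Qed.

Lemma regular_reg_at U g x : zopen A U -> U x -> regular A U g -> reg_at x g.
Proof.
move=> opU Ux /(_ x Ux) [a [p [q [ax qx gpq]]]]; exists a => //; exists p, q; split=> //.
apply: cnear_mono (cnearI (zopen_cnear ax opU Ux) (cnear_neq0 qx)) => y ay [Uy qy].
exact: gpq.
Qed.

Lemma reg_at_regular U g : (forall x, U x -> reg_at x g) -> regular A U g.
Proof.
move=> rg x Ux; have [a ax [p [q [qx [r rx gpq]]]]] := rg x Ux.
exists a, (p * r), (q * r); split=> [//||y Uy ay]; rewrite /peval !mevalM.
  by rewrite mulf_neq0.
rewrite mulf_eq0 negb_or => /andP[qy ry]; rewrite (gpq y ay ry) /peval.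
by field; rewrite qy ry.
Qed.

End Germs.

(** * A pointwise criterion for rational maps *)

Section RationalMaps.
Variables (K : fieldType) (X Y : Type) (A : atlas K X) (B : atlas K Y).
Hypotheses (varA : is_variety A) (varB : is_variety B).

(** It suffices to look at one chart of the target around each value. There an open set contains
    some locus q != 0 and a regular function is some p/q; composing p and q with the coordinates of
    F gives germs on the source. The default 0 of [oapp] is harmless because F is defined near x. *)
Lemma is_rationalI (F : X -> option Y) :
  (exists x y, F x = Some y) ->
  (forall x y, F x = Some y -> exists b : chart_idx B,
     [/\ chart_dom b y,
         near A x (fun x' => exists2 y', F x' = Some y' & chart_dom b y')
       & mx_in (reg_at A x) (fun x' => oapp (fun y' => chart b y') 0 (F x'))]) ->
  is_rational A B F.
Proof.
move=> neF locF; split=> // V opV.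
have opFV : zopen A (preim_opt F V).
  apply/(zopen_near varA) => x [y Fx Vy]; have [b [by_ nb rb]] := locF x y Fx.
  have [q qy qV] := zopen_cnear by_ opV Vy.
  have rq := fr_peval (reg_at_ring varA x) q (rb 0).
  have nq := reg_at_neq0 rq; rewrite Fx /= in nq.
  apply: near_mono (nearI varA nb (nq qy)) => x' [[y' Fx' by'] ].
  by rewrite Fx' => qy'; exists y' => //; apply: qV.
split=> // g rg; apply: reg_at_regular => x [y Fx Vy].
have [b [by_ nb rb]] := locF x y Fx.
have [p [q [qy [r ry gpq]]]] := reg_at_creg varB (regular_reg_at opV Vy rg) by_.
have rp s := fr_peval (reg_at_ring varA x) s (rb 0).
have nr := reg_at_neq0 (rp r); rewrite Fx /= in nr.
apply: (reg_at_near varA (g := fun x' =>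
  peval p (oapp (fun y' => chart b y') 0 (F x')) /
  peval q (oapp (fun y' => chart b y') 0 (F x')))).
  apply: near_mono (nearI varA nb (nr ry)) => x' [[y' Fx' by'] ].
  by rewrite Fx' /= => ry'; rewrite gpq.
by apply: (reg_at_div varA); rewrite ?Fx.
Qed.

End RationalMaps.

(** Provides the representative of e_i^1 that is defined at every point. *)
Lemma is_rational_id (K : fieldType) (X : Type) (A : atlas K X) :
  (exists x : X, True) -> is_rational A A Some.
Proof.
move=> [x _]; split; first by exists x, x.
have preimE V y : preim_opt Some V y <-> V y.
  by split=> [[_ [<-]]|Vy] //; exists y.
move=> V opV; split.
  move=> a; have [S SE] := opV a; exists S => y ay; rewrite -(SE y ay).
  by split=> nV Vy; apply: nV; apply/preimE.
move=> g rg y /preimE Vy; have [a [p [q [ay qy gpq]]]] := rg y Vy.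
by exists a, p, q; split=> // z /preimE; apply: gpq.
Qed.

(** * Products, affine varieties and irreducibility *)

Section Product.
Variables (K : fieldType) (X Y : Type) (A : atlas K X) (B : atlas K Y).
Hypotheses (varA : is_variety A) (varB : is_variety B).
Local Notation AB := (prod_atlas A B).

(** If p/q represents g where r != 0, then (p r)/(q r) represents g wherever its own denominator
    does not vanish. *)
Lemma creg_quot (Z : Type) (C : atlas K Z) (a : chart_idx C) x g : creg a x g ->
  exists p q : {mpoly K[chart_dim a]}, peval q (chart a x) != 0 /\
    forall y, chart_dom a y -> peval q (chart a y) != 0 ->
      g y = peval p (chart a y) / peval q (chart a y).
Proof.
move=> [p [q [qx [r rx gpq]]]]; exists (p * r), (q * r); rewrite /peval !mevalM.
rewrite mulf_neq0 //; split=> // y ay; rewrite !mevalM.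
rewrite mulf_eq0 negb_or => /andP[qy ry]; rewrite (gpq y ay ry) /peval.
by field; rewrite qy ry.
Qed.

Section Lift.
Variables (a : chart_idx A) (b : chart_idx B) (z : X * Y).

Lemma lift_fst (p : {mpoly K[chart_dim a]}) : exists q : {mpoly K[@chart_dim _ _ AB (a, b)]},
  forall w : X * Y, peval q (@chart _ _ AB (a, b) w) = peval p (chart a w.1).
Proof.
have [q qE] := fr_peval (polyfun_ring _ _) p
  (mx_in_lsubmx (polyfun_ring _ _) (@polyfun_id K (chart_dim a + chart_dim b)) 0).
by exists q => w; rewrite -qE row_mxKl.
Qed.

Lemma lift_snd (p : {mpoly K[chart_dim b]}) : exists q : {mpoly K[@chart_dim _ _ AB (a, b)]},
  forall w : X * Y, peval q (@chart _ _ AB (a, b) w) = peval p (chart b w.2).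
Proof.
have [q qE] := fr_peval (polyfun_ring _ _) p
  (mx_in_rsubmx (polyfun_ring _ _) (@polyfun_id K (chart_dim a + chart_dim b)) 0).
by exists q => w; rewrite -qE row_mxKr.
Qed.

Lemma cnear_fst P : cnear a z.1 P -> @cnear _ _ AB (a, b) z (fun w => P w.1).
Proof.
move=> [p px pP]; have [q qE] := lift_fst p.
by exists q => [|w [aw _]]; rewrite qE //; apply: pP.
Qed.

Lemma cnear_snd P : cnear b z.2 P -> @cnear _ _ AB (a, b) z (fun w => P w.2).
Proof.
move=> [p px pP]; have [q qE] := lift_snd p.
by exists q => [|w [_ bw]]; rewrite qE //; apply: pP.
Qed.

Lemma creg_fst g : creg a z.1 g -> @creg _ _ AB (a, b) z (fun w => g w.1).
Proof.
move=> [p [q [qx /cnear_fst gpq]]].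
have [[p' pE] [q' qE]] := (lift_fst p, lift_fst q).
exists p', q'; rewrite qE; split=> //.
by apply: cnear_mono gpq => w _; rewrite pE qE.
Qed.

Lemma creg_snd g : creg b z.2 g -> @creg _ _ AB (a, b) z (fun w => g w.2).
Proof.
move=> [p [q [qx /cnear_snd gpq]]].
have [[p' pE] [q' qE]] := (lift_snd p, lift_snd q).
exists p', q'; rewrite qE; split=> //.
by apply: cnear_mono gpq => w _; rewrite pE qE.
Qed.

End Lift.

Lemma prod_variety : is_variety AB.
Proof.
split.
- move=> [x y]; have [[a ax] [b by_]] := (var_cover varA x, var_cover varB y).
  by exists (a, b).
- move=> [a b] [x y] [x' y'] [/= ax by_] [/= ax' by'] /eq_row_mx[xx' yy'].
  by rewrite (var_inj varA ax ax' xx') (var_inj varB by_ by' yy').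
- move=> [a b] /=.
  have pid := @polyfun_id K (chart_dim a + chart_dim b).
  have hl := algebraic_set_preim (mx_in_lsubmx (polyfun_ring _ _) pid) (var_affine varA a).
  have hr := algebraic_set_preim (mx_in_rsubmx (polyfun_ring _ _) pid) (var_affine varB b).
  apply: algebraic_set_ext (algebraic_setI hl hr) => v; split.
    move=> [[x ax xv] [y by_ yv]]; exists (x, y) => //=.
    by rewrite xv yv hsubmxK.
  move=> [[x y] [/= ax by_] <-].
  by split; [exists x | exists y]; rewrite ?row_mxKl ?row_mxKr.
- move=> [a b]; apply: cnear_zopen => [[a' b'] z [/= az bz] [/= az' bz']].
  apply: (@cnear_mono _ _ _ _ _ (fun w => chart_dom a w.1 /\ chart_dom b w.2)) => //.
  apply: cnearI; [apply: cnear_fst | apply: cnear_snd].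
    exact: (zopen_cnear az (var_dom_open varA a) az').
  exact: (zopen_cnear bz (var_dom_open varB b) bz').
- move=> [a b] [a' b'] j z [/= az bz] [/= az' bz'].
  have [_ ra] := creg_chart varA az' az; have [_ rb] := creg_chart varB bz' bz.
  have rj : @creg _ _ AB (a, b) z (fun w => @chart _ _ AB (a', b') w 0 j).
    apply: (mx_in_row_mx (creg_ring (A := AB) (a, b) z)) => r s.
      exact: (creg_fst b (ra r s)).
    exact: (creg_snd a (rb r s)).
  have [p [q [qz pq]]] := creg_quot rj.
  by exists p, q; split=> // w dw _; apply: pq.
(* The product coordinates (x, y, x', y') are regrouped into (x, x') and (y, y'), which reduces the
   diagonal to those of the two factors. *)
- move=> [a b] [a' b'] /=.
  have pid := @polyfun_id K (chart_dim a + chart_dim b + (chart_dim a' + chart_dim b')).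
  have fr := polyfun_ring K (chart_dim a + chart_dim b + (chart_dim a' + chart_dim b')).
  have hl := algebraic_set_preim
    (mx_in_row_mx fr (mx_in_lsubmx fr (mx_in_lsubmx fr pid))
                     (mx_in_lsubmx fr (mx_in_rsubmx fr pid))) (var_separated varA a a').
  have hr := algebraic_set_preim
    (mx_in_row_mx fr (mx_in_rsubmx fr (mx_in_lsubmx fr pid))
                     (mx_in_rsubmx fr (mx_in_rsubmx fr pid))) (var_separated varB b b').
  apply: algebraic_set_ext (algebraic_setI hl hr) => v; split.
    move=> [[x [ax ax' /eq_row_mx[xv xv']]] [y [by_ by' /eq_row_mx[yv yv']]]].
    by exists (x, y); split=> //=; rewrite -xv -xv' -yv -yv' !hsubmxK.
  move=> [[x y] [[/= ax by_] [ax' by'] ->]].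
  by split; [exists x | exists y]; split; rewrite // ?row_mxKl ?row_mxKr ?row_mxKl ?row_mxKr.
Qed.

Lemma near_fst z P : near A z.1 P -> near AB z (fun w => P w.1).
Proof.
have [b bz] := var_cover varB z.2.
by move=> [a az nP]; exists (a, b) => //; apply: cnear_fst.
Qed.

Lemma near_snd z P : near B z.2 P -> near AB z (fun w => P w.2).
Proof.
have [a az] := var_cover varA z.1.
by move=> [b bz nP]; exists (a, b) => //; apply: cnear_snd.
Qed.

Lemma reg_at_fst z g : reg_at A z.1 g -> reg_at AB z (fun w => g w.1).
Proof.
have [b bz] := var_cover varB z.2.
by move=> [a az rg]; exists (a, b) => //; apply: creg_fst.
Qed.

Lemma reg_at_snd z g : reg_at B z.2 g -> reg_at AB z (fun w => g w.2).
Proof.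
have [a az] := var_cover varA z.1.
by move=> [b bz rg]; exists (a, b) => //; apply: creg_snd.
Qed.

End Product.

Definition affine_atlas (K : fieldType) (X : Type) (d : nat) (c : X -> 'rV[K]_d) : atlas K X :=
  @Atlas K X unit (fun _ => d) (fun _ _ => True) (fun _ => c).

Lemma affine_variety (K : fieldType) (X : Type) (d : nat) (c : X -> 'rV[K]_d) :
  injective c -> algebraic_set (fun v => exists x, c x = v) -> is_variety (affine_atlas c).
Proof.
move=> injc algc; split=> /=.
- by move=> x; exists tt.
- by move=> _ x y _ _; apply: injc.
- by move=> _; apply: algebraic_set_ext algc => v; split=> [[x cx]|[x _ cx]]; exists x.
(* The complement of the single chart domain is empty, hence cut out by the constant polynomial
   1. *)
- move=> _ a; exists (fun p => p = 1) => x _; split=> // /(_ 1 erefl)/eqP.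
  by rewrite /peval meval1 oner_eq0.
- move=> _ _ j x _ _; exists 'X_j, 1; split=> [|y _ _ _]; rewrite /peval meval1 ?oner_neq0 //.
  by rewrite divr1 mevalXU.
- move=> _ _; have pid := @polyfun_id K (d + d); have fr := polyfun_ring K (d + d).
  have hl := algebraic_set_preim (mx_in_lsubmx fr pid) algc.
  have hE : algebraic_set (fun w : 'rV[K]_(d + d) => lsubmx w = rsubmx w).
    apply: (algebraic_setP (g := fun j w => lsubmx w 0 j - rsubmx w 0 j)) => [j|w].
      apply: (fr_sub fr); first exact: (mx_in_lsubmx fr pid).
      exact: (mx_in_rsubmx fr pid).
    split=> [-> j|eqw]; first exact: subrr.
    by apply/rowP => j; apply/eqP; rewrite -subr_eq0 eqw.
  apply: algebraic_set_ext (algebraic_setI hl hE) => w; split.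
    by move=> [[x cx] lr]; exists x; split; rewrite // cx -[LHS]hsubmxK -lr.
  by move=> [x [_ _ ->]]; rewrite row_mxKl row_mxKr; split=> //; exists x.
Qed.

Lemma Gm_variety (K : fieldType) : is_variety (Gm_atlas K).
Proof.
apply: (affine_variety (c := fun c : Gm K => \row_(j < 2) (if j == 0 then val c else (val c)^-1))).
  by move=> c c' /rowP/(_ 0); rewrite !mxE /= => /val_inj.
have fr := polyfun_ring K 2.
apply: (algebraic_setP (g := fun (_ : unit) v => v 0 0 * v 0 1 - 1)) => [_|v].
  by apply: (fr_sub fr); [apply: (fr_mul fr); apply: polyfun_coord | apply: (fr_cst fr)].
split=> [[c <-] _|/(_ tt) /eqP]; first by rewrite !mxE /= divff ?subrr // (valP c).
rewrite subr_eq0 => /eqP v1.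
have v0 : v 0 0 != 0 by apply: contra_eq_neq v1 => ->; rewrite mul0r eq_sym oner_neq0.
exists (exist _ (v 0 0) v0); apply/rowP => j; rewrite mxE /=.
case: eqP => [->//|/eqP j0].
have -> : j = 1 by apply: val_inj; case: j j0 => [[|[|//]]].
by rewrite -[LHS]mulr1 -v1 mulKf.
Qed.

Lemma torus_variety (K : fieldType) (n : nat) : is_variety (torus_atlas K n).
Proof.
apply: (affine_variety (c := fun z : torus K n => row_mx (val z) (map_mx GRing.inv (val z)))).
  by move=> z z' /eq_row_mx[/val_inj].
have fr := polyfun_ring K (n + n).
apply: (algebraic_setP (g := fun (i : 'I_n) v => v 0 (lshift n i) * v 0 (rshift n i) - 1)) => [i|v].
  by apply: (fr_sub fr); [apply: (fr_mul fr); apply: polyfun_coord | apply: (fr_cst fr)].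
split=> [[z <-] i|v1].
  by rewrite row_mxEl row_mxEr mxE divff ?subrr //; apply: (forallP (valP z)).
have vv i : v 0 (lshift n i) * v 0 (rshift n i) = 1 by apply/eqP; rewrite -subr_eq0 v1.
have v0 i : v 0 (lshift n i) != 0.
  by apply: contra_eq_neq (vv i) => ->; rewrite mul0r eq_sym oner_neq0.
have zP : [forall i, lsubmx v 0 i != 0] by apply/forallP => i; rewrite mxE.
exists (exist _ (lsubmx v) zP); rewrite -[RHS]hsubmxK; congr row_mx.
by apply/rowP => i; rewrite !mxE -[LHS]mulr1 -(vv i) mulKf.
Qed.

Definition line_atlas (K : fieldType) : atlas K K := affine_atlas (fun s : K => const_mx s : 'rV_1).

Lemma line_variety (K : fieldType) : is_variety (line_atlas K).
Proof.
apply: affine_variety; first by move=> s s' /rowP/(_ 0); rewrite !mxE.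
apply: algebraic_set_ext (algebraic_setT K 1) => v; split=> // _.
by exists (v 0 0); apply/rowP => j; rewrite mxE ord1.
Qed.

Lemma reg_at_line (K : fieldType) (s : K) : reg_at (line_atlas K) s id.
Proof.
exists tt => //.
have rc := creg_polyfun (A := line_atlas K) (a := tt) s (@polyfun_coord K 1 0).
apply: creg_near rc; apply: cnear_all => x _.
by rewrite mxE.
Qed.

(** * Irreducibility and generic conditions *)

Section Irreducible.
Variables (K : fieldType) (u : nat -> K).
Hypothesis inj_u : injective u.

(** The injection [u] expresses that K is infinite: [size p] distinct points exceed the possible
    number of roots. *)
Lemma nonroot_exists (p : {poly K}) : p != 0 -> exists s, p.[s] != 0.
Proof.
move=> p0; apply: NNPP => nex.
have /(_ (map u (iota 0 (size p)))) := max_poly_roots p0.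
rewrite map_inj_uniq // iota_uniq size_map size_iota ltnn.
suff -> : all (root p) (map u (iota 0 (size p))) by move/(_ isT isT).
by apply/allP => s _; apply/negPn/negP => ps; apply: nex; exists s.
Qed.

Lemma zopen_line (U : K -> Prop) s0 : zopen (line_atlas K) U -> U s0 ->
  exists2 p : {poly K}, p != 0 & forall s, p.[s] != 0 -> U s.
Proof.
move=> opU /(zopen_cnear (a := tt : chart_idx (line_atlas K)) I opU)[q qs qU].
have [p pE] : exists p : {poly K}, forall s, peval q (const_mx s) = p.[s].
  apply: (fr_peval (S := fun g => exists p : {poly K}, forall s, g s = p.[s])) => [|j].
    split.
    - by move=> g h gh [p pE]; exists p => s; rewrite -gh.
    - by move=> c; exists c%:P => s; rewrite hornerC.
    - by move=> g h [p pE] [p' pE']; exists (p + p') => s; rewrite hornerD pE pE'.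
    - by move=> g h [p pE] [p' pE']; exists (p * p') => s; rewrite hornerM pE pE'.
  by exists 'X => s; rewrite mxE hornerX.
exists p => [|s ps]; last by apply: qU => //=; rewrite pE.
by apply: contraNneq qs => p0; rewrite /= pE p0 horner0.
Qed.

Variables (X : Type) (A : atlas K X).

Lemma zclosedNN (Z : X -> Prop) : zclosed A Z -> zopen A (fun x => ~ Z x).
Proof.
move=> clZ a; have [S SE] := clZ a; exists S => x ax; rewrite -(SE x ax).
by split=> [/NNPP|Zx nZx] //; apply: nZx.
Qed.

(** If two proper closed sets covered X, a curve joining a point outside the first to a point
    outside the second would pull their complements back to two nonempty open subsets of the line.
    These meet over an infinite field, at a point lying in neither closed set. *)
Lemma irreducible_of_curves :
  (exists x : X, True) ->
  (forall x1 x2, exists F : K -> option X,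
     [/\ is_rational (line_atlas K) A F, F 0 = Some x1 & F 1 = Some x2]) ->
  irreducible_space A.
Proof.
move=> neX curves; split=> // Z1 Z2 cl1 cl2 Z12; apply: NNPP => nZ.
have [x1 nZ1] : exists x1, ~ Z1 x1.
  apply: NNPP => nex; apply: nZ; left => x; apply: NNPP => nZx; apply: nex; by exists x.
have [x2 nZ2] : exists x2, ~ Z2 x2.
  apply: NNPP => nex; apply: nZ; right => x; apply: NNPP => nZx; apply: nex; by exists x.
have [F [[_ Frat] F0 F1]] := curves x1 x2.
have [opF1 _] := Frat _ (zclosedNN cl1); have [opF2 _] := Frat _ (zclosedNN cl2).
have [|p1 p10 p1P] := zopen_line (s0 := 0) opF1; first by exists x1.
have [|p2 p20 p2P] := zopen_line (s0 := 1) opF2; first by exists x2.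
have [s] := nonroot_exists (mulf_neq0 p10 p20).
rewrite hornerM mulf_eq0 negb_or => /andP[/p1P[y Fs nZy] /p2P[y' Fs' nZy']].
by move: Fs' nZy'; rewrite Fs => -[<-] nZy'; case: (Z12 y).
Qed.

End Irreducible.

Section Generic.
Variables (K : fieldType) (X : Type) (A : atlas K X).

Lemma generically_mono (P Q : X -> Prop) :
  (forall x, P x -> Q x) -> generically A P -> generically A Q.
Proof. by move=> PQ [U [opU neU UP]]; exists U; split=> // x /UP/PQ. Qed.

Hypotheses (varA : is_variety A) (irrA : irreducible_space A).

(** Two disjoint nonempty open sets would have complements covering X, against irreducibility. *)
Lemma generically_and (P Q : X -> Prop) :
  generically A P -> generically A Q -> generically A (fun x => P x /\ Q x).
Proof.
move=> [U [opU [x Ux] UP]] [V [opV [y Vy] VQ]].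
exists (fun x => U x /\ V x); split; [exact: zopenI | | by move=> z [/UP ? /VQ]].
apply: NNPP => nUV; have [_ irr] := irrA.
have [z|/(_ x)|/(_ y)] := irr _ _ opU opV => //.
by case: (classic (U z)) => [Uz|]; [right => Vz; apply: nUV; exists z | left].
Qed.

Lemma generically_forall (I : finType) (P : I -> X -> Prop) :
  (forall i, generically A (P i)) -> generically A (fun x => forall i, P i x).
Proof.
move=> gP; suff: generically A (fun x => forall i, i \in enum I -> P i x).
  by apply: generically_mono => x Px i; apply: Px; rewrite mem_enum.
elim: (enum I) => [|i s IHs].
  exists (fun _ => True); split=> //.
    apply/(zopen_near varA) => x _; have [a ax] := var_cover varA x.
    by exists a => //; apply: cnear_all.
  by have [[x _] _] := irrA; exists x.
apply: generically_mono (generically_and (gP i) IHs) => x [Pix Px] j.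
by rewrite inE => /predU1P[->|/Px].
Qed.

End Generic.

(** * The Grassmannian *)

Lemma reg_mx_near (K : fieldType) (X : Type) (A : atlas K X) (x : X) m p
    (g h : X -> 'M[K]_(m, p)) : is_variety A ->
  near A x (fun y => g y = h y) -> mx_in (reg_at A x) g -> mx_in (reg_at A x) h.
Proof.
move=> varA gh rg i j; apply: reg_at_near (rg i j) => //.
by apply: near_mono gh => y ->.
Qed.

Lemma eq_cols (R : Type) m p (A B : 'M[R]_(m, p)) : (forall j, col j A = col j B) -> A = B.
Proof. by move=> AB; apply/matrixP => i j; have /colP/(_ i) := AB j; rewrite !mxE. Qed.

Lemma col_mulmx (R : pzRingType) m p q (A : 'M[R]_(m, p)) (B : 'M[R]_(p, q)) j :
  col j (A *m B) = A *m col j B.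
Proof. by rewrite !colE mulmxA. Qed.

Section Grassmannian.
Variables (K : fieldType) (k n : nat).
Hypothesis k_gt0 : (0 < k)%N.
Implicit Types (B : 'M[K]_(n, k)) (M : Gr K k n) (J : {set 'I_n}).

(** For k > 0 the default matrix 0 has determinant 0, which removes the case distinction on the size
    of [J]. *)
Lemma maxminorE B J : maxminor B J = \det (rows_mx B J).
Proof.
rewrite /maxminor /rows_mx; case: eqP => // _.
by case: k k_gt0 => // m _; rewrite det0.
Qed.

Lemma rows_mxM B J (g : 'M_k) : rows_mx (B *m g) J = rows_mx B J *m g.
Proof. by rewrite /rows_mx; case: eqP => [e|_]; rewrite ?mul_rowsub_mx ?mul0mx. Qed.

Lemma maxminorM B J (g : 'M_k) : maxminor (B *m g) J = maxminor B J * \det g.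
Proof. by rewrite !maxminorE rows_mxM det_mulmx. Qed.

Lemma mx_in_rows_mx (T : Type) (S : (T -> K) -> Prop) (h : T -> 'M[K]_(n, k)) J :
  fun_ring S -> mx_in S h -> mx_in S (fun x => rows_mx (h x) J).
Proof.
move=> fr Sh i j; rewrite /rows_mx; case: eqP => [e|_]; last exact: mx_in_cst.
by apply: (fr_ext fr) (Sh _ _) => x; rewrite mxE.
Qed.

(** [vbasis] is a tuple of length [\dim V]; here the length is turned into k, so that the coordinate
    functions of k-tuples become available. *)
Lemma gr_mx_basis M : exists2 X : k.-tuple 'cV[K]_n,
  basis_of (val M) X & gr_mx M = \matrix_(r < n, j < k) X`_j r 0.
Proof.
case: M => V dV; rewrite /gr_mx /=; have := vbasisP V.
by move: (vbasis V); rewrite (eqP dV) => X bX; exists X.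
Qed.

Lemma mulmx_cols (X : k.-tuple 'cV[K]_n) (c : 'cV[K]_k) :
  (\matrix_(r < n, j < k) X`_j r 0) *m c = \sum_j c j 0 *: X`_j.
Proof.
apply/colP => r; rewrite mxE summxE; apply: eq_bigr => j _.
by rewrite !mxE mulrC.
Qed.

Lemma mem_gr M v : v \in val M <-> exists c : 'cV[K]_k, v = gr_mx M *m c.
Proof.
have [X bX ->] := gr_mx_basis M; split=> [vM|[c ->]]; last first.
  rewrite mulmx_cols memv_suml // => j _; apply: memvZ.
  by apply: (basis_mem bX); apply: mem_nth; rewrite size_tuple.
exists (\col_j coord X j v); rewrite mulmx_cols [LHS](coord_basis bX vM).
by apply: eq_bigr => j _; rewrite mxE.
Qed.

Lemma gr_mx_ker M (c : 'cV[K]_k) : gr_mx M *m c = 0 -> c = 0.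
Proof.
have [X bX ->] := gr_mx_basis M; rewrite mulmx_cols => c0.
by apply/colP => j; rewrite mxE (freeP (basis_free bX) (fun j => c j 0) c0).
Qed.

Lemma gr_mx_inj M m : injective (mulmx (gr_mx M) : 'M[K]_(k, m) -> 'M[K]_(n, m)).
Proof.
move=> g h gh; apply/eqP; rewrite -subr_eq0; apply/eqP; apply: eq_cols => j.
by rewrite col0; apply: (@gr_mx_ker M); rewrite -col_mulmx mulmxBr gh subrr col0.
Qed.

(* [M] is the column span of [B]; unlike [gr_mx M], such a [B] can be chosen to vary regularly
   with [M]. *)
Definition spans M B := exists2 g, g \in unitmx & gr_mx M = B *m g.

Lemma spans_self M : spans M (gr_mx M).
Proof. by exists 1%:M; rewrite ?unitmx1 ?mulmx1. Qed.

Lemma spansM M B (h : 'M_k) : h \in unitmx -> spans M B -> spans M (B *m h).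
Proof.
move=> hu [g gu MB]; exists (invmx h *m g); first by rewrite unitmx_mul unitmx_inv hu.
by rewrite MB mulmxA mulmxK.
Qed.

Lemma spans_mem M B v : spans M B -> v \in val M <-> exists c : 'cV[K]_k, v = B *m c.
Proof.
move=> [g gu MB]; rewrite mem_gr MB; split=> [[c ->]|[c ->]].
  by exists (g *m c); rewrite mulmxA.
by exists (invmx g *m c); rewrite -mulmxA mulKVmx.
Qed.

Lemma mulmx_of_cols m (C : 'M[K]_(n, m)) B :
  (forall j, exists c : 'cV[K]_k, col j C = B *m c) -> exists g, C = B *m g.
Proof.
move=> /fin_all_exists[f fE]; exists (\matrix_(i, j) f j i 0).
apply: eq_cols => j; rewrite fE col_mulmx; congr (_ *m _).
by apply/colP => i; rewrite !mxE.
Qed.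

(** Equal column spans give gr_mx M = B g and B = gr_mx M h; injectivity of [gr_mx M] then forces h
    g = 1. *)
Lemma spansI M B : (forall v, v \in val M <-> exists c : 'cV[K]_k, v = B *m c) -> spans M B.
Proof.
move=> memM.
have [g MB] : exists g, gr_mx M = B *m g.
  apply: mulmx_of_cols => j; apply/memM/mem_gr.
  by exists (col j 1%:M); rewrite -col_mulmx mulmx1.
have [h BM] : exists h, B = gr_mx M *m h.
  apply: mulmx_of_cols => j; apply/mem_gr/memM.
  by exists (col j 1%:M); rewrite -col_mulmx mulmx1.
exists g => //; have hg1 : h *m g = 1%:M.
  by apply: (@gr_mx_inj M); rewrite mulmxA -BM -MB mulmx1.
by case: (mulmx1_unit hg1).
Qed.

Lemma spans_inj M M' B : spans M B -> spans M' B -> M = M'.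
Proof.
move=> sM sM'; apply/val_inj/vspaceP => v.
by apply/idP/idP => /spans_mem; [move/(_ _ sM)/(spans_mem v sM') | move/(_ _ sM')/(spans_mem v sM)].
Qed.

Lemma spans_act (g : 'M_n) M B : g \in unitmx -> spans M B -> spans (gr_act g M) (g *m B).
Proof.
move=> gu sM; apply: spansI => v; rewrite gr_actE //; split.
  move=> /memv_imgP[w /(spans_mem w sM)[c ->] ->]; exists c.
  by rewrite lfunE /= mulmxA.
move=> [c ->]; apply/memv_imgP; exists (B *m c); last by rewrite lfunE /= mulmxA.
by apply/(spans_mem _ sM); exists c.
Qed.

Definition gr_of B : option (Gr K k n) :=
  insub (limg (linfun (mulmx B : 'cV[K]_k -> 'cV[K]_n))).

Lemma gr_of_spans B M : gr_of B = Some M -> spans M B.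
Proof.
rewrite /gr_of; case: insubP => // N _ ME [<-]; apply: spansI => v; rewrite ME; split.
  by move=> /memv_imgP[c _ ->]; exists c; rewrite lfunE.
by move=> [c ->]; apply/memv_imgP; exists c; rewrite ?memvf ?lfunE.
Qed.

Lemma gr_of_unit B J : rows_mx B J \in unitmx -> exists M, gr_of B = Some M.
Proof.
move=> BJ; rewrite /gr_of; case: insubP => [M _ _|]; first by exists M.
rewrite limg_dim_eq ?dimvf /dim /= ?muln1 ?eqxx //.
apply/eqP; rewrite -subv0; apply/subvP=> c.
rewrite memv_cap memv_ker lfunE /= => /andP[_ /eqP Bc].
rewrite memv0 -(mulKmx BJ c); apply/eqP.
suff -> : rows_mx B J *m c = 0 by rewrite mulmx0.
rewrite /rows_mx; case: eqP => [e|_]; rewrite ?mul0mx // mul_rowsub_mx Bc.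
by apply/matrixP => i j; rewrite !mxE.
Qed.

Lemma chart_domE M B J : spans M B -> (maxminor (gr_mx M) J != 0) = (rows_mx B J \in unitmx).
Proof.
move=> [g gu ->]; rewrite maxminorE rows_mxM unitmxE det_mulmx unitfE mulf_eq0 negb_or.
by move: gu; rewrite unitmxE unitfE => ->; rewrite andbT.
Qed.

Definition chart_mx J M := gr_mx M *m invmx (rows_mx (gr_mx M) J).

(** The normalised matrix is invariant under invertible right multiplication, hence computable from
    any spanning matrix. *)
Lemma chart_mxE M B J : spans M B -> rows_mx B J \in unitmx ->
  chart_mx J M = B *m invmx (rows_mx B J).
Proof.
move=> [g gu MB] BJ; have RJ : rows_mx (gr_mx M) J \in unitmx.
  by rewrite MB rows_mxM unitmx_mul BJ.
rewrite /chart_mx -[RHS](mulmxK RJ); congr (_ *m _).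
by rewrite {2}MB rows_mxM mulmxA mulmxKV // MB.
Qed.

Lemma chart_mx_spans M J : maxminor (gr_mx M) J != 0 -> spans M (chart_mx J M).
Proof.
rewrite (chart_domE _ (spans_self M)) => MJ.
by apply: spansM (spans_self M); rewrite unitmx_inv.
Qed.

Lemma rows_chart_mx M J : maxminor (gr_mx M) J != 0 -> rows_mx (chart_mx J M) J = 1%:M.
Proof. by rewrite (chart_domE _ (spans_self M)) => MJ; rewrite rows_mxM mulmxV. Qed.

Lemma chart_cover M : exists J, maxminor (gr_mx M) J != 0.
Proof.
have fullM : row_full (gr_mx M).
  rewrite /row_full -mxrank_tr; apply: inj_row_free => v vM0.
  apply: trmx_inj; rewrite trmx0; apply: (@gr_mx_ker M).
  by apply: trmx_inj; rewrite trmx_mul trmxK vM0 trmx0.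
pose f := fullrankfun fullM; exists [set f i | i : 'I_k].
rewrite maxminorE -unitfE -unitmxE -row_full_unit.
have cardJ : #|[set f i | i : 'I_k]| = k.
  by rewrite card_imset ?card_ord //; apply: fullrankfun_inj.
(* The k independent rows chosen by [f] need not come in increasing order. Only row spaces are
   compared: each chosen row is also a row of the increasing selection. *)
have := fullrowsub_full fullM; rewrite -!sub1mx => /submx_trans; apply.
apply/row_subP => i.
rewrite /rows_mx; case: eqP => // e.
have fJ : f i \in [set f i | i : 'I_k] by apply: imset_f.
have -> : row i (rowsub f (gr_mx M)) =
  row (cast_ord e (enum_rank_in fJ (f i)))
    (rowsub (fun a : 'I_k => enum_val (cast_ord (esym e) a)) (gr_mx M)).
  apply/rowP => j; rewrite 2!mxE [RHS]mxE [RHS]mxE.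
  by rewrite cast_ordK enum_rankK_in.
exact: row_sub.
Qed.

Local Notation GrA := (Gr_atlas K k n).

(** Identifies the image of the chart at [J] with an affine subspace: any matrix with identity rows
    in [J] has full rank and is already normalised. *)
Lemma rows_mx_eq1P J B : rows_mx B J = 1%:M ->
  exists M, [/\ spans M B, maxminor (gr_mx M) J != 0 & chart_mx J M = B].
Proof.
move=> BJ1; have BJ : rows_mx B J \in unitmx by rewrite BJ1 unitmx1.
have [M /gr_of_spans sM] := gr_of_unit BJ; exists M; split=> //.
  by rewrite (chart_domE _ sM).
by rewrite (chart_mxE sM BJ) BJ1 invmx1 mulmx1.
Qed.

Lemma polyfun_vec_mx : mx_in (@polyfun K (n * k)) (fun v => vec_mx v : 'M_(n, k)).
Proof. exact: (mx_in_vec_mx (polyfun_ring _ _) (@polyfun_id _ _)). Qed.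

Lemma algebraic_mx_eq m p q (g h : 'rV[K]_m -> 'M[K]_(p, q)) :
  mx_in (@polyfun K m) g -> mx_in (@polyfun K m) h -> algebraic_set (fun v => g v = h v).
Proof.
move=> pg ph; apply: (algebraic_setP (g := fun ij v => g v ij.1 ij.2 - h v ij.1 ij.2)).
  by move=> ij; apply: (fr_sub (polyfun_ring _ _)).
move=> v; split=> [-> ij|gh]; first exact: subrr.
by apply/matrixP => i j; apply/eqP; rewrite -subr_eq0 (gh (i, j)).
Qed.

Lemma creg_chart_mx J M : mx_in (creg (A := GrA) J M) (chart_mx J).
Proof.
move=> i j.
have := @creg_polyfun _ _ GrA J M _ (@polyfun_coord K (n * k) (mxvec_index i j)).
by apply: creg_near; apply: cnear_all => y _ /=; rewrite mxvecE.
Qed.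

Lemma Gr_variety : is_variety GrA.
Proof.
split.
- exact: chart_cover.
- move=> J M M' /= MJ M'J /(can_inj mxvecK) MM'.
  by apply: spans_inj (chart_mx_spans MJ) _; rewrite /chart_mx MM'; apply: chart_mx_spans.
- move=> J /=.
  have alg : algebraic_set (fun v : 'rV[K]_(n * k) => rows_mx (vec_mx v) J = 1%:M).
    apply: algebraic_mx_eq; last exact: (mx_in_cst (polyfun_ring _ _)).
    exact: (mx_in_rows_mx J (polyfun_ring _ _) polyfun_vec_mx).
  apply: algebraic_set_ext alg => v; split.
    by move=> /rows_mx_eq1P[M [_ MJ Mv]]; exists M; rewrite // -/(chart_mx J M) Mv vec_mxK.
  by move=> [M MJ <-]; rewrite mxvecK rows_chart_mx.
- move=> J; apply: cnear_zopen => J' M /= MJ' MJ.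
  have sM := chart_mx_spans MJ'; rewrite (chart_domE _ sM) unitmxE unitfE in MJ.
  have rd := fr_det (creg_ring _ _) (mx_in_rows_mx J (creg_ring _ _) (creg_chart_mx J' M)).
  apply: cnear_mono (creg_neq0 (A := GrA) MJ' rd MJ) => M' M'J'.
  by rewrite (chart_domE _ (chart_mx_spans M'J')) unitmxE unitfE.
- move=> J J' j M /= MJ MJ'.
  have rR := mx_in_rows_mx J' (creg_ring _ _) (creg_chart_mx J M).
  have uR : rows_mx (chart_mx J M) J' \in unitmx by rewrite -(chart_domE _ (chart_mx_spans MJ)).
  have rC := mx_in_mul (creg_ring _ _) (creg_chart_mx J M) (creg_invmx (A := GrA) MJ rR uR).
  have [p [q [qM pq]]] := creg_quot (mx_in_mxvec (creg_ring _ _) rC 0 j).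
  exists p, q; split=> // M' M'J M'J' qM'; rewrite -(pq M' M'J qM').
  congr (mxvec _ 0 j); rewrite -/(chart_mx J' M') (chart_mxE (chart_mx_spans M'J)) //.
  by rewrite -(chart_domE _ (chart_mx_spans M'J)).
(* A pair (l, r) of chart matrices belongs to one point iff both are normalised and l = r * rows_mx
   l J'. Taking the rows in [J] of the last equation shows that its right factor is invertible, so
   polynomial equations suffice. *)
- move=> J J' /=.
  have fr := polyfun_ring K (n * k + n * k); have pid := @polyfun_id K (n * k + n * k).
  have pl := mx_in_vec_mx fr (mx_in_lsubmx fr pid).
  have pr := mx_in_vec_mx fr (mx_in_rsubmx fr pid).
  have a1 := algebraic_mx_eq (mx_in_rows_mx J fr pl) (mx_in_cst fr 1%:M).
  have a2 := algebraic_mx_eq (mx_in_rows_mx J' fr pr) (mx_in_cst fr 1%:M).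
  have a3 := algebraic_mx_eq pl (mx_in_mul fr pr (mx_in_rows_mx J' fr pl)).
  apply: algebraic_set_ext (algebraic_setI (algebraic_setI a1 a2) a3) => w; split.
    move=> [[/= l1 r1] lr]; have [M [sM MJ ME]] := rows_mx_eq1P l1.
    have uR : rows_mx (vec_mx (lsubmx w)) J' \in unitmx.
      move: l1; rewrite {1}lr rows_mxM => /mulmx1C/mulmx1_unit[] //.
    exists M; split=> //; first by rewrite (chart_domE _ sM).
    rewrite -/(chart_mx J M) -/(chart_mx J' M) ME (chart_mxE sM uR) {2}lr mulmxK //.
    by rewrite !vec_mxK hsubmxK.
  move=> [M [MJ MJ' ->]]; rewrite row_mxKl row_mxKr !mxvecK.
  rewrite -/(chart_mx J M) -/(chart_mx J' M) !rows_chart_mx //; split=> //.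
  have sM := chart_mx_spans MJ; have uR : rows_mx (chart_mx J M) J' \in unitmx.
    by rewrite -(chart_domE _ sM).
  by rewrite (chart_mxE sM uR) mulmxKV.
Qed.

Lemma Xk_variety : is_variety (Xk_atlas K n k).
Proof. exact: prod_variety Gr_variety (Gm_variety K). Qed.

Section RationalIntoXk.
Variables (X : Type) (A : atlas K X).
Hypothesis varA : is_variety A.

(** Replaces the charts of the Grassmannian by any regularly varying spanning matrix: normalising it
    at a minor that is nonzero at x yields the chart coordinates as germs. *)
Lemma rational_into_Xk (F : X -> option (Xk K n k)) :
  (exists x y, F x = Some y) ->
  (forall x y, F x = Some y -> exists (B : X -> 'M[K]_(n, k)) (t : X -> K),
     [/\ mx_in (reg_at A x) B, reg_at A x t
       & near A x (fun x' => exists2 y', F x' = Some y' &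
                     spans y'.1 (B x') /\ val y'.2 = t x')]) ->
  is_rational A (Xk_atlas K n k) F.
Proof.
move=> neF locF; apply: (is_rationalI varA Xk_variety) => // x y Fx.
have [B [t [rB rt nF]]] := locF x y Fx.
have [y0] := near_self nF; rewrite Fx => -[<-] [sy ty].
have [J yJ] := chart_cover y.1; exists (J, tt).
have rR := mx_in_rows_mx J (reg_at_ring varA x) rB.
have uR : rows_mx (B x) J \in unitmx by rewrite -(chart_domE _ sy).
have nR : near A x (fun x' => rows_mx (B x') J \in unitmx).
  have := reg_at_neq0 (fr_det (reg_at_ring varA x) rR); rewrite -unitfE -unitmxE => /(_ uR).
  by apply: near_mono => x'; rewrite unitmxE unitfE.
split=> //=.
  apply: near_mono (nearI varA nF nR) => x' [[y' Fx' [sy' _]] uR'].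
  by exists y' => //; rewrite (chart_domE _ sy').
have t0 : t x != 0 by rewrite -ty; apply: (valP y.2).
apply: (reg_mx_near varA (g := fun x' => row_mx (mxvec (B x' *m invmx (rows_mx (B x') J)))
  (\row_(j < 2) (if j == 0 then t x' else (t x')^-1)))).
  apply: near_mono (nearI varA nF nR) => x' [[y' Fx' [sy' ty']] uR'].
  by rewrite Fx' /= -ty' -(chart_mxE sy' uR').
apply: (mx_in_row_mx (reg_at_ring varA x)).
  apply: (mx_in_mxvec (reg_at_ring varA x)); apply: (mx_in_mul (reg_at_ring varA x)) => //.
  exact: reg_at_invmx.
move=> i j; apply: (fr_ext (reg_at_ring varA x) (g := fun x' => if j == 0 then t x' else (t x')^-1)).
  by move=> x'; rewrite mxE.
by case: (j == 0) => //; apply: reg_at_inv.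
Qed.

End RationalIntoXk.

Lemma maxminor_neq0_exists J : #|J| = k -> exists M : Gr K k n, maxminor (gr_mx M) J != 0.
Proof.
(* The coordinate subspace spanned by the basis vectors with index in [J]. *)
move=> cardJ; pose B : 'M[K]_(n, k) := \matrix_(r, j) (if #|J| =P k is ReflectT e then
   (r == enum_val (cast_ord (esym e) j))%:R else 0).
have BJ : rows_mx B J \in unitmx.
  suff -> : rows_mx B J = 1%:M by exact: unitmx1.
  rewrite /rows_mx /B; case: eqP => // e; apply/matrixP => i j; rewrite !mxE.
  by rewrite (inj_eq enum_val_inj) (inj_eq (@cast_ord_inj _ _ _)).
have [M /gr_of_spans sM] := gr_of_unit BJ.
by exists M; rewrite (chart_domE _ sM).
Qed.

Lemma Xk_irreducible (u : nat -> K) : injective u -> (k <= n)%N ->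
  irreducible_space (Xk_atlas K n k).
Proof.
move=> inj_u kn; apply: (irreducible_of_curves inj_u).
  have cardJ : #|[set widen_ord kn i | i : 'I_k]| = k.
    by rewrite card_imset ?card_ord // => i j [/val_inj].
  by have [M _] := maxminor_neq0_exists cardJ; exists (M, gm1 K).
move=> x1 x2; pose lin (V : lmodType K) (v w : V) s := (1 - s) *: v + s *: w.
pose B := lin _ (gr_mx x1.1) (gr_mx x2.1); pose t := lin K^o (val x1.2) (val x2.2).
(* The curve is undefined where the interpolated matrix drops rank or the interpolated scalar
   vanishes; the parameters 0 and 1 lie in its domain. *)
pose F s := if gr_of (B s) is Some M then omap (pair M) (to_Gm (t s)) else None.
have gr_ofE M C : spans M C -> gr_of C = Some M.
  move=> sM; have [J MJ] := chart_cover M; rewrite (chart_domE _ sM) in MJ.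
  by have [M' M'C] := gr_of_unit MJ; rewrite M'C (spans_inj (gr_of_spans M'C) sM).
have lin0 (V : lmodType K) (v w : V) : lin V v w 0 = v.
  by rewrite /lin subr0 scale1r scale0r addr0.
have lin1 (V : lmodType K) (v w : V) : lin V v w 1 = w.
  by rewrite /lin subrr scale1r scale0r add0r.
have F0 : F 0 = Some x1.
  by rewrite /F /B /t !lin0 (gr_ofE _ _ (spans_self _)) /to_Gm valK; case: (x1).
have F1 : F 1 = Some x2.
  by rewrite /F /B /t !lin1 (gr_ofE _ _ (spans_self _)) /to_Gm valK; case: (x2).
exists F; split=> //; apply: (rational_into_Xk (line_variety K)); first by exists 0, x1.
move=> s y Fs; exists B, t; have varL := line_variety K.
have fr := reg_at_ring varL s; have rs := reg_at_line s.
have r1s : reg_at (line_atlas K) s (fun s => 1 - s).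
  by apply: (fr_sub fr) => //; apply: (fr_cst fr).
have rB : mx_in (reg_at (line_atlas K) s) B.
  by apply: (mx_in_add fr); apply: (mx_in_scale fr) => //; apply: (mx_in_cst fr).
have rt : reg_at (line_atlas K) s t.
  by apply: (fr_add fr); apply: (fr_mul fr) => //; apply: (fr_cst fr).
split=> //; move: Fs; rewrite /F; case BM: (gr_of (B s)) => [M|//].
rewrite /to_Gm; case: insubP => // c ts _ _.
have [J MJ] := chart_cover M; have sM := gr_of_spans BM.
rewrite (chart_domE _ sM) unitmxE unitfE in MJ.
have nJ := reg_at_neq0 (fr_det fr (mx_in_rows_mx J fr rB)) MJ.
apply: near_mono (nearI varL nJ (reg_at_neq0 rt ts)) => s'; rewrite -unitfE -unitmxE.
move=> [/gr_of_unit[M' M'B] ts']; rewrite M'B insubT /=.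
by eexists; first reflexivity; split=> //; apply: gr_of_spans.
Qed.

End Grassmannian.

(** * Maximal minors with cyclically ordered rows *)

(** [A'] is [A] with its first row moved to the end. Expanding [A'] along its last row and [A] along
    its first produces the same minors, with cofactor signs differing by (-1)^(m-1). *)
Lemma det_rot (R : comNzRingType) m (A A' : 'M[R]_m) : (0 < m)%N ->
  (forall (a b : 'I_m) j, a = m.-1 :> nat -> b = 0 :> nat -> A' a j = A b j) ->
  (forall (a b : 'I_m) j, b = a.+1 :> nat -> A' a j = A b j) ->
  \det A' = (-1) ^+ m.-1 * \det A.
Proof.
case: m A A' => // m A A' _ Alast Aother.
rewrite (expand_det_row A' ord_max) (expand_det_row A ord0) big_distrr /=.
apply: eq_bigr => j _; rewrite (Alast _ ord0) // [RHS]mulrCA; congr (_ * _).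
rewrite /cofactor /= add0n exprD -mulrA; congr (_ * (_ * _)).
congr (\det _); apply/matrixP => r s; rewrite !mxE; apply: Aother.
by rewrite lift0 lift_max.
Qed.

Definition upd (w : nat -> int) (s : nat) (m : int) : nat -> int :=
  fun a => if a == s then m else w a.

Section TwistedRows.
Variables (K : fieldType) (k n' : nat).
Local Notation n := n'.+1.
Implicit Types (B : 'M[K]_(n, k)) (w : nat -> int) (m : int).

Definition twist : K := (-1) ^+ k.-1.

Lemma twist_neq0 : twist != 0.
Proof. by rewrite expf_neq0 // oppr_eq0 oner_neq0. Qed.

Lemma twist_sqr : twist * twist = 1.
Proof. by rewrite -expr2 /twist sqrr_sign. Qed.

(** k(k-1) is even. Consequently shifting all k indices by n leaves a determinant unchanged. *)
Lemma twist_exp_k : twist ^+ k = 1.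
Proof.
rewrite /twist -exprM; case: k => [|m] /=; first by rewrite muln0.
by rewrite -signr_odd oddM /=; case: (odd m).
Qed.

(* The rows of [B] numbered by all integers, so that [rowz B (m + n) = twist *: rowz B m]. With
   this sign, moving the first entry [m] of an increasing sequence to its end as [m + n] does not
   change the determinant of the corresponding rows. *)
Definition rowz B m : 'rV[K]_k :=
  twist ^ ((m - 1) %/ n%:Z)%Z *: row (inord `|((m - 1) %% n%:Z)%Z|%N) B.

Lemma rowz_shift B m (q : int) : rowz B (m + q * n%:Z) = twist ^ q *: rowz B m.
Proof.
rewrite /rowz (_ : m + q * n%:Z - 1 = q * n%:Z + (m - 1)); last by ring.
by rewrite divzMDl // modzMDl expfzDr ?twist_neq0 // scalerA.
Qed.

Lemma rowzDn B m : rowz B (m + n%:Z) = twist *: rowz B m.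
Proof. by have := rowz_shift B m 1; rewrite mul1r expr1z. Qed.

Lemma rowz_ord B (r : 'I_n) : rowz B r.+1%:Z = row r B.
Proof.
rewrite /rowz (_ : r.+1%:Z - 1 = r%:Z); last by lia.
rewrite divz_small ?modz_small; try by rewrite /= ltz_nat ltn_ord.
by rewrite expr0z scale1r absz_nat inord_val.
Qed.

Lemma int_eqmod m : exists (r : 'I_n) (q : int), m = r.+1%:Z + q * n%:Z.
Proof.
have rlt : (`|((m - 1) %% n%:Z)%Z| < n)%N.
  by rewrite -ltz_nat gez0_abs ?modz_ge0 // ltz_mod.
exists (Ordinal rlt), ((m - 1) %/ n%:Z)%Z => /=.
have := divz_eq (m - 1) n%:Z; have : ((m - 1) %% n%:Z)%Z >= 0 by rewrite modz_ge0.
by case: (((m - 1) %% n%:Z)%Z) => // r _; lia.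
Qed.

Definition wmx B w : 'M[K]_k := \matrix_(a < k) rowz B (w a).
Definition wdet B w : K := \det (wmx B w).

Lemma wdet_ext B w w' : (forall a, (a < k)%N -> w a = w' a) -> wdet B w = wdet B w'.
Proof. by move=> ww'; congr (\det _); apply/matrixP => a j; rewrite !mxE ww'. Qed.

Lemma wdet_dup B w a b : (a < k)%N -> (b < k)%N -> a != b -> w a = w b -> wdet B w = 0.
Proof.
move=> ak bk ab wab.
apply: (determinant_alternate (i1 := Ordinal ak) (i2 := Ordinal bk)) => // j.
by rewrite !mxE /= wab.
Qed.

Lemma wdet_shift B w : wdet B (fun a => w a + n%:Z) = wdet B w.
Proof.
have -> : wdet B (fun a => w a + n%:Z) = \det (twist *: wmx B w).
  by congr (\det _); apply/row_matrixP => a; rewrite linearZ /= !rowK rowzDn.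
by rewrite detZ twist_exp_k mul1r.
Qed.

Lemma wdet_rot B w x : (0 < k)%N ->
  wdet B (fun a => if a == k.-1 then x else w a) =
  twist * wdet B (fun a => if a is a'.+1 then w a' else x).
Proof.
move=> k_gt0; apply: det_rot => // a b j.
  by move=> ak b0; rewrite !mxE ak b0 eqxx.
move=> ba; have ak : (a == k.-1 :> nat) = false.
  by have := ltn_ord b; rewrite ba; case: eqP => // ->; rewrite prednK // ltnn.
by rewrite !mxE ak ba.
Qed.

Lemma wdet_lin B B' w (b : K) s m : (s < k)%N ->
  rowz B' (w s) = rowz B (w s) + b *: rowz B m ->
  (forall a, (a < k)%N -> a != s -> rowz B' (w a) = rowz B (w a)) ->
  wdet B' w = wdet B w + b * wdet B (upd w s m).
Proof.
move=> sk ws wa; rewrite -[wdet B w]mul1r.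
apply: (determinant_multilinear (i0 := Ordinal sk)).
- by rewrite !rowK /upd /= eqxx scale1r.
- apply/row_matrixP => a; rewrite !row_rowsub !rowK wa //.
  by rewrite -[s]/(nat_of_ord (Ordinal sk)) (inj_eq val_inj) eq_sym neq_lift.
- apply/row_matrixP => a; rewrite !row_rowsub !rowK /upd.
  have as_ : (lift (Ordinal sk) a == s :> nat) = false.
    by rewrite -[s]/(nat_of_ord (Ordinal sk)) (inj_eq val_inj) eq_sym (negPf (neq_lift _ _)).
  by rewrite as_ wa // as_.
Qed.

Lemma wdet_same B B' w : (forall a, (a < k)%N -> rowz B' (w a) = rowz B (w a)) ->
  wdet B' w = wdet B w.
Proof. by move=> wa; congr (\det _); apply/row_matrixP => a; rewrite !rowK wa. Qed.

(** As a function of the replaced row, the determinant is a linear form whose coefficients are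
    column s of the adjugate. *)
Lemma wdet_upd B w m (s : 'I_k) : wdet B (upd w s m) = (rowz B m *m \adj (wmx B w)) 0 s.
Proof.
rewrite /wdet (expand_det_row _ s) mxE; apply: eq_bigr => j _.
rewrite [\adj _ _ _]mxE [wmx _ _ s j]mxE /upd eqxx; congr (_ * _).
rewrite /cofactor; congr (_ * \det _); apply/matrixP => r c; rewrite !mxE.
by rewrite (inj_eq val_inj) eq_sym (negPf (neq_lift _ _)).
Qed.

Lemma wdet_upd_shift B w m (s : 'I_k) :
  wdet B (upd w s (m + n%:Z)) = twist * wdet B (upd w s m).
Proof. by rewrite !wdet_upd rowzDn -scalemxAl mxE. Qed.

(* Cramer's rule [det(W) x = sum_r det(W with row r replaced by x) W_r], to which the linear form
   [x |-> det(W' with row s replaced by x)] is applied. *)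
Lemma wdet_exchange B w w' m (s : 'I_k) :
  wdet B w * wdet B (upd w' s m) =
  \sum_(r < k) wdet B (upd w r m) * wdet B (upd w' s (w r)).
Proof.
rewrite wdet_upd.
have -> : wdet B w * (rowz B m *m \adj (wmx B w')) 0 s =
    (rowz B m *m \adj (wmx B w) *m (wmx B w *m \adj (wmx B w'))) 0 s.
  move: (rowz B m) => x.
  by rewrite mulmxA -(mulmxA _ (\adj _)) mul_adj_mx mul_mx_scalar -scalemxAl [RHS]mxE.
rewrite mxE; apply: eq_bigr => r _; rewrite !wdet_upd; congr (_ * _).
by rewrite [RHS]mxE mxE; apply: eq_bigr => j _; rewrite [wmx _ _ _ _]mxE.
Qed.

Definition wset w : {set 'I_n} :=
  [set r : 'I_n | [exists a : 'I_k, (r.+1%:Z == w a %[mod n%:Z])%Z]].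

Hypothesis k_gt0 : (0 < k)%N.

Lemma maxminor_pos B w :
  (forall a b, (a < b < k)%N -> w a < w b) -> (forall a, (a < k)%N -> 1 <= w a <= n%:Z) ->
  maxminor B (wset w) = wdet B w.
Proof.
move=> w_incr w_bnd.
have [f fE] : exists f : 'I_k -> 'I_n, forall a : 'I_k, w a = (f a).+1%:Z.
  have /fin_all_exists[f fE] : forall a : 'I_k, exists r : 'I_n, w a = r.+1%:Z.
    move=> a; have := w_bnd a (ltn_ord a); case: (w a) => // -[//|r] /andP[_ rn].
    by exists (Ordinal (n := n) (m := r) rn).
  by exists f.
have f_incr (a b : 'I_k) : (a < b)%N -> (f a < f b)%N.
  by move=> ab; have := w_incr a b; rewrite ab ltn_ord !fE => /(_ isT).
have memJ r : (r \in wset w) = [exists a, r == f a].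
  rewrite inE; apply: eq_existsb => a; rewrite fE -val_eqE /=.
  by rewrite !modz_nat eqz_nat -(addn1 r) -(addn1 (f a)) eqn_modDr !modn_small.
have f_inj : injective f.
  move=> a b fab; apply: val_inj; case: (ltngtP a b) => // /f_incr; rewrite fab ltnn //.
have enumJ : enum (wset w) = [seq f a | a <- enum 'I_k].
  pose lt_ord p (x y : 'I_p) := (x < y)%N.
  have lt_trans p : transitive (@lt_ord p) by move=> y x z; apply: ltn_trans.
  have enum_sorted p : sorted (@lt_ord p) (enum 'I_p).
    by have := iota_ltn_sorted 0 p; rewrite -val_enum_ord sorted_map.
  apply: (irr_sorted_eq (lt_trans n)).
  - by move=> x; rewrite /lt_ord ltnn.
  - by rewrite /enum_mem -enumT; apply: (sorted_filter (lt_trans n)); apply: enum_sorted.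
  - by apply: homo_sorted (enum_sorted k) => a b; apply: f_incr.
  move=> r; rewrite mem_enum memJ; apply/existsP/mapP.
    by move=> [a /eqP ->]; exists a; rewrite // mem_enum.
  by move=> [a _ ->]; exists a.
rewrite maxminorE // /rows_mx; case: eqP => [e|]; last first.
  by case; rewrite cardE enumJ size_map size_enum_ord.
congr (\det _); apply/row_matrixP => a; rewrite row_rowsub rowK fE rowz_ord; congr (row _ B).
rewrite (enum_val_nth (f a)) enumJ (nth_map a) ?size_enum_ord ?(ltn_ord a) //.
by rewrite nth_ord_enum.
Qed.

(** Two entries whose difference lies strictly between 0 and n cannot be congruent modulo n. *)
Lemma card_wset w : (forall a b, (a < b < k)%N -> w a < w b < w a + n%:Z) -> #|wset w| = k.
Proof.
move=> w_incr.
have /fin_all_exists[f fE] : forall a : 'I_k, exists r : 'I_n, exists q : int,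
    w a = r.+1%:Z + q * n%:Z by move=> a; apply: int_eqmod.
have f_neq (a b : 'I_k) : (a < b)%N -> f a != f b.
  move=> ab; apply/eqP => fab; have := w_incr a b; rewrite ab ltn_ord => /(_ isT).
  have [[q ->] [q' ->]] := (fE a, fE b); rewrite fab => qq'.
  have : 0 < (q' - q) * n%:Z < n%:Z by lia.
  by move: (q' - q) => d; case: (ltrgtP d 0) => d0; nia.
have -> : wset w = [set f a | a : 'I_k].
  apply/setP => r; rewrite inE; apply/existsP/imsetP => -[a].
    have [q ->] := fE a; rewrite [_ + q * _]addrC modzMDl.
    rewrite !modz_nat eqz_nat -(addn1 r) -(addn1 (f a)) eqn_modDr !modn_small // => /eqP ra.
    by exists a => //; apply: val_inj.
  move=> _ ->; exists a; have [q ->] := fE a.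
  by rewrite [_ + q * _]addrC modzMDl.
rewrite card_imset ?card_ord // => a b fab; apply: val_inj.
by case: (ltngtP a b) => // /f_neq; rewrite fab eqxx.
Qed.

Lemma eq_wset w w' : (forall r : 'I_n, [exists a : 'I_k, (r.+1%:Z == w a %[mod n%:Z])%Z] =
  [exists a : 'I_k, (r.+1%:Z == w' a %[mod n%:Z])%Z]) -> wset w = wset w'.
Proof. by move=> ww'; apply/setP => r; rewrite !inE ww'. Qed.

(** Moving a first entry m <= 0 to the end as m+n keeps the set of residues. It also keeps the
    determinant, since the rotation contributes one factor [twist] and the translated index another.
    Repeating this brings all entries into [1, n], the case of [maxminor_pos]. *)
Lemma maxminor_wdet B w :
  (forall a b, (a < b < k)%N -> w a < w b) -> w k.-1 < w 0%N + n%:Z ->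
  - n%:Z < w 0%N -> w k.-1 <= n%:Z ->
  maxminor B (wset w) = wdet B w.
Proof.
(* [N] bounds the number of leading entries that may be nonpositive, and each rotation lowers it by
   one. *)
have [N Nk] : exists N, (k <= N)%N by exists k.
have : forall a, (N <= a < k)%N -> 0 < w a by move=> a; lia.
move=> {Nk}; elim: N w => [|N IHN] w wN w_incr wlt w0 wk.
  apply: maxminor_pos => // a ak; have := wN a ak.
  have [->|ak'] := eqVneq a k.-1; first by lia.
  by have := w_incr a k.-1; lia.
have [w00|w00] := lerP (w 0%N) 0; last first.
  apply: IHN => // a ak; have [->|a0] := eqVneq a 0%N; first by [].
  by have := w_incr 0%N a; lia.
pose w' (a : nat) : int := if a == k.-1 then w 0%N + n%:Z else w a.+1.
have w'0 : - n%:Z < w' 0%N.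
  rewrite /w'; case: eqP => [|k1]; first by lia.
  by have := w_incr 0%N 1%N; lia.
have <- : wset w' = wset w.
  apply: eq_wset => r; apply/existsP/existsP => -[a].
    rewrite /w'; case: ifP => [_|/eqP ak] ra.
      by exists (Ordinal k_gt0); move: ra; rewrite modzDr.
    have a1 : (a.+1 < k)%N by have := ltn_ord a; lia.
    by exists (Ordinal a1).
  case: a => -[|a] ak /= ra.
    have k1 : (k.-1 < k)%N by lia.
    by exists (Ordinal k1); rewrite /w' eqxx modzDr.
  exists (Ordinal (ltnW ak)); rewrite /w' /=; case: ifP => // /eqP; lia.
rewrite IHN.
- rewrite wdet_rot // -[RHS]mul1r -twist_sqr -mulrA; congr (_ * _).
  rewrite (wdet_ext _ (w' := upd w (Ordinal k_gt0) (w 0%N + n%:Z))) => [|[|a] _] //.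
  rewrite wdet_upd_shift; congr (_ * _).
  by apply: wdet_ext => -[|a].
- move=> a ak; rewrite /w'; case: eqP => [_|a1]; first by lia.
  by apply: wN; lia.
- move=> a b; rewrite /w' => abk; have -> : (a == k.-1) = false by lia.
  case: eqP => [_|b1]; last by apply: w_incr; lia.
  have [->|a1] := eqVneq a.+1 k.-1; first by lia.
  by have := w_incr a.+1 k.-1; lia.
- rewrite {1}/w' eqxx /w'; case: eqP => [_|k1]; first by lia.
  by have := w_incr 0%N 1%N; lia.
- by [].
- by rewrite /w' eqxx; lia.
Qed.

End TwistedRows.

Lemma val_ord_pred n' (i : 'I_n'.+1) : ord_pred i = (if i == 0%N :> nat then n' else i.-1) :> nat.
Proof.
have := ltn_ord i; case: eqP => i0 ilt /=; first by rewrite i0 add0n /= modn_small.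
have -> : (i + n'.+1).-1 = (i.-1 + n'.+1)%N by lia.
by rewrite modnDr modn_small //; lia.
Qed.

(** * The coordinates P, N, Q under row operations, and their Plücker relations *)

Section PluckerIdentities.
Variables (K : fieldType) (k n' : nat).
Local Notation n := n'.+1.
Hypotheses (k_gt0 : (0 < k)%N) (k_lt_n : (k < n)%N).
Implicit Types (B : 'M[K]_(n, k)) (j : int) (i : 'I_n).

(* The cyclically increasing sequences of [j-k+1, j], [j-k+1, j-1] U {j+1} and
   {j-k} U [j-k+2, j]. *)
Definition wP j (a : nat) : int := j - k%:Z + 1 + a%:Z.
Definition wN j : nat -> int := upd (wP j) k.-1 (j + 1).
Definition wQ j : nat -> int := upd (wP j) 0 (j - k%:Z).

Lemma zintE (a : int) (m : nat) : zint a (a + m%:Z - 1) = [seq a + l%:Z | l <- iota 0 m].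
Proof.
rewrite /zint; congr (map _ (iota 0 _)); case: m => [|m].
  by have -> : (a <= a + 0%N%:Z - 1) = false by lia.
have -> : a <= a + m.+1%:Z - 1 by lia.
by rewrite (_ : a + m.+1%:Z - 1 - a = m%:Z) //; lia.
Qed.

Lemma residues_wP j : residues n (zint (j - k%:Z + 1) j) = wset k n' (wP j).
Proof.
have -> : zint (j - k%:Z + 1) j = [seq wP j l | l <- iota 0 k].
  by rewrite -zintE; congr zint; lia.
apply/setP => r; rewrite !inE has_map; apply/hasP/existsP.
  by move=> [a]; rewrite mem_iota => /andP[_ ak] /= ra; exists (Ordinal ak).
by move=> [a ra]; exists (val a) => //; rewrite mem_iota /= ltn_ord.
Qed.

Lemma residues_wN j :
  residues n (rcons (zint (j - k%:Z + 1) (j - 1)) (j + 1)) = wset k n' (wN j).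
Proof.
have -> : zint (j - k%:Z + 1) (j - 1) = [seq wP j l | l <- iota 0 k.-1].
  by rewrite -zintE; congr zint; lia.
apply/setP => r; rewrite !inE has_rcons has_map; apply/orP/existsP.
  move=> [ra|/hasP[a]].
    have k1 : (k.-1 < k)%N by lia.
    by exists (Ordinal k1); rewrite /wN /upd eqxx.
  rewrite mem_iota => /andP[_ ak] /= ra; have ak' : (a < k)%N by lia.
  exists (Ordinal ak'); rewrite /wN /upd /=; case: ifP => // /eqP; lia.
move=> [a]; rewrite /wN /upd; case: ifP => [_|/eqP ak] ra; first by left.
right; apply/hasP; exists (val a) => //; rewrite mem_iota /=; have := ltn_ord a; lia.
Qed.

Lemma residues_wQ j :
  residues n ((j - k%:Z) :: zint (j - k%:Z + 2) j) = wset k n' (wQ j).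
Proof.
have -> : zint (j - k%:Z + 2) j = [seq wP j l.+1 | l <- iota 0 k.-1].
  rewrite (eq_map (g := fun l : nat => (j - k%:Z + 2) + l%:Z)) => [|l]; last by rewrite /wP; lia.
  by rewrite -zintE; congr zint; lia.
apply/setP => r; rewrite !inE /= has_map; apply/orP/existsP.
  move=> [ra|/hasP[a]].
    by exists (Ordinal k_gt0).
  rewrite mem_iota => /andP[_ ak] /= ra; have ak' : (a.+1 < k)%N by lia.
  by exists (Ordinal ak').
move=> [[[|a] ak] /= ra]; first by left.
by right; apply/hasP; exists a => //; rewrite mem_iota /=; lia.
Qed.

(** The range exceeds [0, n-1] at both ends: j = -1 occurs as i-1 in gamma and eps at i = 0, and j =
    n occurs as i+1 in eps at i = n-1 and as the last summand of f. *)
Lemma maxminor_wP B j : -1 <= j <= n%:Z ->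
  maxminor B (residues n (zint (j - k%:Z + 1) j)) = wdet B (wP j).
Proof.
move=> jn; rewrite residues_wP; apply: maxminor_wdet => // [a b|||]; rewrite /wP; lia.
Qed.

Lemma maxminor_wN B j : 0 <= j < n%:Z ->
  maxminor B (residues n (rcons (zint (j - k%:Z + 1) (j - 1)) (j + 1))) = wdet B (wN j).
Proof.
move=> jn; rewrite residues_wN; apply: maxminor_wdet => // [a b abk|||]; rewrite /wN /upd ?eqxx /wP.
- have -> : (a == k.-1) = false by lia.
  by case: eqP; lia.
- by case: eqP; lia.
- by case: eqP; lia.
- by lia.
Qed.

Lemma maxminor_wQ B j : 0 <= j <= n%:Z ->
  maxminor B (residues n ((j - k%:Z) :: zint (j - k%:Z + 2) j)) = wdet B (wQ j).
Proof.
move=> jn; rewrite residues_wQ; apply: maxminor_wdet => // [a b abk|||]; rewrite /wQ /upd ?eqxx /wP.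
- have -> : (b == 0%N) = false by lia.
  by case: eqP; lia.
- by case: eqP; lia.
- by lia.
- by case: eqP; lia.
Qed.

Lemma wdet_wPn B j : wdet B (wP (j + n%:Z)) = wdet B (wP j).
Proof. by rewrite -(wdet_shift B (wP j)); apply: wdet_ext => a _; rewrite /wP; lia. Qed.

Lemma wdet_wNn B j : wdet B (wN (j + n%:Z)) = wdet B (wN j).
Proof.
rewrite -(wdet_shift B (wN j)); apply: wdet_ext => a _; rewrite /wN /upd /wP.
by case: eqP; lia.
Qed.

Lemma wdet_wQn B j : wdet B (wQ (j + n%:Z)) = wdet B (wQ j).
Proof.
rewrite -(wdet_shift B (wQ j)); apply: wdet_ext => a _; rewrite /wQ /upd /wP.
by case: eqP; lia.
Qed.

(* Adding [b] times [rowz B (i + 1)] to [rowz B i] is the action of [x_i(xcoef i b)]. *)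
Definition xcoef i (b : K) : K := if i == 0%N :> nat then twist K k * b else b.

(* What [x_i] adds to the coordinates [wN (i + 1)], [wN (i - 1)] and [wQ i]. For [k = 1] the row
   [i] does not occur in the first and the last of them. *)
Definition wdetR B j : K := if k == 1%N then 0 else wdet B (upd (wN (j + 1)) k.-2 (j + 1)).
Definition wdetT B j : K := wdet B (upd (wN j) k.-1 (j + 2)).
Definition wdetS B j : K := if k == 1%N then 0 else wdet B (upd (wQ j) k.-1 (j + 1)).

Section RowOperation.
Variables (B : 'M[K]_(n, k)) (i : 'I_n) (b : K).
Local Notation B' := (xmx i (xcoef i b) *m B).

Lemma row_xmx (r : 'I_n) :
  row r B' = row r B + (r == ord_pred i)%:R *: (xcoef i b *: row i B).
Proof.
rewrite /xmx mulmxDl mul1mx linearD /=; congr (_ + _).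
rewrite -scalemxAl linearZ /= row_mul scalerA mulrC -scalerA; congr (_ *: _).
rewrite (rowE i B) scalemxAl; congr (_ *m _); apply/rowP => l.
by rewrite !mxE /= -natrM mulnb.
Qed.

Lemma ord_pred_shift : exists q : int, i%:Z = (ord_pred i).+1%:Z + q * n%:Z.
Proof.
rewrite val_ord_pred; have := ltn_ord i; case: eqP => i0 ilt; [exists (-1) | exists 0]; lia.
Qed.

Lemma rowz_xmx_at : rowz B' i%:Z = rowz B i%:Z + b *: rowz B (i%:Z + 1).
Proof.
have at_pred : rowz B' (ord_pred i).+1%:Z =
    rowz B (ord_pred i).+1%:Z + b *: rowz B ((ord_pred i).+1%:Z + 1).
  rewrite !rowz_ord row_xmx eqxx scale1r; congr (_ + _).
  rewrite /xcoef; have := ltn_ord i; case: eqP => i0 ilt.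
    (* The wrapped case: row n+1 is [twist] times row 1, which accounts for the sign in [xcoef]. *)
    have -> : (ord_pred i).+1%:Z + 1 = i.+1%:Z + n%:Z.
      by rewrite val_ord_pred i0 /=; lia.
    by rewrite rowzDn rowz_ord scalerA mulrC.
  have -> : (ord_pred i).+1%:Z + 1 = i.+1%:Z.
    by rewrite val_ord_pred; case: eqP => //; lia.
  by rewrite rowz_ord.
have [q ->] := ord_pred_shift.
rewrite -addrA (addrC _ 1) addrA !rowz_shift at_pred scalerDr !scalerA.
by rewrite (mulrC b).
Qed.

Lemma rowz_xmx_out j : i%:Z - n%:Z < j < i%:Z + n%:Z -> j != i%:Z -> rowz B' j = rowz B j.
Proof.
move=> jn ji; have [r [q jE]] := int_eqmod n' j.
rewrite jE !rowz_shift !rowz_ord row_xmx; case: eqP => [ri|_]; last by rewrite scale0r addr0.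
have [q' iE] := ord_pred_shift; rewrite ri in jE; exfalso.
have dE : j - i%:Z = (q - q') * n%:Z by rewrite jE iE; ring.
have : j - i%:Z != 0 by rewrite subr_eq0.
have : - n%:Z < j - i%:Z < n%:Z by lia.
rewrite dE; move: (q - q') => d; case: (ltrgtP d 0) => d0; nia.
Qed.

Lemma wdet_xmx_at w s : (s < k)%N -> w s = i%:Z ->
  (forall a, (a < k)%N -> a != s -> (i%:Z - n%:Z < w a < i%:Z + n%:Z) && (w a != i%:Z)) ->
  wdet B' w = wdet B w + b * wdet B (upd w s (i%:Z + 1)).
Proof.
move=> sk ws wa; apply: wdet_lin => //; first by rewrite ws rowz_xmx_at.
by move=> a ak as_; have /andP[] := wa a ak as_; apply: rowz_xmx_out.
Qed.

Lemma wdet_xmx_out w :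
  (forall a, (a < k)%N -> (i%:Z - n%:Z < w a < i%:Z + n%:Z) && (w a != i%:Z)) ->
  wdet B' w = wdet B w.
Proof.
by move=> wa; apply: wdet_same => a ak; have /andP[] := wa a ak; apply: rowz_xmx_out.
Qed.

(** The correction term replaces i by i+1, which is already an entry, so it has two equal rows. *)
Lemma wdet_xmx_dup w s s' : (s < k)%N -> (s' < k)%N -> w s = i%:Z -> w s' = i%:Z + 1 ->
  (forall a, (a < k)%N -> a != s -> (i%:Z - n%:Z < w a < i%:Z + n%:Z) && (w a != i%:Z)) ->
  wdet B' w = wdet B w.
Proof.
move=> sk s'k ws ws' wa; rewrite (wdet_xmx_at sk ws wa).
have ss' : s' != s by apply/eqP => ss'; move: ws'; rewrite ss' ws; lia.
have -> : wdet B (upd w s (i%:Z + 1)) = 0; last by rewrite mulr0 addr0.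
by apply: (wdet_dup B sk s'k); [rewrite eq_sym | rewrite /upd eqxx (negPf ss') ws'].
Qed.

Lemma xmx_wP : wdet B' (wP i%:Z) = wdet B (wP i%:Z) + b * wdet B (wN i%:Z).
Proof. by apply: wdet_xmx_at => [||a ak aks]; rewrite /wP; lia. Qed.

(** A cyclic interval that does not end at i either avoids i or contains i+1 as well. *)
Lemma xmx_wP_other j : i%:Z < j < i%:Z + n%:Z -> wdet B' (wP j) = wdet B (wP j).
Proof.
move=> jn; have [ij|ij] := lerP (j - k%:Z + 1) i%:Z; last first.
  by apply: wdet_xmx_out => a ak; rewrite /wP; lia.
have [s sE] : exists s : nat, s%:Z = i%:Z - (j - k%:Z + 1).
  by exists (absz (i%:Z - (j - k%:Z + 1))%R); lia.
by apply: (@wdet_xmx_dup _ s s.+1) => [||||a ak as_]; rewrite /wP; lia.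
Qed.

Lemma xmx_wN : wdet B' (wN i%:Z) = wdet B (wN i%:Z).
Proof. by apply: wdet_xmx_out => a ak; rewrite /wN /upd /wP; case: eqP; lia. Qed.

Lemma xmx_wN_pred : wdet B' (wN (i%:Z - 1)) = wdet B (wN (i%:Z - 1)) + b * wdetT B (i%:Z - 1).
Proof.
rewrite (@wdet_xmx_at _ k.-1).
- by congr (_ + _ * _); apply: wdet_ext => a _; rewrite /upd; case: eqP; lia.
- by lia.
- by rewrite /wN /upd eqxx; lia.
- by move=> a ak ak1; rewrite /wN /upd (negPf ak1) /wP; lia.
Qed.

Lemma xmx_wN_succ : (2 < n)%N ->
  wdet B' (wN (i%:Z + 1)) = wdet B (wN (i%:Z + 1)) + b * wdetR B i%:Z.
Proof.
move=> n2; rewrite /wdetR; case: eqP => k1.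
  rewrite mulr0 addr0; apply: wdet_xmx_out => a ak; rewrite /wN /upd k1 /wP.
  by (have -> : (a == 1.-1) by lia); lia.
rewrite (@wdet_xmx_at _ k.-2) //.
- by lia.
- rewrite /wN /upd /wP; have -> : (k.-2 == k.-1) = false by lia.
  by lia.
- by move=> a ak ak1; rewrite /wN /upd /wP; case: eqP; lia.
Qed.

(** Away from j = i-1, i, i+1 modulo n, the gap and the isolated entry of [wN j] do not separate i
    from i+1. *)
Lemma xmx_wN_other j : i%:Z + 1 < j < i%:Z + n%:Z - 1 -> wdet B' (wN j) = wdet B (wN j).
Proof.
move=> jn; have [ij|ij] := lerP (j - k%:Z + 1) i%:Z; last first.
  by apply: wdet_xmx_out => a ak; rewrite /wN /upd /wP; case: eqP; lia.
have [s sE] : exists s : nat, s%:Z = i%:Z - (j - k%:Z + 1).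
  by exists (absz (i%:Z - (j - k%:Z + 1))%R); lia.
by apply: (@wdet_xmx_dup _ s s.+1) => [||||a ak as_]; rewrite /wN /upd /wP; try case: eqP; lia.
Qed.

Lemma xmx_wQ : wdet B' (wQ i%:Z) = wdet B (wQ i%:Z) + b * wdetS B i%:Z.
Proof.
rewrite /wdetS; case: eqP => k1.
  rewrite mulr0 addr0; apply: wdet_xmx_out => a ak; rewrite /wQ /upd /wP.
  by case: eqP; lia.
rewrite (@wdet_xmx_at _ k.-1) //.
- by lia.
- rewrite /wQ /upd /wP; have -> : (k.-1 == 0%N) = false by lia.
  by lia.
- by move=> a ak ak1; rewrite /wQ /upd /wP; case: eqP; lia.
Qed.

(** The index set is {i} together with [i+2, i+k]; replacing i by i+1 fills the gap and leaves an
    interval. *)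
Lemma xmx_wQ_add : wdet B' (wQ (i%:Z + k%:Z)) =
  wdet B (wQ (i%:Z + k%:Z)) + b * wdet B (wP (i%:Z + k%:Z)).
Proof.
rewrite (@wdet_xmx_at _ 0%N) //.
- by congr (_ + _ * _); apply: wdet_ext => a _; rewrite /wQ /upd /wP; case: eqP => [->|]; lia.
- by rewrite /wQ /upd /=; lia.
- by move=> a ak a0; rewrite /wQ /upd /wP (negPf a0); lia.
Qed.

Lemma xmx_wQ_other j : i%:Z < j < i%:Z + n%:Z -> j != i%:Z + k%:Z ->
  wdet B' (wQ j) = wdet B (wQ j).
Proof.
move=> jn jk; have [ij|ij] := lerP (j - k%:Z + 2) i%:Z; last first.
  by apply: wdet_xmx_out => a ak; rewrite /wQ /upd /wP; case: eqP; lia.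
have [s sE] : exists s : nat, s%:Z = i%:Z - (j - k%:Z + 1).
  by exists (absz (i%:Z - (j - k%:Z + 1))%R); lia.
by apply: (@wdet_xmx_dup _ s s.+1) => [||||a ak as_]; rewrite /wQ /upd /wP; try case: eqP; lia.
Qed.

Lemma xmx_wdetT : (2 < n)%N -> wdetT B' i%:Z = wdetT B i%:Z.
Proof.
by move=> n2; apply: wdet_xmx_out => a ak; rewrite /wN /upd /wP; case: eqP; lia.
Qed.

Lemma xmx_wdetR_pred : wdetR B' (i%:Z - 1) = wdetR B (i%:Z - 1).
Proof.
rewrite /wdetR; case: eqP => // k1.
apply: (@wdet_xmx_dup _ k.-2 k.-1); try (move=> a ak ak1); rewrite /wN /upd /wP ?eqxx; try lia.
- by case: eqP; lia.
- by case: eqP => //; case: eqP; lia.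
Qed.

End RowOperation.

Lemma wdetT_shift B j : wdetT B (j + n%:Z) = wdetT B j.
Proof.
rewrite /wdetT -(wdet_shift B (upd (wN j) _ _)); apply: wdet_ext => a _.
by rewrite /wN /upd /wP; case: eqP; lia.
Qed.

Lemma wdetR_shift B j : wdetR B (j + n%:Z) = wdetR B j.
Proof.
rewrite /wdetR; case: eqP => // _.
rewrite -(wdet_shift B (upd (wN (j + 1)) _ _)); apply: wdet_ext => a _.
by rewrite /wN /upd /wP; case: eqP; [|case: eqP]; lia.
Qed.

Lemma last_lt : (k.-1 < k)%N. Proof. by rewrite prednK. Qed.

(** The entry j+1 of N_j is exchanged against the entries of N_(j+1). Exchanging with j+2 gives
    P_(j+1) T, and exchanging with j gives R P_j, which requires k > 1; all other entries already
    occur in N_j. *)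
Lemma plucker_braid B j :
  wdet B (wN (j + 1)) * wdet B (wN j) =
  wdetR B j * wdet B (wP j) + wdet B (wP (j + 1)) * wdetT B j.
Proof.
have {1}-> : wdet B (wN j) = wdet B (upd (wN j) (Ordinal last_lt) (j + 1)).
  by apply: wdet_ext => a _; rewrite /wN /upd /=; case: eqP.
rewrite wdet_exchange (bigD1 (Ordinal last_lt)) //= addrC; congr (_ + _); last first.
  congr (_ * _); apply: wdet_ext => a _; rewrite /wN /wP /upd ?eqxx.
    by case: eqP => // ->; lia.
  by case: eqP => // _; lia.
rewrite /wdetR; case: eqP => k1.
  rewrite mul0r big1 // => r; rewrite -val_eqE /= => rk.
  by have := ltn_ord r; lia.
have k2 : (k.-2 < k)%N by lia.
rewrite (bigD1 (Ordinal k2)) /=; last by rewrite -val_eqE /=; lia.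
rewrite big1 ?addr0 => [|r /andP[]].
  congr (_ * _); apply: wdet_ext => a _; rewrite /wN /wP /upd.
  by case: eqP => [->|//]; (have -> : (k.-2 == k.-1) = false by lia); lia.
rewrite -!val_eqE /= => rk rk2; have rk' := ltn_ord r.
(* The entry r of [wN (j + 1)] is the entry r+1 of [wN j]. *)
rewrite (@wdet_dup _ _ _ _ (upd (wN j) k.-1 (wN (j + 1) r)) r.+1 k.-1) ?mulr0 //; try lia.
by rewrite /wN /upd /wP eqxx (negPf rk); (have -> : (r.+1 == k.-1) = false by lia); lia.
Qed.

(** The entry j+1 of N_j is exchanged against the entries of Q_j. For k > 1 the exchange with j
    gives S P_j and the exchange with j-k gives P_(j-1) P_(j+1), all other terms having a repeated
    row; for k = 1 only the latter product is present. *)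
Lemma plucker_decoration B j :
  wdet B (wQ j) * wdet B (wN j) =
  wdetS B j * wdet B (wP j) + wdet B (wP (j - 1)) * wdet B (wP (j + 1)).
Proof.
rewrite /wdetS; case: eqP => k1.
  rewrite mul0r add0r; congr (_ * _); apply: wdet_ext => a ak; rewrite /wQ /wN /upd /wP k1.
    by (have -> : (a == 0%N) by lia); lia.
  by (have -> : (a == 1.-1)%N by lia); lia.
have {1}-> : wdet B (wN j) = wdet B (upd (wN j) (Ordinal last_lt) (j + 1)).
  by apply: wdet_ext => a _; rewrite /wN /upd /=; case: eqP.
rewrite wdet_exchange (bigD1 (Ordinal last_lt)) //=; congr (_ + _).
  congr (_ * _); apply: wdet_ext => a _; rewrite /wN /wQ /wP /upd.
  by case: eqP => // ->; (have -> : (k.-1 == 0%N) = false by lia); lia.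
rewrite (bigD1 (Ordinal k_gt0)) /=; last by rewrite -val_eqE /=; lia.
rewrite big1 ?addr0 => [|r /andP[]].
  (* Both factors of this term are intervals rotated by one place, so each contributes [twist] and
     the signs cancel. *)
  have -> : wdet B (upd (wN j) k.-1 (wQ j 0)) = twist K k * wdet B (wP (j - 1)).
    transitivity (wdet B (fun a => if a == k.-1 then j - k%:Z else wP j a)).
      by apply: wdet_ext => a _; rewrite /wN /wQ /upd; case: eqP.
    rewrite wdet_rot //; congr (_ * _); apply: wdet_ext => -[|a] _; rewrite /wP; lia.
  have -> : wdet B (wP (j + 1)) = twist K k * wdet B (upd (wQ j) 0 (j + 1)).
    transitivity (wdet B (fun a => if a == k.-1 then j + 1 else wP (j + 1) a)).
      by apply: wdet_ext => a _; rewrite /wP; case: eqP; lia.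
    rewrite wdet_rot //; congr (_ * _); apply: wdet_ext => -[|a] _; rewrite /wQ /upd /wP /=; lia.
  by ring.
rewrite -!val_eqE /= => rk r0; have rk' := ltn_ord r.
rewrite (@wdet_dup _ _ _ _ (upd (wN j) k.-1 (wQ j r)) r k.-1) ?mulr0 //; try lia.
by rewrite /wN /wQ /upd /wP eqxx (negPf rk) (negPf r0).
Qed.

End PluckerIdentities.

(** * The crystal operators on representing matrices *)

Lemma to_GmP (K : fieldType) (a : K) (c : Gm K) : to_Gm a = Some c <-> val c = a.
Proof.
by split=> [|<-]; rewrite /to_Gm ?valK //; case: insubP => // c' _ <- [<-].
Qed.

Lemma to_Gm_neq0 (K : fieldType) (a : K) : a != 0 -> exists2 c, to_Gm a = Some c & val c = a.
Proof. by move=> a0; exists (Sub a a0) => //; apply/to_GmP. Qed.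

Lemma gm_mulC (K : fieldType) (c d : Gm K) : gm_mul c d = gm_mul d c.
Proof. by apply: val_inj; rewrite /= mulrC. Qed.

Section UnipotentMatrices.
Variables (K : fieldType) (n : nat).
Implicit Types (i j : 'I_n) (a b : K).

Lemma mul_xmx i a (C : 'M[K]_n) : xmx i a *m C = C + a *: (delta_mx (ord_pred i) i *m C).
Proof. by rewrite /xmx mulmxDl mul1mx scalemxAl. Qed.

Lemma mul_delta_xmx i j b :
  delta_mx (ord_pred i) i *m xmx j b = delta_mx (ord_pred i) i +
    b *: (delta_mx (ord_pred i) i *m delta_mx (ord_pred j) j) :> 'M[K]_n.
Proof. by rewrite /xmx mulmxDr mulmx1 -scalemxAr. Qed.

Lemma mul_xmx_same i a b : i != ord_pred i -> xmx i a *m xmx i b = xmx i (a + b) :> 'M[K]_n.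
Proof.
move=> ip; rewrite mul_xmx mul_delta_xmx mul_delta_mx_0 // scaler0 addr0.
by rewrite /xmx -addrA -scalerDl (addrC b).
Qed.

Lemma xmx_unit i a : i != ord_pred i -> xmx i a \in @unitmx K n.
Proof.
move=> ip; have /mulmx1_unit[] // : xmx i a *m xmx i (- a) = 1%:M.
by rewrite mul_xmx_same // subrr /xmx scale0r addr0.
Qed.

Lemma mul_xmx_comm i j a b : i != ord_pred j -> j != ord_pred i ->
  xmx i a *m xmx j b = xmx j b *m xmx i a.
Proof.
move=> ij ji; rewrite !mul_xmx !mul_delta_xmx !mul_delta_mx_0 // !scaler0 !addr0.
by rewrite /xmx addrAC.
Qed.

(** Since E^2 = F^2 = F E = 0, the two sides are 1 + (a1+a3) E + a2 F + a1 a2 E F and 1 + b2 E +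
    (b1+b3) F + b2 b3 E F. *)
Lemma mul_xmx_braid i j a1 a2 a3 b1 b2 b3 :
  i != ord_pred i -> i = ord_pred j -> j != i -> j != ord_pred i ->
  a1 + a3 = b2 -> a2 = b1 + b3 -> a1 * a2 = b2 * b3 ->
  xmx i a1 *m (xmx j a2 *m xmx i a3) = xmx j b1 *m (xmx i b2 *m xmx j b3) :> 'M[K]_n.
Proof.
move=> ip ij ji jp <- -> aab.
rewrite /xmx -ij; set E := delta_mx _ i; set F := delta_mx i j.
have EE : E *m E = 0 by apply: mul_delta_mx_0.
have FF : F *m F = 0 by apply: mul_delta_mx_0.
have FE : F *m E = 0 by apply: mul_delta_mx_0.
rewrite !(mulmxDl, mulmxDr, mul1mx, mulmx1, =^~ scalemxAl, =^~ scalemxAr) !mulmxA.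
rewrite EE FE FF -[E *m F *m E]mulmxA FE !(mul0mx, mulmx0, scaler0, addr0) !scalerA aab.
rewrite !scalerDl; move: (_ *: (E *m F)) (a1 *: E) (a3 *: E) (b1 *: F) (b3 *: F) => g e e' f f'.
by apply/matrixP => r s; rewrite !mxE; ring.
Qed.

End UnipotentMatrices.

(* The parameters of the six factors of the braid relation, in terms of the Plücker coordinates
   [A], [p] and [B], [q] that define the two actions. *)
Lemma braid_identity (K : fieldType) (A B p q R T c1 c2 : K)
    (a3 := (c2 - 1) * A / p) (q1 := q + a3 * R) (a2 := (c1 * c2 - 1) * B / q1)
    (p2 := p + a2 * T) (a1 := (c1 - 1) * (c2 * A) / p2)
    (b3 := (c1 - 1) * B / q) (p1 := p + b3 * T) (b2 := (c1 * c2 - 1) * A / p1)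
    (q2 := q + b2 * R) (b1 := (c2 - 1) * (c1 * B) / q2) :
  q * p = R * A + B * T -> A != 0 -> p != 0 -> q != 0 -> c1 != 0 -> c2 != 0 ->
  q1 != 0 -> p2 != 0 -> p1 != 0 -> q2 != 0 ->
  [/\ a1 + a3 = b2, a2 = b1 + b3 & a1 * a2 = b2 * b3].
Proof.
move=> rel A0 p0 q0 c10 c20; have RE : R = (q * p - B * T) / A by rewrite rel; field.
(* Once R is eliminated, the four intermediate denominators are monomial in y and z: q1 = z/p, p1 =
   y/q, p2 = p c2 y/z and q2 = c1 q z/y. Their non-vanishing therefore yields that of y and z. *)
pose y := q * p + (c1 - 1) * (B * T); pose z := c2 * (q * p) - (c2 - 1) * (B * T).
have q1E : q1 = z / p by rewrite /q1 /a3 /z RE; field; rewrite p0 A0.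
have p1E : p1 = y / q by rewrite /p1 /b3 /y; field.
rewrite q1E p1E mulf_eq0 negb_or => /andP[z0 _].
have p2E : p2 = p * c2 * y / z by rewrite /p2 /a2 q1E /y /z; field; rewrite p0 -/z z0.
rewrite p2E !mulf_eq0 !negb_or => /andP[/andP[_ y0] _] _.
have q2E : q2 = c1 * q * z / y.
  by rewrite /q2 /b2 p1E RE /y /z; field; rewrite A0 q0 -/y y0.
move=> _; rewrite /a1 /a2 /b1 /b2 /a3 /b3 q1E p1E p2E q2E.
split; rewrite /y /z; field; rewrite -/y -/z ?p0 ?q0 ?y0 ?z0 ?c10 ?c20 //.
Qed.

(** * The data and the operators e_i^c in terms of a spanning matrix *)

Section Crystal.
Variables (K : fieldType) (k n' : nat).
Local Notation n := n'.+1.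
Hypotheses (k_gt0 : (0 < k)%N) (k_lt_n : (k < n)%N).
Implicit Types (B : 'M[K]_(n, k)) (i j : 'I_n) (x y : Xk K n k) (c : Gm K).
Local Notation A := (Xk_atlas K n k).
Local Notation "'P_ B j" := (wdet B (wP k j)) (at level 10, B at level 8, j at level 8).
Local Notation "'N_ B j" := (wdet B (wN k j)) (at level 10, B at level 8, j at level 8).
Local Notation "'Q_ B j" := (wdet B (wQ k j)) (at level 10, B at level 8, j at level 8).

Lemma ord_pred_neq i : i != ord_pred i.
Proof. by apply/eqP => ii; have := val_ord_pred i; rewrite -ii; case: eqP; lia. Qed.

(** A change of spanning matrix multiplies both coordinates by the same determinant. *)
Lemma plucker_ratio x B (I J : seq int) : spans x.1 B ->
  plucker I x.1 / plucker J x.1 =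
  maxminor B (residues n I) / maxminor B (residues n J).
Proof.
move=> [g gu xB]; rewrite /plucker xB !maxminorM //.
by rewrite -mulf_div divff ?mulr1 // -unitfE -unitmxE.
Qed.

Lemma Xphi_spans i x B : spans x.1 B ->
  Xphi i x = to_Gm (val x.2 ^- (i == 0 :> nat)%N * ('N_ B i%:Z / 'P_ B i%:Z)).
Proof.
move=> sx; have ilt := ltn_ord i.
by rewrite /Xphi (plucker_ratio _ _ sx) maxminor_wP ?maxminor_wN //; lia.
Qed.

Lemma Xeps_spans i x B : spans x.1 B ->
  Xeps i x = to_Gm (val x.2 ^- (i == k :> nat)%N *
    (('N_ B i%:Z * 'P_ B i%:Z) / ('P_ B (i%:Z - 1) * 'P_ B (i%:Z + 1)))).
Proof.
move=> sx; have ilt := ltn_ord i; rewrite /Xeps -!mulf_div !(plucker_ratio _ _ sx) !mulf_div.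
rewrite (_ : i%:Z - k%:Z = i%:Z - 1 - k%:Z + 1); last by lia.
rewrite (_ : i%:Z - 1 - k%:Z + 1 + 2 = i%:Z + 1 - k%:Z + 1); last by lia.
rewrite (_ : i%:Z - 1 - k%:Z + 1 + 1 = i%:Z - k%:Z + 1); last by lia.
by rewrite !maxminor_wP ?maxminor_wN //; lia.
Qed.

Lemma Xgamma_spans x B : spans x.1 B ->
  Xgamma x = insub (\row_(i < n) ((if (1 <= i <= k)%N then 1 else val x.2) *
     ('P_ B i%:Z / 'P_ B (i%:Z - 1)))).
Proof.
move=> sx; rewrite /Xgamma; congr insub; apply/rowP => i; rewrite !mxE; congr (_ * _).
have ilt := ltn_ord i; rewrite (plucker_ratio _ _ sx).
rewrite (_ : i%:Z - k%:Z = i%:Z - 1 - k%:Z + 1); last by lia.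
rewrite (_ : i%:Z - 1 - k%:Z + 1 + 1 = i%:Z - k%:Z + 1); last by lia.
by rewrite !maxminor_wP //; lia.
Qed.

Definition fterm (t : K) B (r : nat) : K :=
  (if r == k then t else 1) * ('Q_ B r%:Z / 'P_ B r%:Z).

Lemma Xf_value_spans x B : spans x.1 B -> Xf_value x = \sum_(r < n) fterm (val x.2) B r.
Proof.
move=> sx; rewrite /Xf_value.
have -> : plucker (rcons (zint 2 k%:Z) n%:Z) x.1 / plucker (zint 1 k%:Z) x.1 =
    'Q_ B k%:Z / 'P_ B k%:Z.
  rewrite (plucker_ratio _ _ sx) -maxminor_wQ // -?maxminor_wP //; try lia.
  (* Row n has residue 0 = k-k, so [2, k] together with n is the index set of [wQ k]. *)
  rewrite (_ : k%:Z - k%:Z = 0); last by lia.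
  congr (maxminor _ _ / _); apply/setP => r; rewrite !inE has_rcons /=; congr orb.
  by rewrite modzz mod0z.
rewrite -(big_mkord xpredT (fterm (val x.2) B)).
(* The summand with index n is the one with index 0 by periodicity; neither index equals k, so
   neither carries the factor t. *)
have -> : \sum_(0 <= r < n) fterm (val x.2) B r = \sum_(1 <= r < n.+1) fterm (val x.2) B r.
  rewrite [LHS]big_ltn // [RHS]big_nat_recr //= addrC; congr (_ + _); rewrite /fterm.
  have -> : (0%N == k) = false by lia.
  have -> : (n == k) = false by lia.
  by rewrite -[n%:Z]add0r (wdet_wPn k_gt0 k_lt_n) (wdet_wQn k_gt0 k_lt_n).
rewrite [RHS](bigD1_seq k) ?iota_uniq ?mem_index_iota //=; last by lia.
rewrite [RHS]addrC; congr (_ + _); last by rewrite /fterm eqxx.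
rewrite big_nat_cond [RHS]big_nat_cond; apply: eq_bigr => r /andP[rn rk].
rewrite (plucker_ratio _ _ sx) /fterm (negPf rk) mul1r.
by rewrite maxminor_wP ?maxminor_wQ //; lia.
Qed.

Lemma Xf_spans x B : spans x.1 B ->
  Xf x = if [forall i : 'I_n, 'P_ B i%:Z != 0] then to_Gm (\sum_(r < n) fterm (val x.2) B r)
         else None.
Proof.
move=> sx; rewrite /Xf (Xf_value_spans sx); congr (if _ then _ else _).
apply: eq_forallb => i; have [g gu xB] := sx; have ilt := ltn_ord i.
rewrite /plucker xB maxminorM // maxminor_wP //; last by lia.
by rewrite mulf_eq0 negb_or; move: gu; rewrite unitmxE unitfE => ->; rewrite andbT.
Qed.

(* [e_i^c] in terms of a representing matrix: the powers of [t] cancel. *)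
Definition ecoef B i c : K := (val c - 1) * 'P_ B i%:Z / 'N_ B i%:Z.
Definition emx B i c : 'M[K]_(n, k) := xmx i (xcoef k i (ecoef B i c)) *m B.

Lemma Xk_eq x y B : spans x.1 B -> spans y.1 B -> x.2 = y.2 -> x = y.
Proof. by case: x y => [M t] [M' t'] /= sM sM' ->; rewrite (spans_inj sM sM'). Qed.

Lemma Xphi_neq0 i x B v : spans x.1 B -> Xphi i x = Some v ->
  'P_ B i%:Z != 0 /\ 'N_ B i%:Z != 0.
Proof.
move=> sx; rewrite (Xphi_spans _ sx) => /to_GmP vE; have := valP v; rewrite vE.
by rewrite !mulf_eq0 !negb_or !invr_eq0 => /and3P[_ N0 P0].
Qed.

Lemma Xphi_def i x B : spans x.1 B -> 'P_ B i%:Z != 0 -> 'N_ B i%:Z != 0 ->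
  exists2 v, Xphi i x = Some v &
    val v = val x.2 ^- (i == 0 :> nat)%N * ('N_ B i%:Z / 'P_ B i%:Z).
Proof.
move=> sx P0 N0; rewrite (Xphi_spans _ sx); apply: to_Gm_neq0.
by rewrite !mulf_neq0 ?invr_eq0 ?expf_neq0 // (valP x.2).
Qed.

Lemma Xe_phi i c x B v : spans x.1 B -> Xphi i x = Some v ->
  Xe i c x = Some (gr_act (xmx i (xcoef k i (ecoef B i c))) x.1, x.2).
Proof.
move=> sx phix; have [P0 N0] := Xphi_neq0 sx phix; have t0 := valP x.2.
rewrite /Xe phix; move: phix; rewrite (Xphi_spans _ sx) => /to_GmP ->.
congr (Some (gr_act (xmx i _) _, _)); rewrite /xcoef /ecoef /twist; case: eqP => _ /=.
  by field; rewrite t0 P0 N0.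
by rewrite expr0 invr1 mul1r; field; rewrite P0 N0.
Qed.

Lemma Xe_def i c x B : spans x.1 B -> 'P_ B i%:Z != 0 -> 'N_ B i%:Z != 0 ->
  exists2 y, Xe i c x = Some y & y.2 = x.2 /\ spans y.1 (emx B i c).
Proof.
move=> sx P0 N0; have [v phix _] := Xphi_def sx P0 N0.
rewrite (Xe_phi c sx phix); eexists; first reflexivity; split=> //=.
by apply: spans_act => //; apply: xmx_unit; apply: ord_pred_neq.
Qed.

Lemma Xe_spans i c x y B : spans x.1 B -> Xe i c x = Some y ->
  [/\ 'P_ B i%:Z != 0, 'N_ B i%:Z != 0, y.2 = x.2 & spans y.1 (emx B i c)].
Proof.
move=> sx ex; have [v phix] : exists v, Xphi i x = Some v.
  by move: ex; rewrite /Xe; case: (Xphi i x) => // v _; exists v.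
have [P0 N0] := Xphi_neq0 sx phix; have [y' ex' [ty sy]] := Xe_def c sx P0 N0.
by move: ex; rewrite ex' => -[<-].
Qed.

Lemma emx_P B i c : 'N_ B i%:Z != 0 -> 'P_ (emx B i c) i%:Z = val c * 'P_ B i%:Z.
Proof. by move=> N0; rewrite xmx_wP // /ecoef; field. Qed.

Lemma emx_N B i c : 'N_ (emx B i c) i%:Z = 'N_ B i%:Z.
Proof. exact: xmx_wN. Qed.

Lemma emx_P_other B i c (j : int) : i%:Z - n%:Z < j < i%:Z + n%:Z -> j != i%:Z ->
  'P_ (emx B i c) j = 'P_ B j.
Proof.
move=> jn ji; have [ij|ij] := lerP j i%:Z; last by apply: xmx_wP_other => //; lia.
by rewrite -!(wdet_wPn k_gt0 k_lt_n _ j); apply: xmx_wP_other => //; lia.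
Qed.

Lemma Xe_mul i c1 c2 x v : Xphi i x = Some v ->
  obind (Xe i c1) (Xe i c2 x) = Xe i (gm_mul c1 c2) x.
Proof.
have sx := spans_self x.1; move: (gr_mx x.1) sx => B sx phix.
have [P0 N0] := Xphi_neq0 sx phix.
have [y -> [ty sy]] := Xe_def c2 sx P0 N0.
have [||z ez [tz sz]] := Xe_def (i := i) c1 sy; rewrite ?emx_P ?emx_N ?mulf_neq0 ?(valP c2) //.
have [z' -> [tz' sz']] := Xe_def (gm_mul c1 c2) sx P0 N0.
rewrite /= ez; congr Some; apply: Xk_eq sz _ _; last by rewrite tz ty tz'.
(* After e_i^(c2) the coefficient of the second step is (c1-1) c2 P/N, and (c2-1) + (c1-1) c2 = c1
   c2 - 1. *)
suff -> : emx (emx B i c2) i c1 = emx B i (gm_mul c1 c2) by [].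
rewrite {1}/emx {2}/emx mulmxA mul_xmx_same ?ord_pred_neq //; congr (xmx i _ *m B).
rewrite /xcoef; case: eqP => _; rewrite /ecoef emx_P ?emx_N //=; by field.
Qed.

Lemma Xe_1 i x v : Xphi i x = Some v -> Xe i (gm1 K) x = Some x.
Proof.
move=> phix; have sx := spans_self x.1; have [P0 N0] := Xphi_neq0 sx phix.
have [y -> [ty sy]] := Xe_def (gm1 K) sx P0 N0; congr Some; apply: Xk_eq sx _ => //.
by move: sy; rewrite /emx /ecoef /= subrr !mul0r /xcoef mulr0 if_same /xmx scale0r addr0 mul1mx.
Qed.

Lemma ordS_shift i : (ordS i)%:Z = i%:Z + 1 \/ (ordS i)%:Z + n%:Z = i%:Z + 1.
Proof.
rewrite /=; have := ltn_ord i; rewrite leq_eqVlt => /orP[/eqP iE|i1].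
  by right; rewrite iE modnn; lia.
by left; rewrite modn_small //; lia.
Qed.

Lemma ordS_neq_pred i : (2 < n)%N -> ordS i != ord_pred i.
Proof.
move=> n2; apply/eqP => jp; have := val_ord_pred i; rewrite -jp; have := ltn_ord i.
move: (nat_of_ord (ordS i)) (nat_of_ord i) (ordS_shift i) => a b ab bn.
by case: eqP; lia.
Qed.

Lemma P_ordS B i : 'P_ B (ordS i)%:Z = 'P_ B (i%:Z + 1).
Proof. by case: (ordS_shift i) => <- //; rewrite (wdet_wPn k_gt0 k_lt_n). Qed.

Lemma N_ordS B i : 'N_ B (ordS i)%:Z = 'N_ B (i%:Z + 1).
Proof. by case: (ordS_shift i) => <- //; rewrite (wdet_wNn k_gt0 k_lt_n). Qed.

Lemma emx_P_ordS B i c : 'P_ (emx B i c) (ordS i)%:Z = 'P_ B (ordS i)%:Z.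
Proof. by rewrite !P_ordS emx_P_other //; lia. Qed.

Lemma emx_N_ordS B i c : (2 < n)%N ->
  'N_ (emx B i c) (ordS i)%:Z = 'N_ B (ordS i)%:Z + ecoef B i c * wdetR B i%:Z.
Proof. by move=> n2; rewrite !N_ordS xmx_wN_succ. Qed.

Lemma emx_ordS_P B i c : 'P_ (emx B (ordS i) c) i%:Z = 'P_ B i%:Z.
Proof.
by have := ltn_ord i; case: (ordS_shift i) => iS iln; rewrite emx_P_other //; lia.
Qed.

Lemma emx_ordS_N B i c :
  'N_ (emx B (ordS i) c) i%:Z = 'N_ B i%:Z + ecoef B (ordS i) c * wdetT B i%:Z.
Proof.
have := xmx_wN_pred k_gt0 k_lt_n B (ordS i) (ecoef B (ordS i) c); rewrite -/(emx _ _ _).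
case: (ordS_shift i) => iS; first by rewrite (_ : (ordS i)%:Z - 1 = i%:Z) //; lia.
rewrite -!(wdet_wNn k_gt0 k_lt_n _ (_ - 1)) -(wdetT_shift k_gt0 k_lt_n).
by rewrite (_ : (ordS i)%:Z - 1 + n%:Z = i%:Z) //; lia.
Qed.

Lemma emx_T B i c : (2 < n)%N -> wdetT (emx B i c) i%:Z = wdetT B i%:Z.
Proof. by move=> n2; apply: xmx_wdetT. Qed.

Lemma emx_ordS_R B i c : wdetR (emx B (ordS i) c) i%:Z = wdetR B i%:Z.
Proof.
have := xmx_wdetR_pred k_gt0 k_lt_n B (ordS i) (ecoef B (ordS i) c); rewrite -/(emx _ _ _).
case: (ordS_shift i) => iS; first by rewrite (_ : (ordS i)%:Z - 1 = i%:Z) //; lia.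
rewrite -!(wdetR_shift k_gt0 k_lt_n _ (_ - 1)).
by rewrite (_ : (ordS i)%:Z - 1 + n%:Z = i%:Z) //; lia.
Qed.

Lemma xcoefE i (a : K) : xcoef k i a = xcoef k i 1 * a.
Proof. by rewrite /xcoef; case: eqP => _; rewrite ?mul1r ?mulr1. Qed.

Lemma emxE B i c (a : K) : ecoef B i c = a -> emx B i c = xmx i (xcoef k i 1 * a) *m B.
Proof. by move=> <-; rewrite -xcoefE. Qed.

Lemma emx_braid B i c1 c2 (j := ordS i) (c12 := gm_mul c1 c2) : (2 < n)%N ->
  'P_ B i%:Z != 0 -> 'N_ B i%:Z != 0 -> 'N_ B j%:Z != 0 ->
  'N_ (emx B i c2) j%:Z != 0 -> 'N_ (emx (emx B i c2) j c12) i%:Z != 0 ->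
  'N_ (emx B j c1) i%:Z != 0 -> 'N_ (emx (emx B j c1) i c12) j%:Z != 0 ->
  emx (emx (emx B i c2) j c12) i c1 = emx (emx (emx B j c1) i c12) j c2.
Proof.
move=> n2; have relB := plucker_braid k_gt0 k_lt_n B i%:Z.
rewrite -P_ordS -N_ordS -/j in relB; have [c10 c20] := (valP c1, valP c2).
rewrite /j !emx_ordS_N !emx_N_ordS // !emx_N emx_T // emx_ordS_R -/j => P0 Ni0 Nj0 q1 p2 p1 q2.
have a3E : ecoef B i c2 = (val c2 - 1) * 'P_ B i%:Z / 'N_ B i%:Z by [].
have b3E : ecoef B j c1 = (val c1 - 1) * 'P_ B j%:Z / 'N_ B j%:Z by [].
have a2E : ecoef (emx B i c2) j c12 = (val c1 * val c2 - 1) * 'P_ B j%:Z /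
    ('N_ B j%:Z + ecoef B i c2 * wdetR B i%:Z) by rewrite /ecoef emx_P_ordS emx_N_ordS.
have b2E : ecoef (emx B j c1) i c12 = (val c1 * val c2 - 1) * 'P_ B i%:Z /
    ('N_ B i%:Z + ecoef B j c1 * wdetT B i%:Z) by rewrite /ecoef emx_ordS_P emx_ordS_N.
have a1E : ecoef (emx (emx B i c2) j c12) i c1 = (val c1 - 1) * (val c2 * 'P_ B i%:Z) /
    ('N_ B i%:Z + ecoef (emx B i c2) j c12 * wdetT B i%:Z).
  by rewrite {1}/ecoef emx_ordS_P emx_ordS_N emx_P // emx_N emx_T.
have b1E : ecoef (emx (emx B j c1) i c12) j c2 = (val c2 - 1) * (val c1 * 'P_ B j%:Z) /
    ('N_ B j%:Z + ecoef (emx B j c1) i c12 * wdetR B i%:Z).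
  by rewrite {1}/ecoef emx_P_ordS emx_N_ordS // emx_P // emx_N emx_ordS_R.
rewrite a3E in a2E q1; rewrite b3E in b2E p1; rewrite a2E in a1E p2; rewrite b2E in b1E q2.
have [ab1 ab2 ab3] := braid_identity relB P0 Ni0 Nj0 c10 c20 q1 p2 p1 q2.
rewrite (emxE a1E) (emxE a2E) (emxE a3E) (emxE b1E) (emxE b2E) (emxE b3E) !mulmxA.
congr (_ *m B); rewrite -!mulmxA.
have predS : i = ord_pred j by rewrite /j ordSK.
have ji : j != i by have := ord_pred_neq j; rewrite -predS.
(* The factors [xcoef k i 1] and [xcoef k j 1] scale the three identities by the first factor, the
   second, and their product, so the identities survive the sign at index 0. *)
apply: mul_xmx_braid => //; first exact: ord_pred_neq.
- exact: ordS_neq_pred.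
- by rewrite -mulrDr ab1.
- by rewrite ab2 mulrDr.
- by rewrite mulrACA ab3; ring.
Qed.

Lemma emx_P_far B i j c : i != j -> 'P_ (emx B i c) j%:Z = 'P_ B j%:Z.
Proof.
rewrite -val_eqE /= => ij; have [iln jln] := (ltn_ord i, ltn_ord j).
by rewrite emx_P_other //; lia.
Qed.

Lemma not_adjacent_int i j : i != j -> ~~ adjacent i j ->
  (i%:Z + 1 < j%:Z < i%:Z + n%:Z - 1) \/ (i%:Z + 1 < j%:Z + n%:Z < i%:Z + n%:Z - 1).
Proof.
rewrite /adjacent negb_or -!val_eqE => ij /andP[ji ij'].
have [iln jln] := (ltn_ord i, ltn_ord j); have [Si Sj] := (ordS_shift i, ordS_shift j).
have {}ji : j%:Z != (ordS i)%:Z by rewrite eqz_nat.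
have {}ij' : i%:Z != (ordS j)%:Z by rewrite eqz_nat.
have {}ij : i%:Z != j%:Z by rewrite eqz_nat.
have [Siln Sjln] := (ltn_ord (ordS i), ltn_ord (ordS j)).
by move: (nat_of_ord (ordS i)) (nat_of_ord (ordS j)) Si Sj ji ij' Siln Sjln => a b; lia.
Qed.

Lemma emx_N_far B i j c : i != j -> ~~ adjacent i j -> 'N_ (emx B i c) j%:Z = 'N_ B j%:Z.
Proof.
move=> ij adj; have [jn|jn] := not_adjacent_int ij adj; first exact: xmx_wN_other.
by rewrite -!(wdet_wNn k_gt0 k_lt_n _ j%:Z); apply: xmx_wN_other.
Qed.

Lemma emx_comm B i j c1 c2 : i != j -> ~~ adjacent i j ->
  emx (emx B j c2) i c1 = emx (emx B i c1) j c2.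
Proof.
move=> ij adj; have ji : j != i by rewrite eq_sym.
have adj' : ~~ adjacent j i by rewrite /adjacent orbC.
rewrite (emxE (a := ecoef B i c1)); last by rewrite /ecoef emx_P_far ?emx_N_far.
rewrite (emxE (B := emx B i c1) (a := ecoef B j c2)); last by rewrite /ecoef emx_P_far ?emx_N_far.
rewrite (emxE (erefl (ecoef B j c2))) (emxE (erefl (ecoef B i c1))) !mulmxA.
rewrite mul_xmx_comm //; apply: contraNneq adj => ->; rewrite /adjacent ord_predK eqxx ?orbT //.
Qed.

(** Only the terms at i and at i+k modulo n change, and they are distinct because 0 < k < n. The
    numerator Q_(i+k) gains a multiple of P_(i+k), which yields the summand in c-1. At i both
    numerator and denominator change, and the second Plücker relation turns the difference into the
    summand in 1/c-1. *)
Lemma emx_fsum (t : K) B i c : (forall r : 'I_n, 'P_ B r%:Z != 0) -> 'N_ B i%:Z != 0 ->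
  \sum_(r < n) fterm t (emx B i c) r = \sum_(r < n) fterm t B r +
    (val c - 1) * (t ^+ (i == 0 :> nat)%N * ('P_ B i%:Z / 'N_ B i%:Z)) +
    ((val c)^-1 - 1) * (t ^+ (i == k :> nat)%N *
      ('P_ B (i%:Z - 1) * 'P_ B (i%:Z + 1) / ('N_ B i%:Z * 'P_ B i%:Z))).
Proof.
move=> P0 N0; have iln := ltn_ord i; have c0 := valP c.
have [r rE] : exists r : 'I_n, r%:Z = i%:Z + k%:Z \/ r%:Z + n%:Z = i%:Z + k%:Z.
  have [ik|ik] := ltnP (i + k)%N n; first by exists (Ordinal ik); left.
  have ik' : (i + k - n < n)%N by lia.
  by exists (Ordinal ik'); right => /=; lia.
have ri : r != i by rewrite -val_eqE /=; have := ltn_ord r; lia.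
have ir : i != r by rewrite eq_sym.
rewrite (bigD1 i) //= (bigD1 r) //= [X in _ = X + _ + _](bigD1 i) //=.
rewrite [X in _ = _ + X + _ + _](bigD1 r) //=.
have -> : \sum_(s < n | (s != i) && (s != r)) fterm t (emx B i c) s =
    \sum_(s < n | (s != i) && (s != r)) fterm t B s.
  apply: eq_bigr => s /andP[si sr]; have [sln rln] := (ltn_ord s, ltn_ord r).
  rewrite /fterm emx_P_far 1?eq_sym //; congr (_ * (_ / _)).
  rewrite -!val_eqE /= in si sr.
  have [is_|is_] := ltnP i s; first by apply: xmx_wQ_other => //; lia.
  by rewrite -!(wdet_wQn k_gt0 k_lt_n _ s%:Z); apply: xmx_wQ_other => //; lia.
have -> : fterm t (emx B i c) r = fterm t B r +
    (val c - 1) * (t ^+ (i == 0 :> nat)%N * ('P_ B i%:Z / 'N_ B i%:Z)).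
  have QE : 'Q_ (emx B i c) r%:Z = 'Q_ B r%:Z + ecoef B i c * 'P_ B r%:Z.
    have := xmx_wQ_add k_gt0 k_lt_n B i (ecoef B i c); rewrite -/(emx B i c).
    by case: rE => <- //; rewrite !(wdet_wQn k_gt0 k_lt_n) (wdet_wPn k_gt0 k_lt_n).
  rewrite /fterm (emx_P_far _ _ ir) QE /ecoef.
  (* The t-weighted term k of f is the affected term i+k exactly when i = 0, which matches the power
     of t in phi_0. *)
  have -> : (r == k :> nat) = (i == 0%N :> nat) by have := ltn_ord r; lia.
  by case: eqP => _; rewrite /= ?expr1 ?expr0; field; rewrite N0 P0.
have -> : fterm t (emx B i c) i = fterm t B i +
    ((val c)^-1 - 1) * (t ^+ (i == k :> nat)%N *
      ('P_ B (i%:Z - 1) * 'P_ B (i%:Z + 1) / ('N_ B i%:Z * 'P_ B i%:Z))).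
  (* The new term minus the old one is (1/c-1)(Q N - S P)/(N P), and the Plücker relation identifies
     Q N - S P. *)
  have PP : 'P_ B (i%:Z - 1) * 'P_ B (i%:Z + 1) =
      'Q_ B i%:Z * 'N_ B i%:Z - wdetS B i%:Z * 'P_ B i%:Z.
    by rewrite plucker_decoration //; ring.
  rewrite /fterm emx_P // PP xmx_wQ // /ecoef.
  by case: eqP => _; rewrite ?expr1 ?expr0; field; rewrite N0 P0 c0.
by rewrite /=; ring.
Qed.

End Crystal.

(** * Rationality and generic identities *)

Section RationalFunctions.
Variables (K : fieldType) (X : Type) (A : atlas K X).
Hypothesis varA : is_variety A.

Lemma rational_to_Gm (F : X -> option (Gm K)) (g : X -> K) :
  (exists x c, F x = Some c) ->
  (forall x c, F x = Some c ->
     reg_at A x g /\ near A x (fun x' => F x' = to_Gm (g x'))) ->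
  is_rational A (Gm_atlas K) F.
Proof.
move=> neF locF; apply: (is_rationalI varA (Gm_variety K)) => // x c Fx; exists tt.
have [rg nF] := locF x c Fx; have Fx' := near_self nF; rewrite Fx in Fx'.
have gx : g x != 0 by move/esym/to_GmP: Fx' => <-; apply: (valP c).
have nFg := nearI varA nF (reg_at_neq0 rg gx); split=> //.
  apply: near_mono nFg => x' [-> gx'].
  by have [c' c'E _] := to_Gm_neq0 gx'; exists c'.
apply: (reg_mx_near varA (g := fun x' => \row_(j < 2) (if j == 0 then g x' else (g x')^-1))).
  apply: near_mono nFg => x' [-> gx'].
  by have [c' -> <-] := to_Gm_neq0 gx'.
move=> i j; apply: (fr_ext (reg_at_ring varA x) (g := fun x' => if j == 0 then g x' else (g x')^-1)).
  by move=> x'; rewrite mxE.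
by case: (j == 0) => //; apply: reg_at_inv.
Qed.

Lemma rational_to_torus n (g : 'I_n -> X -> K) :
  (exists x, forall i, g i x != 0) ->
  (forall x, (forall i, g i x != 0) -> forall i, reg_at A x (g i)) ->
  is_rational A (torus_atlas K n) (fun x => insub (\row_i g i x)).
Proof.
move=> [x0 gx0] rg.
have defF x : (forall i, g i x != 0) ->
    exists2 z : torus K n, insub (\row_i g i x) = Some z & val z = \row_i g i x.
  move=> gx; have zP : [forall i, (\row_i g i x) 0 i != 0] by apply/forallP => i; rewrite mxE.
  by exists (exist _ (\row_i g i x) zP); rewrite // insubT.
apply: (is_rationalI varA (torus_variety K n)).
  by have [z zE _] := defF x0 gx0; exists x0, z.
move=> x z; case: insubP => // z' gx _ [_]; exists tt.
have {}gx i : g i x != 0 by move/forallP/(_ i): gx; rewrite mxE.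
have ng : near A x (fun x' => forall i, g i x' != 0).
  by apply: (near_forall varA) => i; apply: reg_at_neq0 => //; apply: rg.
split=> //; first by apply: near_mono ng => x' /defF[z1 zE _]; exists z1.
apply: (reg_mx_near varA (g := fun x' => row_mx (\row_i g i x') (\row_i (g i x')^-1))).
  apply: near_mono ng => x' /defF[z1 -> /= ->]; congr row_mx.
  by apply/rowP => i; rewrite !mxE.
have fr := reg_at_ring varA x.
apply: (mx_in_row_mx fr) => i j.
  by apply: (fr_ext fr (g := g j)) => [x'|]; [rewrite mxE | apply: rg].
apply: (fr_ext fr (g := fun x' => (g j x')^-1)) => [x'|]; first by rewrite mxE.
by apply: reg_at_inv => //; apply: rg.
Qed.

Lemma rational_generic (Y : Type) (B : atlas K Y) (F : X -> option Y) :
  is_rational A B F -> generically A (fun x => exists y, F x = Some y).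
Proof.
move=> [[x [y Fx]] ratF]; exists (preim_opt F (fun _ => True)); split.
- have [] // := ratF (fun _ => True); move=> a.
  exists (fun p => p = 1) => z _; split=> // /(_ 1 erefl)/eqP.
  by rewrite /peval meval1 oner_eq0.
- by exists x, y.
- by move=> z [y' Fz _]; exists y'.
Qed.

End RationalFunctions.

Lemma reg_at_Gm (K : fieldType) (c : Gm K) : reg_at (Gm_atlas K) c val.
Proof.
exists tt => //.
have rc := creg_polyfun (A := Gm_atlas K) (a := tt) c (@polyfun_coord K 2 0).
by apply: creg_near rc; apply: cnear_all => x _; rewrite mxE.
Qed.

Lemma fr_wdet (K : fieldType) (k n' : nat) (T : Type) (S : (T -> K) -> Prop)
    (h : T -> 'M[K]_(n'.+1, k)) (w : nat -> int) :
  fun_ring S -> mx_in S h -> S (fun x => wdet (h x) w).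
Proof.
move=> fr Sh; apply: (fr_det fr) => a j.
apply: (fr_ext fr (g := fun x => twist K k ^ ((w a - 1) %/ n'.+1%:Z)%Z *
  h x (inord `|((w a - 1) %% n'.+1%:Z)%Z|%N) j)); first by move=> x; rewrite !mxE.
by apply: (fr_mul fr) => //; apply: (fr_cst fr).
Qed.

Section CrystalStructure.
Variables (K : fieldType) (k n' : nat) (u : nat -> K).
Local Notation n := n'.+1.
Hypotheses (k_gt0 : (0 < k)%N) (k_lt_n : (k < n)%N) (inj_u : injective u).
Implicit Types (B : 'M[K]_(n, k)) (i j : 'I_n) (x y : Xk K n k) (c : Gm K).
Local Notation A := (Xk_atlas K n k).
Local Notation "'P_ B j" := (wdet B (wP k j)) (at level 10, B at level 8, j at level 8).
Local Notation "'N_ B j" := (wdet B (wN k j)) (at level 10, B at level 8, j at level 8).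

Let varGr : is_variety (Gr_atlas K k n) := Gr_variety K n k_gt0.
Let varGm : is_variety (Gm_atlas K) := Gm_variety K.
Let varA : is_variety A := Xk_variety K n k_gt0.
Let irrA : irreducible_space A := Xk_irreducible k_gt0 inj_u (ltnW k_lt_n).

Lemma near_chart_dom x J : maxminor (gr_mx x.1) J != 0 ->
  near A x (fun y => maxminor (gr_mx y.1) J != 0).
Proof.
move=> xJ; apply: (near_fst varGm (P := fun M => maxminor (gr_mx M) J != 0)).
by exists J => //; apply: cnear_all.
Qed.

Lemma reg_chart_mx x J : maxminor (gr_mx x.1) J != 0 ->
  mx_in (reg_at A x) (fun y => chart_mx J y.1).
Proof.
move=> xJ r s; apply: (reg_at_fst varGm (g := fun M => chart_mx J M r s)).
by exists J => //; apply: creg_chart_mx.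
Qed.

Lemma reg_t x : reg_at A x (fun y => val y.2).
Proof. by apply: (reg_at_snd varGr (g := val)); apply: reg_at_Gm. Qed.

(** [gr_mx] comes from an arbitrary choice of basis, so a single coordinate of it need not be
    regular; the ratio can be computed from the chart matrix, which is. *)
Lemma reg_plucker_ratio (I J : seq int) x : plucker J x.1 != 0 ->
  reg_at A x (fun y => plucker I y.1 / plucker J y.1).
Proof.
move=> xJ; have [L xL] := chart_cover k_gt0 x.1; have fr := reg_at_ring varA x.
have rm H : reg_at A x (fun y => maxminor (chart_mx L y.1) H).
  apply: (fr_ext fr (g := fun y => \det (rows_mx (chart_mx L y.1) H))).
    by move=> y; rewrite maxminorE.
  by apply: (fr_det fr); apply: (mx_in_rows_mx _ fr); apply: reg_chart_mx.
apply: (reg_at_near varA (g := fun y =>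
  maxminor (chart_mx L y.1) (residues n I) / maxminor (chart_mx L y.1) (residues n J))).
  apply: near_mono (near_chart_dom xL) => y yL.
  by rewrite (plucker_ratio k_gt0 _ _ (chart_mx_spans k_gt0 yL)).
apply: (reg_at_div varA) => //; move: xJ; rewrite /plucker.
have [g _ xE] := chart_mx_spans k_gt0 xL; rewrite {1}xE maxminorM // mulf_eq0 negb_or.
by move=> /andP[].
Qed.

(** Covers both uses of rationality: c varying together with x over the product with the torus, and
    c fixed. *)
Lemma Xe_rational_along (Z : Type) (C : atlas K Z) (cz : Z -> Gm K) (xz : Z -> Xk K n k) i :
  is_variety C ->
  (forall z, reg_at C z (fun z' => val (cz z'))) ->
  (forall z g, reg_at A (xz z) g -> reg_at C z (fun z' => g (xz z'))) ->
  (forall z P, near A (xz z) P -> near C z (fun z' => P (xz z'))) ->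
  (exists z v, Xphi i (xz z) = Some v) ->
  is_rational C A (fun z => Xe i (cz z) (xz z)).
Proof.
move=> varC rc rx nx [z0 [v0 phi0]]; apply: (rational_into_Xk k_gt0 varC).
  by exists z0; rewrite (Xe_phi k_gt0 k_lt_n (cz z0) (spans_self _) phi0); eexists.
move=> z y ez; have [J zJ] := chart_cover k_gt0 (xz z).1.
have sz := chart_mx_spans k_gt0 zJ.
have [P0 N0 _ _] := Xe_spans k_gt0 k_lt_n sz ez; have fr := reg_at_ring varC z.
have rB : mx_in (reg_at C z) (fun z' => chart_mx J (xz z').1).
  by move=> r s; apply: (rx z (fun x => chart_mx J x.1 r s)); apply: reg_chart_mx.
have rP := fr_wdet (wP k i%:Z) fr rB; have rN := fr_wdet (wN k i%:Z) fr rB.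
exists (fun z' => emx (chart_mx J (xz z').1) i (cz z')), (fun z' => val (xz z').2); split.
- apply: (mx_in_mul fr) => //; apply: (mx_in_add fr); first exact: (mx_in_cst fr).
  apply: (mx_in_scale fr); last exact: (mx_in_cst fr).
  apply: (fr_ext fr (g := fun z' => xcoef k i 1 * ecoef (chart_mx J (xz z').1) i (cz z'))).
    by move=> z'; rewrite -xcoefE.
  apply: (fr_mul fr); first exact: (fr_cst fr).
  apply: (reg_at_div varC) => //; apply: (fr_mul fr) => //.
  by apply: (fr_sub fr) => //; apply: (fr_cst fr).
- by apply: (rx z (fun x => val x.2)); apply: reg_t.
- have nJ := nx z _ (near_chart_dom zJ).
  have nPN := nearI varC (reg_at_neq0 rP P0) (reg_at_neq0 rN N0).
  apply: near_mono (nearI varC nJ nPN) => z' [z'J [P0' N0']].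
  have [y' ey' [ty' sy']] := Xe_def k_gt0 k_lt_n (cz z') (chart_mx_spans k_gt0 z'J) P0' N0'.
  by exists y' => //; rewrite ty'.
Qed.

Lemma generic_minor (J : {set 'I_n}) : #|J| = k ->
  generically A (fun x => maxminor (gr_mx x.1) J != 0).
Proof.
move=> cardJ; exists (fun x => maxminor (gr_mx x.1) J != 0); split=> //.
  by apply/(zopen_near varA) => x; apply: near_chart_dom.
by have [M MJ] := maxminor_neq0_exists K k_gt0 cardJ; exists (M, gm1 K).
Qed.

(** Because k < n, each of these index sets has k distinct residues, so the corresponding coordinate
    is nonzero at a coordinate subspace; irreducibility combines the finitely many open
    conditions. *)
Lemma generic_PN : generically A (fun x => forall i,
  'P_ (gr_mx x.1) i%:Z != 0 /\ 'N_ (gr_mx x.1) i%:Z != 0).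
Proof.
apply: (generically_forall varA irrA) => i; have iln := ltn_ord i.
apply: (generically_and varA irrA).
  apply: generically_mono (generic_minor (J := wset k n' (wP k i%:Z)) _) => [x|].
    by rewrite -(residues_wP k_gt0 k_lt_n) maxminor_wP //; lia.
  by apply: (card_wset k_gt0) => a b; rewrite /wP; lia.
apply: generically_mono (generic_minor (J := wset k n' (wN k i%:Z)) _) => [x|].
  by rewrite -(residues_wN k_gt0 k_lt_n) maxminor_wN //; lia.
apply: (card_wset k_gt0) => a b abk; rewrite /wN /upd /wP; have -> : (a == k.-1) = false by lia.
by case: eqP; lia.
Qed.

Lemma exists_PN : exists x, forall i, 'P_ (gr_mx x.1) i%:Z != 0 /\ 'N_ (gr_mx x.1) i%:Z != 0.
Proof. by have [U [_ [x Ux] UP]] := generic_PN; exists x; apply: UP. Qed.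

Lemma P_neq0 B (j : int) : (forall i, 'P_ B i%:Z != 0) -> -1 <= j <= n%:Z -> 'P_ B j != 0.
Proof.
move=> P0 jn; have [j0|j0] := ltrP j 0.
  rewrite -(wdet_wPn k_gt0 k_lt_n) (_ : j + n%:Z = (@ord_max n')%:Z); first exact: P0.
  by rewrite /=; lia.
have [jn'|jn'] := ltrP j n%:Z; last first.
  rewrite (_ : j = (@ord0 n')%:Z + n%:Z) ?(wdet_wPn k_gt0 k_lt_n); first exact: P0.
  by rewrite /=; lia.
case: j j0 jn jn' => // m _ _ mn; exact: (P0 (Ordinal (mn : (m < n)%N))).
Qed.

Lemma Xphi_rational i : is_rational A (Gm_atlas K) (Xphi (k := k) i).
Proof.
apply: (rational_to_Gm varA (g := fun x => val x.2 ^- (i == 0 :> nat)%N *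
    (plucker (rcons (zint (i%:Z - k%:Z + 1) (i%:Z - 1)) (i%:Z + 1)) x.1 /
     plucker (zint (i%:Z - k%:Z + 1) i%:Z) x.1))).
  have [x PN] := exists_PN; have [P0 N0] := PN i.
  by have [v phix _] := Xphi_def k_gt0 k_lt_n (spans_self x.1) P0 N0; exists x, v.
move=> x v; rewrite /Xphi => /to_GmP vE; have := valP v; rewrite vE.
rewrite !mulf_eq0 !negb_or !invr_eq0 => /and3P[t0 _ P0]; split; last first.
  by have [a ax] := var_cover varA x; exists a => //; apply: cnear_all.
have fr := reg_at_ring varA x; apply: (fr_mul fr); last exact: reg_plucker_ratio.
by apply: (reg_at_inv (g := fun y => val y.2 ^+ _)) => //; apply: (fr_exp fr); apply: reg_t.
Qed.

Lemma Xeps_def i x B : spans x.1 B -> (forall r : 'I_n, 'P_ B r%:Z != 0) -> 'N_ B i%:Z != 0 ->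
  exists2 v, Xeps i x = Some v & val v = val x.2 ^- (i == k :> nat)%N *
    (('N_ B i%:Z * 'P_ B i%:Z) / ('P_ B (i%:Z - 1) * 'P_ B (i%:Z + 1))).
Proof.
move=> sx P0 N0; rewrite (Xeps_spans k_gt0 k_lt_n _ sx); apply: to_Gm_neq0.
have iln := ltn_ord i; have [t0 Pi0] := (valP x.2, P0 i).
have P1 : 'P_ B (i%:Z - 1) != 0 by apply: P_neq0 => //; lia.
have P2 : 'P_ B (i%:Z + 1) != 0 by apply: P_neq0 => //; lia.
by rewrite !mulf_neq0 ?invr_eq0 ?expf_neq0 ?mulf_neq0.
Qed.

Lemma Xeps_rational i : is_rational A (Gm_atlas K) (Xeps (k := k) i).
Proof.
apply: (rational_to_Gm varA (g := fun x => val x.2 ^- (i == k :> nat)%N *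
    ((plucker (rcons (zint (i%:Z - k%:Z + 1) (i%:Z - 1)) (i%:Z + 1)) x.1 *
      plucker (zint (i%:Z - k%:Z + 1) i%:Z) x.1) /
     (plucker (zint (i%:Z - k%:Z) (i%:Z - 1)) x.1 *
      plucker (zint (i%:Z - k%:Z + 2) (i%:Z + 1)) x.1)))).
  have [x PN] := exists_PN.
  have [|v epsx _] := Xeps_def (spans_self x.1) _ (PN i).2; first by move=> r; case: (PN r).
  by exists x, v.
move=> x v; rewrite /Xeps => /to_GmP vE; have := valP v; rewrite vE.
rewrite mulf_eq0 negb_or invr_eq0 => /andP[t0].
rewrite mulf_eq0 negb_or invr_eq0 [_ * plucker (zint (_ + 2) _) _ == 0]mulf_eq0 negb_or.
move=> /andP[_ /andP[P1 P2]]; split; last first.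
  by have [a ax] := var_cover varA x; exists a => //; apply: cnear_all.
have fr := reg_at_ring varA x; apply: (fr_mul fr).
  by apply: (reg_at_inv (g := fun y => val y.2 ^+ _)) => //; apply: (fr_exp fr); apply: reg_t.
apply: (fr_ext fr) (fr_mul fr (reg_plucker_ratio _ P1) (reg_plucker_ratio _ P2)) => y.
exact: mulf_div.
Qed.

Lemma Xgamma_def x B : spans x.1 B -> (forall r : 'I_n, 'P_ B r%:Z != 0) ->
  exists2 z, Xgamma x = Some z & forall i, val z 0 i =
    (if (1 <= i <= k)%N then 1 else val x.2) * ('P_ B i%:Z / 'P_ B (i%:Z - 1)).
Proof.
move=> sx P0; rewrite (Xgamma_spans k_gt0 k_lt_n sx); set w := \row_i _.
have wP : [forall i, w 0 i != 0].
  apply/forallP => i; have iln := ltn_ord i; have Pi0 := P0 i.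
  have P1 : 'P_ B (i%:Z - 1) != 0 by apply: P_neq0 => //; lia.
  rewrite mxE !mulf_neq0 ?invr_eq0 //; case: ifP => _; rewrite ?oner_neq0 //.
  exact: (valP x.2).
by exists (exist _ w wP); [rewrite insubT | move=> i; rewrite mxE].
Qed.

Lemma Xgamma_rational : is_rational A (torus_atlas K n) (@Xgamma K n k).
Proof.
apply: (rational_to_torus varA (g := fun i x => (if (1 <= i <= k)%N then 1 else val x.2) *
     (plucker (zint (i%:Z - k%:Z + 1) i%:Z) x.1 /
      plucker (zint (i%:Z - k%:Z) (i%:Z - 1)) x.1))).
  have [x PN] := exists_PN; exists x => i.
  have [|z] := Xgamma_def (spans_self x.1); first by move=> r; case: (PN r).
  rewrite /Xgamma; case: insubP => // z' /forallP/(_ i); rewrite mxE => + _ _ _.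
  by [].
move=> x gx i; have fr := reg_at_ring varA x; apply: (fr_mul fr).
  by case: (1 <= i <= k)%N; [apply: (fr_cst fr) | apply: reg_t].
apply: reg_plucker_ratio; have := gx i.
by rewrite !mulf_eq0 !negb_or invr_eq0 => /and3P[].
Qed.

Lemma Xf_def x B : spans x.1 B -> (forall r : 'I_n, 'P_ B r%:Z != 0) ->
  Xf x = to_Gm (\sum_(r < n) fterm (val x.2) B r).
Proof. by move=> sx P0; rewrite (Xf_spans k_gt0 k_lt_n sx) ifT //; apply/forallP. Qed.

Lemma Xf_neq0 x B w : spans x.1 B -> Xf x = Some w ->
  (forall r : 'I_n, 'P_ B r%:Z != 0) /\ val w = \sum_(r < n) fterm (val x.2) B r.
Proof.
move=> sx; rewrite (Xf_spans k_gt0 k_lt_n sx); case: ifP => // /forallP P0 /to_GmP ->.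
by [].
Qed.

Lemma emx_P_neq0 B i c : (forall r : 'I_n, 'P_ B r%:Z != 0) -> 'N_ B i%:Z != 0 ->
  forall r : 'I_n, 'P_ (emx B i c) r%:Z != 0.
Proof.
move=> P0 N0 r; have [<-|ir] := eqVneq i r; last by rewrite emx_P_far.
by rewrite emx_P // mulf_neq0 // (valP c).
Qed.

(* If [f] vanishes at [x], the decoration formula, whose proof does not use [f <> 0], shows that it
   does not vanish at [e_i^c x] for general [c]. *)
Lemma Xf_nonzero : exists x w, Xf x = Some w :> option (Gm K).
Proof.
have [x PN] := exists_PN; have sx := spans_self x.1; move: (gr_mx x.1) sx PN => B sx PN.
have P0 (r : 'I_n) : 'P_ B r%:Z != 0 by case: (PN r).
have [_ N0] := PN ord0; have t0 := valP x.2.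
have fE c := emx_fsum k_gt0 k_lt_n (val x.2) c P0 N0.
move: fE; set fx := \sum_(r < n) _; set al := _ * ('P_ B _ / _); set be := _ ^+ _ * _ => fE.
have al0 : al != 0.
  apply: mulf_neq0; first exact: expf_neq0.
  by apply: mulf_neq0; [apply: P0 | rewrite invr_eq0].
have [fx0|fx0] := eqVneq fx 0; last first.
  by have [w fw _] := to_Gm_neq0 fx0; exists x, w; rewrite (Xf_def sx P0).
(* If f vanishes at x, the value at e_0^s x is (s-1) al + (1/s-1) be = (s-1)(s - be/al) al/s. Hence
   s only has to avoid 0, 1 and be/al. *)
have p0 : 'X * ('X - 1%:P) * ('X - (be / al)%:P) != 0 :> {poly K}.
  by rewrite !mulf_neq0 ?polyX_eq0 ?polyXsubC_eq0.
have [s] := nonroot_exists inj_u p0; rewrite !hornerE !mulf_eq0 !negb_or -andbA.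
move=> /and3P[s0 s1 sab]; pose c : Gm K := exist _ s s0.
have [y _ [ty sy]] := Xe_def k_gt0 k_lt_n c sx (P0 ord0) N0.
have fy0 : \sum_(r < n) fterm (val y.2) (emx B ord0 c) r != 0.
  rewrite ty fE fx0 add0r /= (_ : _ + _ = (s - 1) * (s - be / al) * (al / s)); last first.
    by field; rewrite s0 al0.
  by rewrite !mulf_neq0 ?invr_eq0.
have [w fw _] := to_Gm_neq0 fy0; exists y, w; rewrite (Xf_def sy) //.
exact: emx_P_neq0.
Qed.

Lemma Xf_rational : is_rational A (Gm_atlas K) (@Xf K n k).
Proof.
apply: (rational_to_Gm varA (g := @Xf_value K n k)); first exact: Xf_nonzero.
move=> x w fx; have [P0 _] := Xf_neq0 (spans_self x.1) fx.
have pl0 (j : nat) : (j <= n)%N -> plucker (zint (j%:Z - k%:Z + 1) j%:Z) x.1 != 0.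
  by move=> jn; rewrite /plucker maxminor_wP //; apply: P_neq0.
split; last first.
  have : near A x (fun y => forall i, plucker (zint (i%:Z - k%:Z + 1) i%:Z) y.1 != 0).
    by apply: (near_forall varA) => i; apply: near_chart_dom; apply: pl0; apply: ltnW.
  by apply: near_mono => y yP; rewrite /Xf ifT //; apply/forallP.
have fr := reg_at_ring varA x; apply: (fr_add fr).
  (* The range is repeated in the filter so that the bound i <= n is available for each summand. *)
  apply: (fr_ext fr (g := fun y => \sum_(1 <= i < n.+1 | (1 <= i < n.+1)%N && (i != k))
      plucker ((i%:Z - k%:Z) :: zint (i%:Z - k%:Z + 2) i%:Z) y.1 /
      plucker (zint (i%:Z - k%:Z + 1) i%:Z) y.1)).
    by move=> y; rewrite -big_nat_cond.
  apply: (fr_sum fr) => i /andP[/andP[_ iln] _].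
  by apply: reg_plucker_ratio; apply: pl0.
apply: (fr_mul fr); first exact: reg_t.
apply: reg_plucker_ratio; have := pl0 k (ltnW k_lt_n).
by rewrite (_ : k%:Z - k%:Z + 1 = 1) //; lia.
Qed.

Lemma Xphi_exists i : exists (x : Xk K n k) v, Xphi i x = Some v.
Proof. by have [[x [v phix]] _] := Xphi_rational i; exists x, v. Qed.

Lemma Xe_rational i c : is_rational A A (Xe (k := k) i c).
Proof.
apply: (Xe_rational_along (cz := fun _ => c) (xz := id)) => //.
  by move=> z; apply: (fr_cst (reg_at_ring varA z)).
by have [x [v phix]] := Xphi_exists i; exists x, v.
Qed.

(* [e_i^c] is dominant, with inverse [e_i^(1/c)]. *)
Lemma generic_e i c (P : Xk K n k -> Prop) : generically A P ->
  generically A (fun x => exists2 y, Xe i c x = Some y & P y).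
Proof.
move=> [U [opU neU UP]]; have gphi := rational_generic (Xphi_rational i).
have gU : generically A U by exists U.
have [V [_ [x Vx] /(_ x Vx)[Ux [v phix]]]] := generically_and varA irrA gU gphi.
have [opW _] := (Xe_rational i c).2 U opU.
exists (preim_opt (Xe i c) U); split=> //; last by move=> y [z ey /UP]; exists z.
pose d : Gm K := exist _ (val c)^-1 (invr_neq0 (valP c)).
have := Xe_mul k_gt0 k_lt_n c d phix.
have -> : gm_mul c d = gm1 K by apply: val_inj; rewrite /= divff // (valP c).
rewrite (Xe_1 k_gt0 k_lt_n phix); case: (Xe i d x) => //= y ey.
by exists y, x.
Qed.

Lemma Xe_action i : rational_unital_action A (Xe (k := k) i).
Proof.
have gphi := rational_generic (Xphi_rational i); split.
- apply: (Xe_rational_along (C := prod_atlas (Gm_atlas K) A) (cz := fst) (xz := snd)).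
  + exact: prod_variety.
  + by move=> z; apply: (reg_at_fst varA (g := val)); apply: reg_at_Gm.
  + by move=> z g; apply: reg_at_snd.
  + by move=> z P; apply: near_snd.
  + by have [x [v phix]] := Xphi_exists i; exists (gm1 K, x), v.
(* The identity agrees with e_i^1 wherever phi_i is defined, and it provides the value at all
   remaining points. *)
- move=> x; exists Some; split=> //; first by apply: is_rational_id; exists x.
  by apply: generically_mono gphi => y [v /(Xe_1 k_gt0 k_lt_n)]; exists y.
- move=> c1 c2; apply: generically_mono gphi => x [v phix].
  have sx := spans_self x.1; have [P0 N0] := Xphi_neq0 k_gt0 k_lt_n sx phix.
  have [y ey _] := Xe_def k_gt0 k_lt_n (gm_mul c1 c2) sx P0 N0.
  by exists y; rewrite ?(Xe_mul k_gt0 k_lt_n c1 c2 phix).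
Qed.

(** The weight of gamma drops from t to 1 between the components 0 and 1 and returns to t between k
    and k+1; these two jumps are the powers of t in phi_0 and eps_k. *)
Lemma gamma_weight (t : K) i : t != 0 ->
  t ^- (i == k :> nat)%N * (if (1 <= ordS i <= k)%N then 1 else t) =
  t ^- (i == 0 :> nat)%N * (if (1 <= i <= k)%N then 1 else t).
Proof.
move=> t0; have := ltn_ord (ordS i); have := ltn_ord i; have := ordS_shift k_gt0 k_lt_n i.
move: (nat_of_ord (ordS i)) (nat_of_ord i) => a b ab bn an.
case: (b =P 0%N) => [b0|b0]; case: (b =P k) => [bk|bk]; try lia.
- rewrite ifT ?ifF ?expr0 ?expr1 ?invr1 ?mul1r ?mulVf //; lia.
- rewrite ifF ?ifT ?expr0 ?expr1 ?invr1 ?mul1r ?mulVf //; lia.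
- by have -> : (0 < a <= k)%N = (0 < b <= k)%N by lia.
Qed.

Lemma eps_phi_gamma i x : (forall i, 'P_ (gr_mx x.1) i%:Z != 0 /\ 'N_ (gr_mx x.1) i%:Z != 0) ->
  exists u v z, [/\ Xeps i x = Some u, Xphi i x = Some v, Xgamma x = Some z
      & val u = val v * alpha i z].
Proof.
move=> PN; have sx := spans_self x.1; move: (gr_mx x.1) sx PN => B sx PN.
have P0 (r : 'I_n) : 'P_ B r%:Z != 0 by case: (PN r).
have [_ N0] := PN i; have t0 := valP x.2.
have [eu eE uE] := Xeps_def sx P0 N0; have [v pE vE] := Xphi_def k_gt0 k_lt_n sx (P0 i) N0.
have [z gE zE] := Xgamma_def sx P0; exists eu, v, z; split=> //.
rewrite uE vE /alpha !zE P_ordS //.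
have -> : 'P_ B ((ordS i)%:Z - 1) = 'P_ B i%:Z.
  case: (ordS_shift k_gt0 k_lt_n i) => iS; first by congr (wdet _ (wP _ _)); lia.
  by rewrite -(wdet_wPn k_gt0 k_lt_n); congr (wdet _ (wP _ _)); lia.
have iln := ltn_ord i.
have P1 : 'P_ B (i%:Z - 1) != 0 by apply: P_neq0 => //; lia.
have P2 : 'P_ B (i%:Z + 1) != 0 by apply: P_neq0 => //; lia.
have := gamma_weight i t0; have Pi0 := P0 i.
have : (if (1 <= ordS i <= k)%N then 1 else val x.2) != 0 by case: ifP; rewrite ?oner_neq0.
set s1 := if (1 <= ordS i <= k)%N then _ else _; set s2 := if _ then _ else _.
set r1 := _ ^- (i == k :> nat); set r2 := _ ^- _ => s10 rs.
have -> : r1 = r2 * s2 / s1 by rewrite -rs mulfK.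
by field; rewrite s10 P2 P1 Pi0.
Qed.

(** The coordinate P_(j-1) is the denominator of gamma_j, so its scaling at j = i+1 is the source of
    the factor 1/c in that component. *)
Lemma emx_P_pred B i c j : 'N_ B i%:Z != 0 ->
  'P_ (emx B i c) (j%:Z - 1) = (if j == ordS i then val c else 1) * 'P_ B (j%:Z - 1).
Proof.
move=> N0; have [iln jln] := (ltn_ord i, ltn_ord j).
have iS := ordS_shift k_gt0 k_lt_n i; case: eqP => [->|/eqP].
  case: iS => iS; first by rewrite (_ : (ordS i)%:Z - 1 = i%:Z) ?emx_P //; lia.
  rewrite -!(wdet_wPn k_gt0 k_lt_n _ (_ - 1)) (_ : (ordS i)%:Z - 1 + n%:Z = i%:Z) ?emx_P //.
  by lia.
have Sln := ltn_ord (ordS i); rewrite -val_eqE => /= jS; rewrite mul1r.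
have {}jS : j%:Z != (ordS i)%:Z by rewrite eqz_nat.
by rewrite emx_P_other //; move: (nat_of_ord (ordS i)) iS jS Sln => a; lia.
Qed.

Lemma gamma_e i c x : (forall i, 'P_ (gr_mx x.1) i%:Z != 0 /\ 'N_ (gr_mx x.1) i%:Z != 0) ->
  exists y z z', [/\ Xe i c x = Some y, Xgamma x = Some z, Xgamma y = Some z'
      & forall j, val z' 0 j = alpha_vee i c j * val z 0 j].
Proof.
move=> PN; have sx := spans_self x.1; move: (gr_mx x.1) sx PN => B sx PN.
have P0 (r : 'I_n) : 'P_ B r%:Z != 0 by case: (PN r).
have [_ N0] := PN i; have c0 := valP c.
have [y ey [ty sy]] := Xe_def k_gt0 k_lt_n c sx (P0 i) N0.
have [z gz zE] := Xgamma_def sx P0.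
have [z' gz' z'E] := Xgamma_def sy (emx_P_neq0 c P0 N0).
exists y, z, z'; split=> // j; rewrite zE z'E ty emx_P_pred // /alpha_vee.
have jln := ltn_ord j; have Pj0 := P0 j.
have P1 : 'P_ B (j%:Z - 1) != 0 by apply: P_neq0 => //; lia.
have iSi : i != ordS i.
  by rewrite eq_sym; have := ord_pred_neq k_gt0 k_lt_n (ordS i); rewrite ordSK.
have [->|ji] := eqVneq j i.
  rewrite (negPf iSi) emx_P // mul1r; ring.
rewrite emx_P_far 1?eq_sym //; case: eqP => _.
  by field; rewrite P1 c0.
by rewrite !mul1r.
Qed.

Lemma phi_e i c x : (forall i, 'P_ (gr_mx x.1) i%:Z != 0 /\ 'N_ (gr_mx x.1) i%:Z != 0) ->
  exists y v v', [/\ Xe i c x = Some y, Xphi i x = Some v, Xphi i y = Some v'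
      & val v' = (val c)^-1 * val v].
Proof.
move=> PN; have sx := spans_self x.1; move: (gr_mx x.1) sx PN => B sx PN.
have [[P0 N0] c0] := (PN i, valP c).
have [y ey [ty sy]] := Xe_def k_gt0 k_lt_n c sx P0 N0.
have [v pv vE] := Xphi_def k_gt0 k_lt_n sx P0 N0.
have [||v' pv' v'E] := Xphi_def (i := i) k_gt0 k_lt_n sy; rewrite ?emx_P ?emx_N ?mulf_neq0 //.
exists y, v, v'; split=> //; rewrite v'E vE ty emx_P // emx_N // invfM; ring.
Qed.

Lemma eps_e i c x : (forall i, 'P_ (gr_mx x.1) i%:Z != 0 /\ 'N_ (gr_mx x.1) i%:Z != 0) ->
  exists y w w', [/\ Xe i c x = Some y, Xeps i x = Some w, Xeps i y = Some w'
      & val w' = val c * val w].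
Proof.
move=> PN; have sx := spans_self x.1; move: (gr_mx x.1) sx PN => B sx PN.
have P0 (r : 'I_n) : 'P_ B r%:Z != 0 by case: (PN r).
have [_ N0] := PN i; have iln := ltn_ord i.
have [y ey [ty sy]] := Xe_def k_gt0 k_lt_n c sx (P0 i) N0.
have [w ew wE] := Xeps_def sx P0 N0.
have N0' : 'N_ (emx B i c) i%:Z != 0 by rewrite emx_N.
have [w' ew' w'E] := Xeps_def sy (emx_P_neq0 c P0 N0) N0'.
exists y, w, w'; split=> //; rewrite w'E wE ty emx_P // emx_N //.
rewrite ![in LHS]emx_P_other //; try lia; ring.
Qed.

Lemma decoration_e i c x w y w' :
  (forall i, 'P_ (gr_mx x.1) i%:Z != 0 /\ 'N_ (gr_mx x.1) i%:Z != 0) ->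
  Xf x = Some w -> Xe i c x = Some y -> Xf y = Some w' ->
  exists eu v, [/\ Xeps i x = Some eu, Xphi i x = Some v
      & val w' = val w + (val c - 1) / val v + ((val c)^-1 - 1) / val eu].
Proof.
move=> PN fx ex fy; have sx := spans_self x.1; move: (gr_mx x.1) sx PN => B sx PN.
have P0 (r : 'I_n) : 'P_ B r%:Z != 0 by case: (PN r).
have [_ N0] := PN i; have [_ _ ty sy] := Xe_spans k_gt0 k_lt_n sx ex.
have [eu eE uE] := Xeps_def sx P0 N0; have [v pE vE] := Xphi_def k_gt0 k_lt_n sx (P0 i) N0.
exists eu, v; split=> //.
have [_ ->] := Xf_neq0 sx fx; have [_ ->] := Xf_neq0 sy fy.
by rewrite ty emx_fsum // vE uE !invfM !invrK; ring.
Qed.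

Lemma e_comm i j c1 c2 : i != j -> ~~ adjacent i j ->
  Defs.rat_eq A (fun x => obind (Xe i c1) (Xe j c2 x)) (fun x => obind (Xe j c2) (Xe i c1 x)).
Proof.
move=> ij adj; have ji : j != i by rewrite eq_sym.
have adj' : ~~ adjacent j i by rewrite /adjacent orbC.
apply: generically_mono generic_PN => x; have sx := spans_self x.1.
move: (gr_mx x.1) sx => B sx PN; have [[Pi0 Ni0] [Pj0 Nj0]] := (PN i, PN j).
have [y ey [ty sy]] := Xe_def k_gt0 k_lt_n c1 sx Pi0 Ni0.
have [z ez [tz sz]] := Xe_def k_gt0 k_lt_n c2 sx Pj0 Nj0.
have [||y' ey' [ty' sy']] := Xe_def (i := j) k_gt0 k_lt_n c2 sy;
  rewrite ?emx_P_far ?emx_N_far //.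
have [||z' ez' [tz' sz']] := Xe_def (i := i) k_gt0 k_lt_n c1 sz;
  rewrite ?emx_P_far ?emx_N_far //.
exists y'; rewrite ?ey ?ez /= ?ez' //; congr Some.
by apply: Xk_eq sz' _ _; [rewrite emx_comm | rewrite tz' tz ty' ty].
Qed.

(** All six intermediate points exist generically by [generic_e]. The non-vanishing conditions of
    [emx_braid] are then read off from the existence of these points instead of being checked
    separately. *)
Lemma e_braid i c1 c2 (j := ordS i) : (2 < n)%N ->
  Defs.rat_eq A
    (fun x => obind (Xe i c1) (obind (Xe j (gm_mul c1 c2)) (Xe i c2 x)))
    (fun x => obind (Xe j c2) (obind (Xe i (gm_mul c1 c2)) (Xe j c1 x))).
Proof.
move=> n2; pose D i c := rational_generic (Xe_rational i c).
have g1 := generic_e i c2 (generic_e j (gm_mul c1 c2) (D i c1)).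
have g2 := generic_e j c1 (generic_e i (gm_mul c1 c2) (D j c2)).
apply: generically_mono (generically_and varA irrA g1 g2) => x.
move=> [[x1 e1 [x2 e2 [x3 e3]]] [y1 d1 [y2 d2 [y3 d3]]]].
have sx := spans_self x.1; move: (gr_mx x.1) sx => B sx.
have [Pi0 Ni0 t1 s1] := Xe_spans k_gt0 k_lt_n sx e1.
have [_ N1 t2 s2] := Xe_spans k_gt0 k_lt_n s1 e2.
have [_ N2 t3 s3] := Xe_spans k_gt0 k_lt_n s2 e3.
have [_ Nj0 r1 q1] := Xe_spans k_gt0 k_lt_n sx d1.
have [_ M1 r2 q2] := Xe_spans k_gt0 k_lt_n q1 d2.
have [_ M2 r3 q3] := Xe_spans k_gt0 k_lt_n q2 d3.
exists x3; first by rewrite e1 /= e2 /= e3.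
rewrite d1 /= d2 /= d3; congr Some; apply: Xk_eq q3 _ _; last by rewrite r3 r2 r1 t3 t2 t1.
by rewrite -emx_braid.
Qed.

Lemma rat_eq_sym (F G : Xk K n k -> option (Xk K n k)) : Defs.rat_eq A F G -> Defs.rat_eq A G F.
Proof. by apply: generically_mono => x [y Fx Gx]; exists y. Qed.

Theorem Xk_crystal : decorated_geometric_crystal A
  (@Xgamma K n k) (@Xphi K n k) (@Xeps K n k) (@Xe K n k) (@Xf K n k).
Proof.
split; last 2 first.
- exact: Xf_rational.
- move=> i c; have gf := rational_generic Xf_rational.
  (* f must be defined both at x and at e_i^c x; the latter holds generically because e_i^c is
     dominant. *)
  apply: generically_mono (generically_and varA irrA generic_PN
    (generically_and varA irrA gf (generic_e i c gf))) => x [PN [[w fx] [y ex [w' fy]]]].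
  by have [eu [v [epsx phix fE]]] := decoration_e PN fx ex fy; exists y, eu, v, w, w'.
split.
- split=> //.
  + exact: Xgamma_rational.
  + exact: Xphi_rational.
  + exact: Xeps_rational.
  + exact: Xe_action.
  + by move=> i; apply: generically_mono generic_PN => x; apply: eps_phi_gamma.
  + by move=> i c; apply: generically_mono generic_PN => x; apply: gamma_e.
  + by move=> i c; apply: generically_mono generic_PN => x; apply: phi_e.
  + by move=> i c; apply: generically_mono generic_PN => x; apply: eps_e.
- by move=> _ i j c1 c2; apply: e_comm.
(* When i follows j, the relation is that of the pair (j, i) with its two sides and c1, c2
   exchanged. *)
- move=> n2 i j c1 c2 /orP[/eqP->|/eqP->]; first exact: e_braid.
  by apply: rat_eq_sym; rewrite gm_mulC; apply: e_braid.
Qed.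

End CrystalStructure.

Theorem theorem3p8 (R : realType) (n k : nat)
    (hn : (2 <= n)%N) (hk : (1 <= k <= n - 1)%N) :
  decorated_geometric_crystal
    (@Xk_atlas (complex R) n k)
    (@Xgamma (complex R) n k)
    (@Xphi (complex R) n k)
    (@Xeps (complex R) n k)
    (@Xe (complex R) n k)
    (@Xf (complex R) n k).
Proof.
case: n hn hk => // n' hn /andP[k_gt0 k_le].
(* The embedding of the natural numbers witnesses that the complex field is infinite. *)
apply: (@Xk_crystal _ k n' (fun m => m%:R)) => //; first by lia.
by move=> a b /eqP; rewrite eqr_nat => /eqP.
Qed.
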